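(* Let $e_1,e_2,e_3$ be nonzero integers with $e_1+e_2+e_3=0$, $\gcd(e_1,e_2,e_3)\in\{1,2\}$, $e_1,e_2$ odd and $2\,\|\,e_3$. Let $n=p_1\cdots p_k$ be an odd positive square-free integer coprime with $e_1e_2e_3$, whose prime factors are quadratic residues modulo each odd prime factor of $e_1e_2e_3$. If $\mathrm{Sel}_2(E/\mathbb{Q})\cong(\mathbb{Z}/2\mathbb{Z})^2$, then every class of $\mathrm{Sel}_2'(E^{(n)})$ has a unique representative $(d_1,d_2,d_3)$ with each $d_i$ a positive divisor of $n$, and the map $(d_1,d_2,d_3)\mapsto\begin{pmatrix}\mathbf{x}\\ \mathbf{y}\end{pmatrix}$, where $\mathbf{x}=(v_{p_i}(d_1))_{i}^{\mathrm T}$, $\mathbf{y}=(v_{p_i}(d_2))_i^{\mathrm T}\in\mathbb{F}_2^k$, induces an isomorphism $$\mathrm{Sel}_2'(E^{(n)})\xrightarrow{\sim}\ker\begin{pmatrix}\mathbf{A}+\mathbf{D}_{-e_3}&\mathbf{D}_{-e_2e_3}\\ \mathbf{D}_{-e_1e_3}&\mathbf{A}+\mathbf{D}_{e_3}\end{pmatrix}.$$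
   Context: For a nonzero integer $m$, $E^{(m)}$ is $y^2=x(x-e_1m)(x+e_2m)$, $E=E^{(1)}$. For $\Lambda=(d_1,d_2,d_3)$ of nonzero square-free integers with $d_1d_2d_3$ a square, $D^{(m)}_\Lambda\subset\mathbb{P}^3$ is defined by $e_1mt^2+d_2u_2^2-d_3u_3^2=0$, $e_2mt^2+d_3u_3^2-d_1u_1^2=0$, $e_3mt^2+d_1u_1^2-d_2u_2^2=0$. $\mathrm{Sel}_2(E^{(m)}/\mathbb{Q})$ is identified with the group (componentwise multiplication) of $\Lambda\in(\mathbb{Q}^\times/\mathbb{Q}^{\times2})^3$ with $d_1d_2d_3\in\mathbb{Q}^{\times2}$ and $D^{(m)}_\Lambda(\mathbb{A}_{\mathbb{Q}})\ne\emptyset$; rational 2-torsion points correspond to $(1,1,1)$, $(-e_3m,-e_1e_3,e_1m)$, $(-e_2e_3,e_3m,-e_2m)$, $(e_2m,-e_1m,-e_1e_2)$. $\mathrm{Sel}_2'(E^{(m)})=\mathrm{Sel}_2(E^{(m)}/\mathbb{Q})/(E^{(m)}(\mathbb{Q})_{\rm tors}/2E^{(m)}(\mathbb{Q})_{\rm tors})$. $[\alpha,\beta]_v\in\mathbb{F}_2$ is the additive Hilbert symbol, $(\alpha,\beta)_v=(-1)^{[\alpha,\beta]_v}$. $\mathbf{A}=([p_j,-n]_{p_i})_{i,j}\in M_k(\mathbb{F}_2)$. For an integer $u$ coprime to $n$, $\mathbf{D}_u=\mathrm{diag}([u/p_1],\dots,[u/p_k])$, where $[u/p]\in\mathbb{F}_2$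 is $0$ if $u$ is a quadratic residue mod $p$ and $1$ otherwise. $2\,\|\,m$ means $2\mid m$, $4\nmid m$. *)

(* Defs.v *)
From HB Require Import structures.
From mathcomp Require Import all_boot all_order all_algebra.
From mathcomp Require Import Rstruct.
From Stdlib Require Import ClassicalEpsilon.
Set Implicit Arguments.
Unset Strict Implicit.
Unset Printing Implicit Defensive.
Import Order.TTheory GRing.Theory Num.Theory.
Local Open Scope ring_scope.

Definition Rreal : realFieldType := Rdefinitions.R.

Definition is_sq (a : int) : Prop := exists b : int, a = b * b.

Definition sqfree (d : int) : Prop :=
  d != 0 /\ forall p : nat, prime p -> ~~ ((p * p)%N %| absz d)%N.

Definition triple := (int * int * int)%type.
Definition t1 (L : triple) : int := L.1.1.
Definition t2 (L : triple) : int := L.1.2.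
Definition t3 (L : triple) : int := L.2.

(* The three quadratic forms defining D^{(m)}_Lambda in P^3,
   in the variables (t,u1,u2,u3), over any commutative ring. *)
Definition Deqs (S : comNzRingType) (e1 e2 e3 m : int) (L : triple)
    (t u1 u2 u3 : S) : seq S :=
  [:: (e1 * m)%:~R * t ^+ 2 + (t2 L)%:~R * u2 ^+ 2 - (t3 L)%:~R * u3 ^+ 2;
      (e2 * m)%:~R * t ^+ 2 + (t3 L)%:~R * u3 ^+ 2 - (t1 L)%:~R * u1 ^+ 2;
      (e3 * m)%:~R * t ^+ 2 + (t1 L)%:~R * u1 ^+ 2 - (t2 L)%:~R * u2 ^+ 2].

Definition D_real_pt (e1 e2 e3 m : int) (L : triple) : Prop :=
  exists t u1 u2 u3 : Rreal,
    [|| t != 0, u1 != 0, u2 != 0 | u3 != 0] /\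
    all (fun q => q == 0) (Deqs e1 e2 e3 m L t u1 u2 u3).

(* D^{(m)}_Lambda(Q_p) is nonempty.  Since D is projective, a Q_p-point
   is the same as a primitive Z_p-point, and by compactness of Z_p this
   holds iff for every k there is a primitive integer solution mod p^k. *)
Definition D_padic_pt (p : nat) (e1 e2 e3 m : int) (L : triple) : Prop :=
  forall k : nat, exists t u1 u2 u3 : int,
    ~~ [&& (p%:Z %| t)%Z, (p%:Z %| u1)%Z, (p%:Z %| u2)%Z & (p%:Z %| u3)%Z] /\
    all (fun q => ((p ^ k)%N%:Z %| q)%Z) (Deqs e1 e2 e3 m L t u1 u2 u3).

Definition D_adelic_pt (e1 e2 e3 m : int) (L : triple) : Prop :=
  D_real_pt e1 e2 e3 m L /\
  forall p : nat, prime p -> D_padic_pt p e1 e2 e3 m L.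

(* The 2-Selmer group of E^{(m)}: elements of (Q^x/Q^x2)^3 are          *)
(* represented by their unique square-free integer representatives.     *)

Definition Sel2 (e1 e2 e3 m : int) (L : triple) : Prop :=
  [/\ sqfree (t1 L), sqfree (t2 L), sqfree (t3 L),
      is_sq (t1 L * t2 L * t3 L) & D_adelic_pt e1 e2 e3 m L].

(* The images of the rational 2-torsion points of E^{(m)} *)
Definition tors_img (e1 e2 e3 m : int) : seq triple :=
  [:: (1, 1, 1);
      (- (e3 * m), - (e1 * e3), e1 * m);
      (- (e2 * e3), e3 * m, - (e2 * m));
      (e2 * m, - (e1 * m), - (e1 * e2))].

(* L3 = L1 * L2 in (Q^x/Q^x2)^3 (all entries nonzero integers) *)
Definition prod_cls (L1 L2 L3 : triple) : Prop :=
  [/\ is_sq (t1 L1 * t1 L2 * t1 L3),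
      is_sq (t2 L1 * t2 L2 * t2 L3) &
      is_sq (t3 L1 * t3 L2 * t3 L3)].

(* L and L' have the same class in Sel_2' = Sel_2 / (image of torsion) *)
Definition same_cls' (e1 e2 e3 m : int) (L L' : triple) : Prop :=
  exists2 T, T \in tors_img e1 e2 e3 m & prod_cls L L' T.

Definition prod_cls' (e1 e2 e3 m : int) (L1 L2 L3 : triple) : Prop :=
  exists2 T, T \in tors_img e1 e2 e3 m &
    [/\ is_sq (t1 L1 * t1 L2 * t1 L3 * t1 T),
        is_sq (t2 L1 * t2 L2 * t2 L3 * t2 T) &
        is_sq (t3 L1 * t3 L2 * t3 L3 * t3 T)].

Definition pos_div_rep (n : nat) (L : triple) : Prop :=
  [/\ 0 < t1 L, 0 < t2 L, 0 < t3 L &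
      [/\ (absz (t1 L) %| n)%N, (absz (t2 L) %| n)%N & (absz (t3 L) %| n)%N]].

(* z^2 = a x^2 + b y^2 has a nonzero solution in Q_p (equivalently, a
   primitive solution modulo p^k for every k). *)
Definition hilb_solv (p : nat) (a b : int) : Prop :=
  forall k : nat, exists x y z : int,
    ~~ [&& (p%:Z %| x)%Z, (p%:Z %| y)%Z & (p%:Z %| z)%Z] /\
    ((p ^ k)%N%:Z %| z ^+ 2 - a * x ^+ 2 - b * y ^+ 2)%Z.

Definition hilb_add (p : nat) (a b : int) : 'F_2 :=
  if excluded_middle_informative (hilb_solv p a b) then 0 else 1.

Definition leg_add (u : int) (p : nat) : 'F_2 :=
  if [exists x : 'I_p, (p%:Z %| (x%:Z) ^+ 2 - u)%Z] then 0 else 1.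

Definition Amat (ps : seq nat) (n : nat) : 'M['F_2]_(size ps) :=
  \matrix_(i < size ps, j < size ps)
     hilb_add (nth 0%N ps i) (nth 0%N ps j)%:Z (- n%:Z).

Definition Dmat (ps : seq nat) (u : int) : 'M['F_2]_(size ps) :=
  diag_mx (\row_(i < size ps) leg_add u (nth 0%N ps i)).

Definition Mmat (ps : seq nat) (n : nat) (e1 e2 e3 : int)
    : 'M['F_2]_(size ps + size ps) :=
  block_mx (Amat ps n + Dmat ps (- e3)) (Dmat ps (- (e2 * e3)))
           (Dmat ps (- (e1 * e3))) (Amat ps n + Dmat ps e3).

Definition xyvec (ps : seq nat) (L : triple) : 'cV['F_2]_(size ps + size ps) :=
  col_mx (\col_(i < size ps) (logn (nth 0%N ps i) (absz (t1 L)))%:R)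
         (\col_(i < size ps) (logn (nth 0%N ps i) (absz (t2 L)))%:R).

(* Main.v *)
Require Import Defs.
From HB Require Import structures.
From mathcomp Require Import all_boot all_order all_algebra.
From mathcomp Require Import all_fingroup all_solvable.
From mathcomp Require Import zify ring lra Rstruct.
From Stdlib Require Import Classical.
Import Order.TTheory GRing.Theory Num.Theory.
Local Open Scope ring_scope.
Set Implicit Arguments.
Unset Strict Implicit.

(* Over [Z_p] with [p] odd and of good reduction, the homogeneous space of a unit triple has a
   point because the curve y^2 = x (x - a) (x - b) over F_p has one at infinity; at [p | n] a
   unit triple is locally trivial iff its entries are squares mod [p], and every triple is made
   unit at [p] by translating by a 2-torsion point; at 2 nothing has to be checked, because
   Legendre's theorem puts rational points on the three conics attached to the homogeneous
   space, and their congruence conditions mod 8 provide a 2-adic point.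

   A Selmer element of the twist is unramified outside 2 n e1 e2 e3.  Once translated to odd
   entries, each entry is (divisor of n) * b with b prime to n, and the triple of the b's is a
   Selmer element of E itself, since n and its divisors are squares at the odd primes dividing
   e1 e2 e3.  By hypothesis it comes from torsion, which leaves positive divisors of n.  For
   such triples only the places dividing n impose conditions, and these are the rows of the
   matrix. *)

(** The obstacle is the place 2. A point on the twisted space gives a point on the space of E
    wherever n and its divisors are squares; this holds over the reals and at the odd primes
    dividing e1 e2 e3, but n need not be a 2-adic square. Solvability at 2 has to be recovered from
    the other places, so Legendre's theorem is needed in a form whose hypotheses mention only signs
    and odd primes. As e1 and e2 are odd and 4 does not divide e3, the conditions on the conics
    modulo 4 and 8 reduce the rest to a finite check in ['Z_8]. A p-adic point is encoded by
    primitive solutions modulo every p^k. The hypothesis on Sel_2(E) acts by counting: torsion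
    already supplies four distinct classes. The entries of the matrix come from translation: at p
    dividing n, the valuations of d1 and d2 select the torsion point that makes the triple a unit,
    and the e's in the diagonal blocks are the entries of that point. *)

(** * Divisibility and square-free parts of integers *)

Lemma dvdz_comb2 (a b : int) {d x y z : int} :
  (d %| x)%Z -> (d %| y)%Z -> z = a * x + b * y -> (d %| z)%Z.
Proof. by move=> dx dy ->; apply: rpredD; apply: dvdz_mull. Qed.

(** With [dvdz_comb2], the shape in which congruences are combined throughout: the coefficients are
    supplied at the call and [ring] checks the identity. *)
Lemma dvdz_scale (a : int) {d x z : int} : (d %| x)%Z -> z = a * x -> (d %| z)%Z.
Proof. by move=> dx ->; apply: dvdz_mull. Qed.

Lemma prime_dvdzM (p : nat) (x y : int) :
  prime p -> (p%:Z %| x * y)%Z = (p%:Z %| x)%Z || (p%:Z %| y)%Z.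
Proof. by move=> pp; rewrite !dvdzE abszM Euclid_dvdM. Qed.

Lemma prime_dvdzX2 (p : nat) (x : int) :
  prime p -> (p%:Z %| x ^+ 2)%Z = (p%:Z %| x)%Z.
Proof. by move=> pp; rewrite expr2 prime_dvdzM // orbb. Qed.

Lemma coprimez_primeX (p k : nat) (d : int) :
  prime p -> ~~ (p%:Z %| d)%Z -> coprimez (p ^ k)%N%:Z d.
Proof.
by move=> pp pd; rewrite coprimezE absz_nat coprimeXl // prime_coprime.
Qed.

Lemma invz_mod (p k : nat) (d : int) : prime p -> ~~ (p%:Z %| d)%Z ->
  exists d', ((p ^ k)%N%:Z %| d * d' - 1)%Z.
Proof.
move=> pp pd; have /coprimezP [[u v] /= E] := coprimez_primeX k pp pd.
exists v; apply/dvdzP; exists (- u); rewrite -E; ring.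
Qed.

Lemma dvdz_primeX (p j k : nat) (x : int) :
  (j <= k)%N -> ((p ^ k)%N%:Z %| x)%Z -> ((p ^ j)%N%:Z %| x)%Z.
Proof. by move=> jk; apply: dvdz_trans; rewrite dvdzE dvdn_exp2l. Qed.

Lemma dvdz_prime1 (p k : nat) (x : int) :
  (0 < k)%N -> ((p ^ k)%N%:Z %| x)%Z -> (p%:Z %| x)%Z.
Proof. by move=> k0 /(@dvdz_primeX p 1 k x k0); rewrite expn1. Qed.

Lemma odd_prime_ndvd2 (p : nat) : prime p -> odd p -> ~~ (p%:Z %| 2)%Z.
Proof. by move=> pp op; rewrite dvdzE /= gtnNdvd // odd_prime_gt2. Qed.

Lemma sqfree_decomp (d : int) : d != 0 ->
  exists d0 s : int, [/\ sqfree d0, s != 0 & d = d0 * s ^+ 2].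
Proof.
elim: {d}_.+1 {-2}d (ltnSn `|d|%N) => // N IH d dN d0.
case: (classic (exists2 p : nat, prime p & (p * p %| `|d|)%N)); last first.
  move=> H; exists d, 1; split; rewrite ?expr1n ?mulr1 //; split=> // p pp.
  by apply/negP=> pd; apply: H; exists p.
move=> [p pp pd].
have /dvdzP[q Eq] : (p%:Z * p%:Z %| d)%Z by rewrite dvdzE abszM.
have q0 : q != 0 by apply: contraNneq d0 => q0; rewrite Eq q0 mul0r.
have p1 := prime_gt1 pp.
have [||e0 [s [se s0 Es]]] := IH q; rewrite ?q0 //.
  apply: leq_trans (_ : `|d| <= N)%N => //.
  rewrite Eq !abszM !absz_nat.
  have : (0 < `|q|)%N by rewrite absz_gt0.
  move: p1; nia.
exists e0, (s * p%:Z); split=> //.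
  by rewrite mulf_neq0 //; lia.
rewrite Eq Es; ring.
Qed.

(** * Squares modulo prime powers *)

Definition quadres (p : nat) (a : int) : Prop := exists x : int, (p%:Z %| x ^+ 2 - a)%Z.

Definition padic_sq (p : nat) (a : int) : Prop :=
  forall k : nat, exists x : int, ((p ^ k)%N%:Z %| x ^+ 2 - a)%Z.

Lemma hensel_odd (p : nat) (a : int) : prime p -> odd p ->
  ~~ (p%:Z %| a)%Z -> quadres p a -> padic_sq p a.
Proof.
move=> pp op pa [x0 Ex0].
suff H k : exists x : int, ((p ^ k.+1)%N%:Z %| x ^+ 2 - a)%Z.
  by case=> [|k]; [exists 0; rewrite expn0 dvd1z | apply: H].
elim: k => [|k [x Ex]]; first by exists x0; rewrite expn1.
have px : ~~ (p%:Z %| 2 * x)%Z.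
  rewrite prime_dvdzM // negb_or odd_prime_ndvd2 //=.
  apply: contra pa => px; apply: dvdz_comb2 px (dvdz_prime1 _ Ex) (_ : _ = x * _ + (-1) * _) => //; ring.
have [i Ei] := invz_mod 1 pp px; rewrite expn1 in Ei.
have /dvdzP[c Ec] := Ex.
(* Newton step. An inverse [i] of [2 * x] modulo [p] alone suffices, since the error already carries
   the factor [p ^ k.+1]. *)
exists (x + (p ^ k.+1)%N%:Z * (- c * i)).
move/dvdzP: Ei => [j Ej].
apply/dvdzP; exists (- c * j + (p ^ k)%N%:Z * (c * i) ^+ 2).
have -> : (x + (p ^ k.+1)%N%:Z * (- c * i)) ^+ 2 - a =
  (x ^+ 2 - a) + (p ^ k.+1)%N%:Z * (- c * (2 * x * i - 1) - c) + (p ^ k.+1)%N%:Z ^+ 2 * (c * i) ^+ 2 by ring.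
rewrite Ec Ej !expnS !PoszM; ring.
Qed.

Lemma hensel_two (a : int) : (8 %| a - 1)%Z -> padic_sq 2 a.
Proof.
move=> /dvdzP[c0 Ea].
suff H k : exists x : int, ((2 ^ (k + 3))%N%:Z %| x ^+ 2 - a)%Z /\ ~~ (2 %| x)%Z.
  move=> k; have [x [Ex _]] := H k; exists x.
  by apply: dvdz_primeX Ex; rewrite leq_addr.
elim: k => [|k [x [/dvdzP[c Ec] ox]]].
  exists 1; split=> //; apply/dvdzP; exists (- c0); rewrite add0n.
  have -> : a = c0 * 8 + 1 by rewrite -Ea; ring.
  by rewrite expr1n; have -> : (2 ^ 3)%N%:Z = 8 by []; ring.
have [y Ey] : exists y, 1 + x = 2 * y by exists ((1 + x) %/ 2)%Z; lia.
(* The correction sits one exponent below the modulus because the derivative 2x is even. It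
   contributes 2^(k+3) x c, and added to the error 2^(k+3) c this gains a factor 2, as 1 + x is
   even. *)
exists (x + (2 ^ (k + 2))%N%:Z * c); split; last first.
  by rewrite addnS expnS PoszM; lia.
apply/dvdzP; exists (c * y + (2 ^ k)%N%:Z * c ^+ 2).
have -> : (x + (2 ^ (k + 2))%N%:Z * c) ^+ 2 - a =
 (x ^+ 2 - a) + (2 ^ (k + 2))%N%:Z * 2 * (1 + x - 1) * c + (2 ^ (k + 2))%N%:Z ^+ 2 * c ^+ 2 by ring.
rewrite Ec Ey addSn !expnS !expnD !PoszM; ring.
Qed.

Lemma padic_sq_solve (p : nat) (d c : int) : prime p -> ~~ (p%:Z %| d)%Z ->
  padic_sq p (d * c) -> forall k, exists u, ((p ^ k)%N%:Z %| d * u ^+ 2 - c)%Z.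
Proof.
move=> pp pd H k; have [y Ey] := H k; have [i Ei] := invz_mod k pp pd.
exists (i * y); apply: dvdz_comb2 Ey Ei (_ : _ = (d * i ^+ 2) * _ + (d * i * c + c) * _).
ring.
Qed.

(** * The quadratic character of a prime field *)

Section QuadraticCharacter.

Variable p : nat.
Hypotheses (pp : prime p) (op : odd p).

Let is_square (x : 'F_p) := [exists y : 'F_p, y ^+ 2 == x].

Definition quad_char (x : 'F_p) : int :=
  if x == 0 then 0 else if is_square x then 1 else -1.

Local Notation chi := quad_char.

Let two_neq0 : 2%:R != 0 :> 'F_p.
Proof.
have := odd_prime_ndvd2 pp op; rewrite (dvdz_pcharf (pchar_Fp pp)).
by rewrite (_ : 2%:~R = 2%:R).
Qed.

Let unit_generator : exists g : 'F_p, forall x : 'F_p, x != 0 -> exists i : nat, x = g ^+ i.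
Proof.
have /cyclicP[g Eg] := field_unit_group_cyclic [set: {unit 'F_p}]%G.
exists (val g) => x x0.
have ux : x \is a GRing.unit by rewrite unitfE.
have : FinRing.unit 'F_p ux \in <[g]>%g by rewrite -Eg inE.
case/cycleP=> i Ei; exists i; have := congr1 val Ei; rewrite /= => ->.
by rewrite FinRing.val_unitX.
Qed.

Let is_squareM_non x y : x != 0 -> y != 0 ->
  ~~ is_square x -> ~~ is_square y -> is_square (x * y).
Proof.
have [g Hg] := unit_generator.
move=> /Hg[i ->] /Hg[j ->].
have odd_exp k : ~~ is_square (g ^+ k) -> odd k.
  apply: contraNT => ek; apply/existsP; exists (g ^+ k./2).
  by rewrite -exprM muln2 even_halfK.
move=> /odd_exp oi /odd_exp oj; apply/existsP; exists (g ^+ (i + j)./2).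
by rewrite -exprM muln2 even_halfK ?oddD ?oi ?oj // exprD.
Qed.

Let is_squareM x y : is_square x -> is_square y -> is_square (x * y).
Proof.
by move=> /existsP[u /eqP <-] /existsP[v /eqP <-]; apply/existsP; exists (u * v); rewrite exprMn.
Qed.

Let is_squareV x : is_square x -> is_square x^-1.
Proof.
by move=> /existsP[u /eqP <-]; apply/existsP; exists u^-1; rewrite exprVn.
Qed.

Lemma quad_charM x y : chi (x * y) = chi x * chi y.
Proof.
rewrite /chi mulf_eq0.
have [_|x0] /= := eqVneq x 0; first by rewrite mul0r.
have [_|y0] /= := eqVneq y 0; first by rewrite mulr0.
case: (boolP (is_square x)) => sx; case: (boolP (is_square y)) => sy.
- by rewrite is_squareM.
- rewrite ifN //; apply: contra sy => sxy.
  by rewrite -[y](mulKf x0) is_squareM // is_squareV.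
- rewrite ifN //; apply: contra sx => sxy.
  by rewrite -[x](mulfK y0) is_squareM // is_squareV.
- by rewrite is_squareM_non.
Qed.

Lemma quad_char1 : chi 1 = 1.
Proof.
rewrite /chi oner_eq0 ifT //; apply/existsP; exists 1; by rewrite expr1n.
Qed.

Lemma quad_char_sqr x : x != 0 -> chi (x ^+ 2) = 1.
Proof.
by move=> x0; rewrite /chi expf_eq0 (negbTE x0) ifT //; apply/existsP; exists x.
Qed.

(** Otherwise squaring would be surjective on a finite set, hence injective, although 1 and -1 have
    the same square. *)
Lemma exists_nonsquare : exists x : 'F_p, chi x = -1.
Proof.
apply: NNPP => H.
have sq x : is_square x.
  apply: contraT => nx; case: H; exists x; rewrite /chi (negbTE nx).
  case: eqP nx => // -> /negP[]; apply/existsP; exists 0; by rewrite expr0n.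
pose s (x : 'F_p) := x ^+ 2.
have /injF_bij si : injective s.
  apply/injectiveP/card_uniqP; rewrite size_codom.
  by apply: eq_card => x; rewrite inE; have /existsP[y /eqP <-] := sq x; exact: codom_f.
have /(bij_inj si) E : s 1 = s (-1) by rewrite /s sqrrN.
have : 1 + 1 = 0 :> 'F_p by rewrite [in X in _ + X]E subrr.
by move/eqP; rewrite -(natrD _ 1 1) (negbTE two_neq0).
Qed.

Lemma sum_quad_char : \sum_x chi x = 0.
Proof.
have [v Ev] := exists_nonsquare.
have v0 : v != 0 by apply: contra_eqN Ev => /eqP ->; rewrite /chi eqxx.
have : \sum_x chi x = - \sum_x chi x.
  rewrite {1}(reindex_inj (mulfI v0)) /= -sumrN.
  by apply: eq_bigr => x _; rewrite quad_charM Ev mulN1r.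
lia.
Qed.

Lemma sum_quad_char_shift a : \sum_x chi (x - a) = 0.
Proof.
by rewrite -[RHS]sum_quad_char [RHS](reindex_inj (addIr (- a))).
Qed.

(** After the shift by [a], with c = b - a, a nonzero x contributes chi (x (x - c)) = chi (x^2 (1 -
    c/x)) = chi (1 - c/x). *)
Lemma sum_quad_char2 a b : a != b -> \sum_x chi (x - a) * chi (x - b) = -1.
Proof.
move=> ab; rewrite (reindex_inj (addIr a)) /=.
pose c := b - a; have c0 : c != 0 by rewrite subr_eq0 eq_sym.
(* With the convention [0^-1 = 0] this is a bijection of all of F_p; it sends 0 to 1, the one value
   missed by the sum over nonzero x. Hence that sum is 0 - chi 1. *)
have hinj : injective (fun x : 'F_p => 1 - c * x^-1).
  by move=> x y /addrI /oppr_inj /(mulfI c0) /invr_inj.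
have := sum_quad_char; rewrite (reindex_inj hinj) /= (bigD1 0) //=.
rewrite invr0 mulr0 subr0 quad_char1 => E; rewrite (bigD1 0) //=.
rewrite add0r subrr (_ : chi 0 = 0) ?mul0r ?add0r; last by rewrite /chi eqxx.
transitivity (\sum_(x | x != 0) chi (1 - c * x^-1)); last by move/eqP: E; rewrite addrC addr_eq0 => /eqP.
apply: eq_bigr => x x0; rewrite -quad_charM.
rewrite -[RHS]mul1r -(quad_char_sqr x0) -quad_charM; congr chi.
rewrite /c; field; exact: x0.
Qed.

(* The sum below is the number of F_p-points of y^2 = x (x - a) (x - b),
   and that curve has a point at infinity. *)
Lemma sum_quad_char3_gt0 a b : a != 0 -> b != 0 -> a != b ->
  0 < \sum_x (1 + chi x) * (1 - chi (x - a)) * (1 - chi (x - b)).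
Proof.
move=> a0 b0 ab.
have E : \sum_x (1 + chi x) * (1 - chi (x - a)) * (1 - chi (x - b)) =
    \sum_x (1 + chi (x * (x - a) * (x - b))) + 1.
  (* In the expanded product the linear terms sum to 0, and the three products of two characters
     contribute 1 + 1 - 1. *)
  transitivity (\sum_x (1 + chi (x * (x - a) * (x - b))) + \sum_x chi x
      - \sum_x chi (x - a) - \sum_x chi (x - b) - \sum_x chi (x - 0) * chi (x - a)
      - \sum_x chi (x - 0) * chi (x - b) + \sum_x chi (x - a) * chi (x - b)).
    rewrite -!sumrN -!big_split /=; apply: eq_bigr => x _.
    by rewrite !quad_charM subr0; ring.
  have [a0' b0'] : 0 != a /\ 0 != b by rewrite ![0 == _]eq_sym.
  rewrite !sum_quad_char_shift sum_quad_char.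
  rewrite (sum_quad_char2 a0') (sum_quad_char2 b0') (sum_quad_char2 ab); ring.
rewrite E ltr_wpDl // sumr_ge0 // => x _.
by rewrite /chi; case: ifP => // _; case: ifP.
Qed.

Lemma quad_char_intr (z : int) :
  [/\ chi z%:~R = 0 <-> (p%:Z %| z)%Z, chi z%:~R = 1 -> quadres p z &
      chi z%:~R = -1 -> ~ quadres p z].
Proof.
have Hd := dvdz_pcharf (pchar_Fp pp).
rewrite /chi; split.
- rewrite Hd; case: ifP => // _; case: ifP => //.
- case: ifP => [_ /eqP //|_]; case: ifP => [/existsP[y /eqP Ey] _|_ /eqP //].
  exists (y : nat)%:Z; rewrite Hd rmorphB rmorphXn /= -Ey.
  by rewrite -pmulrn natr_Zp subrr.
case: ifP => [_ /eqP //|_]; case: ifP => [_ /eqP //|/negbT ns _ [x]].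
rewrite Hd rmorphB rmorphXn /= subr_eq0 => Ex; case/negP: ns.
by apply/existsP; exists x%:~R.
Qed.

End QuadraticCharacter.

(** * Quadratic residues among the integers *)

Lemma quadres_sqr (p : nat) (x : int) : quadres p (x ^+ 2).
Proof. by exists x; rewrite subrr. Qed.

Lemma quadresM (p : nat) (u v : int) : quadres p u -> quadres p v -> quadres p (u * v).
Proof.
move=> [x Ex] [y Ey]; exists (x * y).
apply: dvdz_comb2 Ex Ey (_ : _ = (y ^+ 2) * _ + u * _); ring.
Qed.

Lemma quadres_cancel (p : nat) (u s : int) : prime p -> ~~ (p%:Z %| s)%Z ->
  quadres p (u * s ^+ 2) -> quadres p u.
Proof.
move=> pp ps [x Ex]; have [i Ei] := invz_mod 1 pp ps; rewrite expn1 in Ei.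
exists (x * i).
apply: dvdz_comb2 Ex Ei (_ : _ = (i ^+ 2) * _ + (u * (s * i + 1)) * _); ring.
Qed.

Lemma quadres_divl (p : nat) (u v : int) : prime p -> ~~ (p%:Z %| u)%Z ->
  quadres p u -> quadres p (u * v) -> quadres p v.
Proof.
move=> pp pu qu quv; apply: (quadres_cancel (s := u)) => //.
rewrite (_ : v * u ^+ 2 = u * (u * v)); last by ring.
exact: quadresM.
Qed.

Lemma quadresM_non (p : nat) (u v : int) : prime p -> odd p ->
  ~ quadres p u -> ~ quadres p v -> quadres p (u * v).
Proof.
move=> pp op nu nv.
have ndvd z : ~ quadres p z -> ~~ (p%:Z %| z)%Z.
  move=> nz; apply/negP=> pz; apply: nz; exists 0.
  by apply: dvdz_scale pz (_ : _ = (-1) * _); ring.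
have chiN z : ~ quadres p z -> quad_char (p := p) z%:~R = -1.
  move=> nz; have [H0 H1 _] := quad_char_intr pp z.
  move: H0 H1 (ndvd _ nz); rewrite /quad_char; case: ifP => [_ [H _] _|_].
    by rewrite H.
  by case: ifP => // _ _ H; have := nz (H erefl).
have [_ H _] := quad_char_intr pp (u * v); apply: H.
by rewrite rmorphM quad_charM // !chiN.
Qed.

(** A positive character sum has a nonzero term, and at such an [x] none of the three factors
    vanishes. The pattern is the one met by a homogeneous space with one square and two nonsquare
    coefficients. *)
Lemma quadres_pattern (p : nat) (a b : int) : prime p -> odd p ->
  ~~ (p%:Z %| a)%Z -> ~~ (p%:Z %| b)%Z -> ~~ (p%:Z %| a - b)%Z ->
  exists x : int, [/\ quadres p x, (p%:Z %| x - a)%Z \/ ~ quadres p (x - a) &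
                      (p%:Z %| x - b)%Z \/ ~ quadres p (x - b)].
Proof.
move=> pp op pa pb pab; have Hd := dvdz_pcharf (pchar_Fp pp).
rewrite !Hd in pa pb pab; rewrite rmorphB /= subr_eq0 in pab.
have := sum_quad_char3_gt0 pp op pa pb pab.
rewrite lt0r => /andP[/eqP nz _].
have [x0 /eqP Hx] : exists x : 'F_p, (1 + quad_char x) * (1 - quad_char (x - a%:~R)) *
    (1 - quad_char (x - b%:~R)) != 0.
  apply: NNPP => H; apply: nz; apply: big1 => x _; apply/eqP.
  by apply: contraT => nx; case: H; exists x.
pose x : int := (x0 : nat)%:Z.
have Ex : x0 = x%:~R by rewrite /x -pmulrn natr_Zp.
exists x; move: Hx; rewrite Ex -!rmorphB.
have chiE (z : 'F_p) : [\/ quad_char z = 0, quad_char z = 1 | quad_char z = -1].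
  by rewrite /quad_char; case: ifP => _; [constructor 1|case: ifP => _; [constructor 2|constructor 3]].
have [A0 A1 A2] := quad_char_intr pp x.
have [B0 B1 B2] := quad_char_intr pp (x - a).
have [C0 C1 C2] := quad_char_intr pp (x - b).
move=> Hx; split.
- case: (chiE x%:~R) => E.
  + have /dvdzP[q Eq] := A0.1 E; exists 0; apply/dvdzP; exists (- q); rewrite Eq; ring.
  + exact: A1.
  + by case: Hx; rewrite E; ring.
- case: (chiE (x - a)%:~R) => E; [by left; apply: B0.1| |by right; apply: B2].
  by case: Hx; rewrite E; ring.
- case: (chiE (x - b)%:~R) => E; [by left; apply: C0.1| |by right; apply: C2].
  by case: Hx; rewrite E; ring.
Qed.

(** * Legendre's theorem on conics *)

(** The loss [v] depends on [N] only, not on [c] or [x]; this uniformity is what makes a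
    substitution invertible up to [N] harmless. *)
Lemma primeX_cancel (p : nat) (N : int) : prime p -> N != 0 ->
  exists v : nat, forall (c : nat) (x : int),
    ((p ^ (c + v))%N%:Z %| N * x)%Z -> ((p ^ c)%N%:Z %| x)%Z.
Proof.
move=> pp N0; have N0' : (0 < `|N|)%N by rewrite absz_gt0.
have [q pq Eq] := pfactor_coprime pp N0'.
exists (logn p `|N|) => c x; rewrite !dvdzE abszM !absz_nat {2}Eq expnD.
rewrite mulnAC dvdn_pmul2r ?expn_gt0 ?prime_gt0 // Gauss_dvdr //.
by rewrite coprimeXl.
Qed.

(** [S k] stands for a system of quadratic forms modulo [p ^ k]: dividing all unknowns by [p] lowers
    the exponent by two. If the unknowns are not all divisible by [p ^ c], fewer than [c] divisions
    make them primitive. *)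
Lemma primitive_of_loose (p : nat) (S : nat -> seq int -> Prop) : prime p ->
  (forall k v, S k.+1 v -> S k v) ->
  (forall k v, S k.+2 [seq p%:Z * x | x <- v] -> S k v) ->
  (exists c, forall k, exists2 v, S k v & ~~ all (fun x => ((p ^ c)%N%:Z %| x)%Z) v) ->
  forall k, exists2 v, S k v & ~~ all (fun x => (p%:Z %| x)%Z) v.
Proof.
move=> pp HSd HS [c Hc] k.
(* The precision [c.*2] is the reserve spent by the divisions, two exponents for each. *)
have {Hc} := Hc (k + c.*2)%N; elim: c k => [|c IH] k [v Sv nv].
  by case/negP: nv; apply/allP => x _; rewrite expn0 dvd1z.
have [/allP pv|pv] := boolP (all (fun x => (p%:Z %| x)%Z) v); last first.
  exists v => //; elim: (c.+1.*2) Sv => [|j IHj]; rewrite ?addn0 // addnS.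
  by move/HSd.
pose w := [seq (x %/ p%:Z)%Z | x <- v].
have Ev : v = [seq p%:Z * x | x <- w].
  rewrite -map_comp -[LHS]map_id; apply/eq_in_map => x /pv px /=.
  by rewrite mulrC divzK.
apply: IH; exists w; first by apply: HS; rewrite -Ev; rewrite doubleS !addnS in Sv.
apply: contra nv => /allP pw; apply/allP => x; rewrite Ev => /mapP[y /pw py ->].
by rewrite expnS PoszM dvdz_mul.
Qed.

(** A p-adic point of the conic z^2 = a x^2 + b y^2, primitive only up to a power of [p] independent
    of the precision; this form is stable under the substitutions below. *)
Definition conic_loc (p : nat) (a b : int) : Prop :=
  exists c, forall k : nat, exists x y z : int,
    ~~ [&& ((p ^ c)%N%:Z %| x)%Z, ((p ^ c)%N%:Z %| y)%Z & ((p ^ c)%N%:Z %| z)%Z] /\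
    ((p ^ k)%N%:Z %| z ^+ 2 - a * x ^+ 2 - b * y ^+ 2)%Z.

Lemma conic_loc_primitive (p : nat) (a b : int) : prime p -> conic_loc p a b ->
  forall k : nat, exists x y z : int,
    ~~ [&& (p%:Z %| x)%Z, (p%:Z %| y)%Z & (p%:Z %| z)%Z] /\
    ((p ^ k)%N%:Z %| z ^+ 2 - a * x ^+ 2 - b * y ^+ 2)%Z.
Proof.
move=> pp [c Hc].
pose S k (v : seq int) := exists x y z, v = [:: x; y; z] /\
  ((p ^ k)%N%:Z %| z ^+ 2 - a * x ^+ 2 - b * y ^+ 2)%Z.
suff H : forall k, exists2 v, S k v & ~~ all (fun x => (p%:Z %| x)%Z) v.
  by move=> k; have [_ [x [y [z [-> H1]]]]] := H k; rewrite /= andbT => H2; exists x, y, z.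
apply: primitive_of_loose => //.
- by move=> k v [x [y [z [-> H]]]]; exists x, y, z; split=> //; apply: dvdz_primeX H.
- move=> k [|x [|y [|z [|? ?]]]] [x' [y' [z' [] //= [<- <- <-]]]] => H.
  exists x, y, z; split=> //; move: H; rewrite !expnS mulnA !PoszM.
  have -> : (p%:Z * z) ^+ 2 - a * (p%:Z * x) ^+ 2 - b * (p%:Z * y) ^+ 2 =
     p%:Z * p%:Z * (z ^+ 2 - a * x ^+ 2 - b * y ^+ 2) by ring.
  by rewrite dvdz_mul2l // mulf_neq0 //; have := prime_gt0 pp; lia.
- exists c => k; have [x [y [z [H1 H2]]]] := Hc k.
  by exists [:: x; y; z]; [exists x, y, z|rewrite /= andbT].
Qed.

Lemma conic_loc_scale (p : nat) (a b s t : int) : prime p -> s != 0 -> t != 0 ->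
  conic_loc p (a * s ^+ 2) (b * t ^+ 2) -> conic_loc p a b.
Proof.
move=> pp s0 t0 [c Hc]; have [v Hv] := primeX_cancel pp (mulf_neq0 s0 t0).
exists (c + v)%N => k; have [x [y [z [nd H]]]] := Hc k.
exists (s * x), (t * y), z; split; last by apply: dvdz_scale H (_ : _ = 1 * _); ring.
apply: contra nd => /and3P[dx dy dz]; apply/and3P; split; apply: Hv.
- by apply: dvdz_scale dx (_ : _ = t * _); ring.
- by apply: dvdz_scale dy (_ : _ = s * _); ring.
- by apply: dvdz_mull.
Qed.

Lemma conic_locC (p : nat) (a b : int) : conic_loc p a b -> conic_loc p b a.
Proof.
move=> [c Hc]; exists c => k; have [x [y [z [nd H]]]] := Hc k.
exists y, x, z; split; first by apply: contra nd => /and3P[-> -> ->].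
by apply: dvdz_scale H (_ : _ = 1 * _); ring.
Qed.

(* Multiplication of norms from Q(sqrt a). *)
Lemma conic_loc_norm (p : nat) (a b b' r k : int) : prime p ->
  b * b' * k ^+ 2 = r ^+ 2 - a -> r ^+ 2 - a != 0 ->
  conic_loc p a b -> conic_loc p a b'.
Proof.
move=> pp E N0 [c Hc]; have [v Hv] := primeX_cancel pp N0.
exists (c + v)%N => j; have [x [y [z [nd H]]]] := Hc j.
exists (z + x * r), (b * k * y), (z * r + a * x); split.
  apply: contra nd => /and3P[dx dy dz]; apply/and3P; split; apply: Hv.
  - by apply: dvdz_comb2 dx dz (_ : _ = r * _ + (-1) * _); ring.
  - by apply: dvdz_scale dy (_ : _ = (b' * k) * _); rewrite -E; ring.
  - by apply: dvdz_comb2 dx dz (_ : _ = (- a) * _ + r * _); ring.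
apply: dvdz_scale H (_ : _ = (r ^+ 2 - a) * _).
transitivity ((z ^+ 2 - a * x ^+ 2) * (r ^+ 2 - a) - b * (b * b' * k ^+ 2) * y ^+ 2); first by ring.
rewrite E; ring.
Qed.

(** The integral version of the same substitution: (z + x sqrt a)(r + sqrt a) = (z r + a x) + (z + x
    r) sqrt a has norm b y^2 times b b' k^2, which is b' (b k y)^2. *)
Lemma conic_sol_norm (a b b' r k : int) :
  b * b' * k ^+ 2 = r ^+ 2 - a -> r ^+ 2 - a != 0 ->
  (exists x y z : int, [|| x != 0, y != 0 | z != 0] /\ z ^+ 2 = a * x ^+ 2 + b * y ^+ 2) ->
  (exists x y z : int, [|| x != 0, y != 0 | z != 0] /\ z ^+ 2 = a * x ^+ 2 + b' * y ^+ 2).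
Proof.
move=> E N0 [x [y [z [nz H]]]].
exists (z + x * r), (b * k * y), (z * r + a * x); split.
  apply: contraT; rewrite !negb_or !negbK => /and3P[/eqP Ex /eqP Ey /eqP Ez].
  have x0 : (r ^+ 2 - a) * x = 0.
    rewrite (_ : _ * x = r * (z + x * r) - (z * r + a * x)); last by ring.
    by rewrite Ex Ez; ring.
  have z0 : (r ^+ 2 - a) * z = 0.
    rewrite (_ : _ * z = r * (z * r + a * x) - a * (z + x * r)); last by ring.
    by rewrite Ex Ez; ring.
  have y0 : (r ^+ 2 - a) * y = 0.
    rewrite -E (_ : _ * y = b' * k * (b * k * y)); last by ring.
    by rewrite Ey mulr0.
  move/eqP: x0; move/eqP: y0; move/eqP: z0.
  rewrite !mulf_eq0 (negbTE N0) /= => /eqP z0 /eqP y0 /eqP x0.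
  by move: nz; rewrite x0 y0 z0 eqxx.
have -> : (z * r + a * x) ^+ 2 = (z ^+ 2 - a * x ^+ 2) * (r ^+ 2 - a) + a * (z + x * r) ^+ 2 by ring.
have -> : b' * (b * k * y) ^+ 2 = b * y ^+ 2 * (b * b' * k ^+ 2) by ring.
rewrite E H; ring.
Qed.

Lemma sqfree_dvd2 (p : nat) (b : int) : prime p -> sqfree b -> ~~ ((p ^ 2)%N%:Z %| b)%Z.
Proof. by move=> pp [_ H]; rewrite dvdzE absz_nat -mulnn; apply: H. Qed.

Lemma sqfree_dvd_cancel (p : nat) (b y : int) : prime p -> sqfree b ->
  ((p ^ 2)%N%:Z %| b * y ^+ 2)%Z -> (p%:Z %| y)%Z.
Proof.
move=> pp sb H; apply: contraT => py.
have /negP[] := sqfree_dvd2 pp sb.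
move: H; rewrite Gauss_dvdzl //; apply: coprimez_primeX => //.
by rewrite prime_dvdzX2.
Qed.

(** Modulo [p] the conic reads z^2 = a x^2. If [p] divided x it would divide z, and modulo p^2 the
    square-free [b] would force it to divide y as well. *)
Lemma conic_loc_quadres (p : nat) (a b : int) : prime p -> sqfree b ->
  (p%:Z %| b)%Z -> conic_loc p a b -> quadres p a.
Proof.
move=> pp sb pb /conic_loc_primitive - /(_ pp 2%N) [x [y [z [nd H]]]].
have H1 : (p%:Z %| z ^+ 2 - a * x ^+ 2)%Z.
  apply: dvdz_comb2 (dvdz_prime1 _ H) pb (_ : _ = 1 * _ + (y ^+ 2) * _) => //; ring.
have px : ~~ (p%:Z %| x)%Z.
  apply: contra nd => px.
  have pz : (p%:Z %| z)%Z.
    rewrite -prime_dvdzX2 //.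
    by apply: dvdz_comb2 H1 px (_ : _ = 1 * _ + (a * x) * _); ring.
  rewrite px pz andbT /=; apply: sqfree_dvd_cancel pp sb _.
  move: px pz => /dvdzP[x' Ex] /dvdzP[z' Ez].
  have P : ((p ^ 2)%N%:Z %| z ^+ 2 - a * x ^+ 2)%Z.
    rewrite Ex Ez; apply/dvdzP; exists (z' ^+ 2 - a * x' ^+ 2).
    by rewrite !expnS expn0 muln1 PoszM; ring.
  by apply: dvdz_comb2 P H (_ : _ = 1 * _ + (-1) * _); ring.
apply: (quadres_cancel pp px); by exists z.
Qed.

Lemma quadres_crt (a b : int) : sqfree b ->
  (forall p : nat, prime p -> (p%:Z %| b)%Z -> quadres p a) ->
  exists r : int, (b %| r ^+ 2 - a)%Z.
Proof.
elim: {b}_.+1 {-2}b (ltnSn `|b|%N) => // N IH b bN sb Hb.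
have [b1|b1] := leqP `|b| 1.
  have ab1 : `|b|%N = 1%N by have [b0 _] := sb; move: b0; rewrite -absz_gt0; lia.
  by exists 0; rewrite dvdzE ab1 dvd1n.
pose p := pdiv `|b|; have pp : prime p := pdiv_prime b1.
have pb : (p%:Z %| b)%Z by rewrite dvdzE absz_nat pdiv_dvd.
have /dvdzP[c Ec] := pb.
have [b0 sq] := sb.
have c0 : c != 0 by apply: contraNneq b0 => c0; rewrite Ec c0 mul0r.
have pc : ~~ (p%:Z %| c)%Z.
  apply: contra (sq p pp); rewrite Ec abszM dvdzE => pc; exact: dvdn_mul.
have [|||r2 Er2] := IH c.
- apply: leq_trans (_ : `|b| <= N)%N => //; rewrite Ec abszM absz_nat.
  by rewrite ltn_Pmulr ?prime_gt1 // absz_gt0.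
- split=> // q pq; apply: contra (sq q pq) => qc; rewrite Ec abszM.
  exact: dvdn_mulr.
- by move=> q pq qc; apply: Hb => //; rewrite Ec dvdz_mulr.
have [r1 Er1] := Hb p pp pb.
have cop : coprimez p%:Z c by have := coprimez_primeX 1 pp pc; rewrite expn1.
exists (zchinese p%:Z c r1 r2).
set r := zchinese _ _ _ _.
rewrite Ec mulrC Gauss_dvdz //; apply/andP; split.
- have D : (p%:Z %| r - r1)%Z by rewrite -eqz_mod_dvd; apply/eqP/zchinese_modl.
  by apply: dvdz_comb2 D Er1 (_ : _ = (r + r1) * _ + 1 * _); ring.
- have D : (c %| r - r2)%Z by rewrite -eqz_mod_dvd; apply/eqP/zchinese_modr.
  by apply: dvdz_comb2 D Er2 (_ : _ = (r + r2) * _ + 1 * _); ring.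
Qed.

Lemma centered_residue (b r : int) : b != 0 ->
  exists r' : int, (b %| r' - r)%Z /\ (2 * `|r'| <= `|b|)%N.
Proof.
move=> b0; pose r0 := (r %% b)%Z.
have r0_ge : 0 <= r0 by rewrite modz_ge0.
have r0_lt : r0 < `|b| by rewrite ltz_mod.
have D : (b %| r0 - r)%Z.
  by apply/dvdzP; exists (- (r %/ b)%Z); rewrite {1}(divz_eq r b) /r0; ring.
have [H|H] := leP (2 * r0) `|b|; first by exists r0; split=> //; lia.
exists (r0 - `|b|); split; last by lia.
have D' : (b %| `|b|)%Z by rewrite dvdzE.
by apply: dvdz_comb2 D D' (_ : _ = 1 * _ + (-1) * _); ring.
Qed.

(* Descent: with r^2 = a mod b and 2|r| <= |b|, the cofactor of b in r^2 - a is smaller than b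
   and, being a norm times b up to squares, may replace b. *)
Theorem legendre_sqfree (a b : int) : sqfree a -> sqfree b -> (0 < a) || (0 < b) ->
  (forall p : nat, prime p -> odd p -> conic_loc p a b) ->
  exists x y z : int, [|| x != 0, y != 0 | z != 0] /\ z ^+ 2 = a * x ^+ 2 + b * y ^+ 2.
Proof.
elim: {a b}_.+1 {-2}a {-2}b (ltnSn (`|a| + `|b|)%N) => // N IH a b.
wlog le_ab : a b / (`|a| <= `|b|)%N.
  move=> W abN sa sb pos loc; have [le_ab|/ltnW le_ba] := leqP `|a| `|b|; first exact: W.
  have [||p pp op|x [y [z [nz E]]]] := W b a le_ba _ sb sa; rewrite 1?addnC 1?orbC //.
    exact/conic_locC/loc.
  by exists y, x, z; split; [move: nz; case: (x == 0); case: (y == 0)|rewrite E addrC].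
move=> abN sa sb pos loc.
have a0 : a != 0 := sa.1; have b0 : b != 0 := sb.1.
have [b1|b1] := leqP `|b| 1.
  have [->|->] : a = 1 \/ b = 1 by lia.
  - by exists 1, 0, 1; split=> //; ring.
  - by exists 0, 1, 1; split=> //; ring.
have [r0 Er0] : exists r : int, (b %| r ^+ 2 - a)%Z.
  apply: quadres_crt => // p pp pb.
  have [op|] := boolP (odd p); first exact: conic_loc_quadres (loc p pp op).
  (* Nothing is assumed about the conic at 2, but every integer is a square modulo 2, since a^2 - a
     is even. *)
  move=> /negbTE ep; have -> : p = 2%N by case: (even_prime pp) => // op; rewrite op in ep.
  exists a; apply/dvdzP; exists (a * (a - 1) %/ 2)%Z.
  have [c [->|->]] : exists c : int, a = 2 * c \/ a = 2 * c + 1 by exists (a %/ 2)%Z; lia.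
    by rewrite (_ : 2 * c * (2 * c - 1) = (c * (2 * c - 1)) * 2) ?mulzK //; ring.
  by rewrite (_ : (2 * c + 1) * (2 * c + 1 - 1) = ((2 * c + 1) * c) * 2) ?mulzK //; ring.
have [r [Er r_le]] := centered_residue r0 b0.
have {Er0}/dvdzP[b' Eb'] : (b %| r ^+ 2 - a)%Z.
  by apply: dvdz_comb2 Er Er0 (_ : _ = (r + r0) * _ + 1 * _); ring.
have [N0|N0] := eqVneq (r ^+ 2 - a) 0.
  by exists 1, 0, r; split=> //; move/eqP: N0; rewrite subr_eq0 => /eqP ->; ring.
have b'0 : b' != 0 by apply: contraNneq N0 => H; rewrite Eb' H mul0r.
have [b2 [k [sb2 k0 E2]]] := sqfree_decomp b'0.
have E : b * b2 * k ^+ 2 = r ^+ 2 - a by rewrite Eb' E2; ring.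
have E' : b2 * b * k ^+ 2 = r ^+ 2 - a by rewrite -E; ring.
apply: (conic_sol_norm E') => //; apply: IH => //.
(* Here |b'| |b| <= r^2 + |a| <= |b|^2 / 4 + |b|, so |b'| <= |b| / 4 + 1 < |b| as soon as |b| >=
   2. *)
- have H1 : (`|b'| * `|b| <= `|r| ^ 2 + `|a|)%N.
    by rewrite -abszM -Eb' -abszX; lia.
  have H2 : (`|b2| <= `|b'|)%N by rewrite E2 abszM leq_pmulr // absz_gt0 expf_neq0.
  suff : (`|b2| < `|b|)%N by lia.
  rewrite ltnNge; apply/negP => H3; rewrite -mulnn in H1.
  have H4 : (`|b| * `|b| <= `|b'| * `|b|)%N by rewrite leq_mul // (leq_trans H3).
  have H5 : (2 * `|r| * (2 * `|r|) <= `|b| * `|b|)%N by rewrite leq_mul.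
  have H6 : (2 * `|b| <= `|b| * `|b|)%N by rewrite leq_mul.
  move: H1 H4 H5 H6 b1 le_ab; set B := (`|b| * `|b|)%N; set C := (`|b'| * `|b|)%N.
  rewrite mulnACA; set D := (`|r| * `|r|)%N; lia.
(* The sign condition survives the descent: if [a] is negative then [b] and r^2 - a are positive,
   hence so is [b2]. *)
- have [a_pos|a_neg] := ltP 0 a; rewrite // ?a_pos //=.
  have b_pos : 0 < b by move: pos; rewrite ltNge a_neg.
  have : 0 < b * b2 * k ^+ 2 by rewrite E subr_gt0; have := sqr_ge0 r; lia.
  rewrite -mulrA pmulr_rgt0 // pmulr_lgt0 // lt0r sqr_ge0 andbT expf_neq0 //.
- by move=> p pp op; apply: conic_loc_norm E N0 (loc p pp op).
Qed.

Lemma legendre (a b : int) : a != 0 -> b != 0 -> (0 < a) || (0 < b) ->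
  (forall p : nat, prime p -> odd p -> conic_loc p a b) ->
  exists x y z : int, [|| x != 0, y != 0 | z != 0] /\ z ^+ 2 = a * x ^+ 2 + b * y ^+ 2.
Proof.
move=> a0 b0 pos loc.
have [a1 [s [sa s0 Ea]]] := sqfree_decomp a0.
have [b1 [t [sb t0 Eb]]] := sqfree_decomp b0.
have sqpos (u : int) : u != 0 -> 0 < u ^+ 2.
  by move=> u0; rewrite lt0r sqr_ge0 andbT expf_neq0.
have [||x [y [z [nz E]]]] := legendre_sqfree sa sb.
- by move: pos; rewrite Ea Eb (pmulr_lgt0 _ (sqpos _ s0)) (pmulr_lgt0 _ (sqpos _ t0)).
- by move=> p pp op; apply: (conic_loc_scale pp s0 t0); rewrite -Ea -Eb; apply: loc.
exists (t * x), (s * y), (s * t * z); split.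
  by rewrite !mulf_eq0 (negbTE s0) (negbTE t0); exact: nz.
rewrite exprMn E Ea Eb; ring.
Qed.

(** * Local points of the homogeneous spaces *)

Definition primitive4 (q t u1 u2 u3 : int) : bool :=
  ~~ [&& (q %| t)%Z, (q %| u1)%Z, (q %| u2)%Z & (q %| u3)%Z].

Definition Dcong (e1 e2 e3 m d1 d2 d3 q t u1 u2 u3 : int) : Prop :=
  [/\ (q %| e1 * m * t ^+ 2 + d2 * u2 ^+ 2 - d3 * u3 ^+ 2)%Z,
      (q %| e2 * m * t ^+ 2 + d3 * u3 ^+ 2 - d1 * u1 ^+ 2)%Z &
      (q %| e3 * m * t ^+ 2 + d1 * u1 ^+ 2 - d2 * u2 ^+ 2)%Z].

Lemma D_padicE (p : nat) (e1 e2 e3 m d1 d2 d3 : int) :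
  D_padic_pt p e1 e2 e3 m (d1, d2, d3) <->
  forall k, exists t u1 u2 u3, primitive4 p%:Z t u1 u2 u3 /\
    Dcong e1 e2 e3 m d1 d2 d3 (p ^ k)%N%:Z t u1 u2 u3.
Proof.
split=> H k; have [t [u1 [u2 [u3 [nd E]]]]] := H k; exists t, u1, u2, u3; split=> //.
  by move: E; rewrite /Deqs /t1 /t2 /t3 /= !intz => /and4P[].
by case: E => E1 E2 E3; rewrite /Deqs /t1 /t2 /t3 /= !intz E1 E2 E3.
Qed.

Lemma D_padic_cycle (p : nat) (e1 e2 e3 m d1 d2 d3 : int) :
  D_padic_pt p e1 e2 e3 m (d1, d2, d3) -> D_padic_pt p e2 e3 e1 m (d2, d3, d1).
Proof.
move=> /D_padicE H; apply/D_padicE => k; have [t [u1 [u2 [u3 [nd [E1 E2 E3]]]]]] := H k.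
exists t, u2, u3, u1; split=> //; apply: contra nd => /and4P[-> -> -> ->] //.
Qed.

Lemma D_padic_loose (p : nat) (e1 e2 e3 m d1 d2 d3 : int) : prime p ->
  (exists c, forall k, exists t u1 u2 u3, primitive4 (p ^ c)%N%:Z t u1 u2 u3 /\
    Dcong e1 e2 e3 m d1 d2 d3 (p ^ k)%N%:Z t u1 u2 u3) ->
  D_padic_pt p e1 e2 e3 m (d1, d2, d3).
Proof.
move=> pp [c Hc]; apply/D_padicE.
pose S k (v : seq int) := exists t u1 u2 u3, v = [:: t; u1; u2; u3] /\
  Dcong e1 e2 e3 m d1 d2 d3 (p ^ k)%N%:Z t u1 u2 u3.
suff H : forall k, exists2 v, S k v & ~~ all (fun x => (p%:Z %| x)%Z) v.
  move=> k; have [_ [t [u1 [u2 [u3 [-> H1]]]]]] := H k; rewrite /= andbT => H2.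
  by exists t, u1, u2, u3.
apply: primitive_of_loose => //.
- move=> k v [t [u1 [u2 [u3 [-> [E1 E2 E3]]]]]]; exists t, u1, u2, u3; split=> //.
  by split; [move: E1|move: E2|move: E3]; apply: dvdz_primeX.
- move=> k [|t [|u1 [|u2 [|u3 [|? ?]]]]] [t' [u1' [u2' [u3' [] //= [<- <- <- <-]]]]] => H.
  exists t, u1, u2, u3; split=> //; move: H; rewrite /Dcong !expnS mulnA !PoszM.
  have pull (a b c' x y z : int) : a * m * (p%:Z * x) ^+ 2 + b * (p%:Z * y) ^+ 2 - c' * (p%:Z * z) ^+ 2 =
    p%:Z * p%:Z * (a * m * x ^+ 2 + b * y ^+ 2 - c' * z ^+ 2) by ring.
  rewrite !pull !dvdz_mul2l //; by rewrite mulf_neq0 //; have := prime_gt0 pp; lia.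
- exists c => k; have [t [u1 [u2 [u3 [H1 H2]]]]] := Hc k.
  by exists [:: t; u1; u2; u3]; [exists t, u1, u2, u3|rewrite /= andbT].
Qed.

(** The substitution is required to be undone up to the factor [N]. Both clauses quantify over all
    moduli [q]: the first is used at the power measuring primitivity, the second at the working
    precision. *)
Lemma D_padic_transfer (p : nat) (e1 e2 e3 m d1 d2 d3 d1' d2' d3' N : int) :
  prime p -> N != 0 -> D_padic_pt p e1 e2 e3 m (d1, d2, d3) ->
  (forall t u1 u2 u3, exists t' u1' u2' u3',
    (forall q : int, (q %| t')%Z -> (q %| u1')%Z -> (q %| u2')%Z -> (q %| u3')%Z ->
      [/\ (q %| N * t)%Z, (q %| N * u1)%Z, (q %| N * u2)%Z & (q %| N * u3)%Z]) /\
    (forall q : int, Dcong e1 e2 e3 m d1 d2 d3 q t u1 u2 u3 ->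
       Dcong e1 e2 e3 m d1' d2' d3' q t' u1' u2' u3')) ->
  D_padic_pt p e1 e2 e3 m (d1', d2', d3').
Proof.
move=> pp N0 /D_padicE HD Hmap; apply: D_padic_loose => //.
have [v Hv] := primeX_cancel pp N0; exists (1 + v)%N => k.
have [t [u1 [u2 [u3 [nd E]]]]] := HD k.
have [t' [u1' [u2' [u3' [Hn HE]]]]] := Hmap t u1 u2 u3.
exists t', u1', u2', u3'; split; last exact: HE.
apply: contra nd => /and4P[a0 a1 a2 a3].
have [b0 b1 b2 b3] := Hn _ a0 a1 a2 a3.
by have := (Hv _ _ b0, Hv _ _ b1, Hv _ _ b2, Hv _ _ b3); rewrite expn1 => -[[[-> ->] ->] ->].
Qed.

Lemma D_padic_scale (p : nat) (e1 e2 e3 m d1 d2 d3 d1' d2' d3' : int) : prime p ->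
  d1 != 0 -> d2 != 0 -> d3 != 0 -> d1' != 0 -> d2' != 0 -> d3' != 0 ->
  is_sq (d1 * d1') -> is_sq (d2 * d2') -> is_sq (d3 * d3') ->
  D_padic_pt p e1 e2 e3 m (d1, d2, d3) -> D_padic_pt p e1 e2 e3 m (d1', d2', d3').
Proof.
move=> pp n1 n2 n3 n1' n2' n3' [z1 E1] [z2 E2] [z3 E3] HD.
have z10 : z1 != 0 by apply: contraNneq (mulf_neq0 n1 n1'); rewrite E1 => ->; rewrite mul0r.
have z20 : z2 != 0 by apply: contraNneq (mulf_neq0 n2 n2'); rewrite E2 => ->; rewrite mul0r.
have z30 : z3 != 0 by apply: contraNneq (mulf_neq0 n3 n3'); rewrite E3 => ->; rewrite mul0r.
pose P := d1' * d2' * d3'.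
apply: (D_padic_transfer (N := P * z1 * z2 * z3)) HD _ => //.
  by rewrite !mulf_neq0.
move=> t u1 u2 u3.
(* This is u_i -> (z_i / d_i') u_i, multiplied by [P] to clear denominators. *)
exists (P * t), (z1 * d2' * d3' * u1), (z2 * d1' * d3' * u2), (z3 * d1' * d2' * u3); split.
  move=> q a0 a1 a2 a3; rewrite /P; split.
  - apply: dvdz_scale a0 (_ : _ = (z1 * z2 * z3) * _); rewrite /P; ring.
  - apply: dvdz_scale a1 (_ : _ = (d1' * z2 * z3) * _); ring.
  - apply: dvdz_scale a2 (_ : _ = (d2' * z1 * z3) * _); ring.
  - apply: dvdz_scale a3 (_ : _ = (d3' * z1 * z2) * _); ring.
have F (d d' z s u : int) : d * d' = z * z -> d' * s = P ->
    d' * (z * s * u) ^+ 2 = P ^+ 2 * (d * u ^+ 2).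
  move=> E Es; transitivity (z * z * d' * s ^+ 2 * u ^+ 2); first by ring.
  by rewrite -E -Es; ring.
have -> : z1 * d2' * d3' * u1 = z1 * (d2' * d3') * u1 by ring.
have -> : z2 * d1' * d3' * u2 = z2 * (d1' * d3') * u2 by ring.
have -> : z3 * d1' * d2' * u3 = z3 * (d1' * d2') * u3 by ring.
move=> q [H1 H2 H3]; split; rewrite ?(F _ _ _ _ _ E1) ?(F _ _ _ _ _ E2) ?(F _ _ _ _ _ E3) /P; try ring.
- by apply: dvdz_scale H1 (_ : _ = (P ^+ 2) * _); rewrite /P; ring.
- by apply: dvdz_scale H2 (_ : _ = (P ^+ 2) * _); rewrite /P; ring.
- by apply: dvdz_scale H3 (_ : _ = (P ^+ 2) * _); rewrite /P; ring.
Qed.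

Lemma D_padic_translate3 (p : nat) (e1 e2 e3 m d1 d2 d3 w : int) : prime p ->
  e1 + e2 + e3 = 0 ->
  d1 != 0 -> d2 != 0 -> d3 != 0 -> m != 0 -> d1 * d2 * d3 = w * w ->
  D_padic_pt p e1 e2 e3 m (d1, d2, d3) ->
  D_padic_pt p e1 e2 e3 m (d1 * (e2 * m), d2 * (- (e1 * m)), d3 * (- (e1 * e2))).
Proof.
move=> pp /eqP; rewrite addrC addr_eq0 => /eqP -> n1 n2 n3 m0 Ew HD.
have w0 : w != 0.
  by apply: contraNneq (mulf_neq0 (mulf_neq0 n1 n2) n3); rewrite Ew => ->; rewrite mul0r.
apply: (D_padic_transfer (N := d1 * d2 * d3 * w * m)) HD _ => //.
  by rewrite !mulf_neq0.
move=> t u1 u2 u3.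
(* The substitution exchanges [t] with [u3] and [u1] with [u2]. The factors, with w^2 = d1 d2 d3,
   turn each new equation into a combination of the old ones. *)
exists (d3 * w * u3), (d3 * d2 * u2), (d3 * d1 * u1), (w * m * t); split.
  move=> q a0 a1 a2 a3; split.
  - by apply: dvdz_scale a3 (_ : _ = (d1 * d2 * d3) * _); ring.
  - by apply: dvdz_scale a2 (_ : _ = (d2 * w * m) * _); ring.
  - by apply: dvdz_scale a1 (_ : _ = (d1 * w * m) * _); ring.
  - by apply: dvdz_scale a0 (_ : _ = (d1 * d2 * m) * _); ring.
have X1 : d1 * (e2 * m) * (d3 * d2 * u2) ^+ 2 = e2 * m * d3 * (w * w) * (d2 * u2 ^+ 2).
  by rewrite -Ew; ring.
have X2 : d2 * (- (e1 * m)) * (d3 * d1 * u1) ^+ 2 = - (e1 * m * d3 * (w * w) * (d1 * u1 ^+ 2)).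
  by rewrite -Ew; ring.
move=> q [H1 H2 H3]; split; rewrite ?X1 ?X2.
- by apply: dvdz_scale H2 (_ : _ = (e1 * m * d3 * (w * w)) * _); ring.
- by apply: dvdz_scale H1 (_ : _ = (- (e2 * m * d3 * (w * w))) * _); ring.
- by apply: dvdz_comb2 H1 H2 (_ : _ = (e2 * m * d3 * (w * w)) * _ + (- (e1 * m * d3 * (w * w))) * _); ring.
Qed.

(** * Points over an ordered field, and invariance under torsion *)

(** [D_real_pt] with the reals replaced by any ordered field; square roots of positive elements are
    assumed separately where they are needed. *)
Definition D_field_pt (K : realFieldType) (e1 e2 e3 m : int) (L : triple) : Prop :=
  exists t u1 u2 u3 : K, [|| t != 0, u1 != 0, u2 != 0 | u3 != 0] /\
    all (fun q => q == 0) (Deqs e1 e2 e3 m L t u1 u2 u3).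

Lemma D_fieldE (K : realFieldType) (e1 e2 e3 m d1 d2 d3 : int) :
  D_field_pt K e1 e2 e3 m (d1, d2, d3) <->
  exists t u1 u2 u3 : K, [|| t != 0, u1 != 0, u2 != 0 | u3 != 0] /\
   [/\ e1%:~R * m%:~R * t ^+ 2 + d2%:~R * u2 ^+ 2 - d3%:~R * u3 ^+ 2 = 0,
       e2%:~R * m%:~R * t ^+ 2 + d3%:~R * u3 ^+ 2 - d1%:~R * u1 ^+ 2 = 0 &
       e3%:~R * m%:~R * t ^+ 2 + d1%:~R * u1 ^+ 2 - d2%:~R * u2 ^+ 2 = 0].
Proof.
split=> -[t [u1 [u2 [u3 [nz E]]]]]; exists t, u1, u2, u3; split=> //.
  by move: E; rewrite /Deqs /t1 /t2 /t3 /= !rmorphM /= => /and4P[/eqP-> /eqP-> /eqP->].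
by case: E => E1 E2 E3; rewrite /Deqs /t1 /t2 /t3 /= !rmorphM /= E1 E2 E3 eqxx.
Qed.

Lemma D_field_cycle (K : realFieldType) (e1 e2 e3 m d1 d2 d3 : int) :
  D_field_pt K e1 e2 e3 m (d1, d2, d3) -> D_field_pt K e2 e3 e1 m (d2, d3, d1).
Proof.
move=> /D_fieldE[t [u1 [u2 [u3 [nz [E1 E2 E3]]]]]]; apply/D_fieldE.
by exists t, u2, u3, u1; split=> //; case/or4P: nz => ->; rewrite ?orbT.
Qed.

Lemma D_field_scale (K : realFieldType) (e1 e2 e3 m d1 d2 d3 d1' d2' d3' : int) :
  d1 != 0 -> d2 != 0 -> d3 != 0 -> d1' != 0 -> d2' != 0 -> d3' != 0 ->
  is_sq (d1 * d1') -> is_sq (d2 * d2') -> is_sq (d3 * d3') ->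
  D_field_pt K e1 e2 e3 m (d1, d2, d3) -> D_field_pt K e1 e2 e3 m (d1', d2', d3').
Proof.
move=> n1 n2 n3 n1' n2' n3' [z1 E1] [z2 E2] [z3 E3].
move=> /D_fieldE[t [u1 [u2 [u3 [nz [H1 H2 H3]]]]]]; apply/D_fieldE.
have F (d d' z : int) (u : K) : d' != 0 -> d * d' = z * z ->
    d'%:~R * (z%:~R / d'%:~R * u) ^+ 2 = d%:~R * u ^+ 2.
  move=> n' /(congr1 (fun x : int => x%:~R : K)); rewrite /= !rmorphM /= => E.
  have n'R : d'%:~R != 0 :> K by rewrite intr_eq0.
  transitivity (z%:~R * z%:~R / d'%:~R * u ^+ 2); first by field.
  by rewrite -E; field.
have nzF (d d' z : int) : d != 0 -> d' != 0 -> d * d' = z * z -> z%:~R / d'%:~R != 0 :> K.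
  move=> n n' E; rewrite mulf_neq0 ?invr_eq0 ?intr_eq0 //.
  by apply: contraNneq (mulf_neq0 n n'); rewrite E => ->; rewrite mul0r.
exists t, (z1%:~R / d1'%:~R * u1), (z2%:~R / d2'%:~R * u2), (z3%:~R / d3'%:~R * u3); split.
  by rewrite !(mulf_eq0 (_ / _)) (negbTE (nzF _ _ _ n1 n1' E1)) (negbTE (nzF _ _ _ n2 n2' E2))
    (negbTE (nzF _ _ _ n3 n3' E3)).
by rewrite (F _ _ _ _ n1' E1) (F _ _ _ _ n2' E2) (F _ _ _ _ n3' E3).
Qed.

Lemma D_field_translate3 (K : realFieldType) (e1 e2 e3 m d1 d2 d3 w : int) : e1 + e2 + e3 = 0 ->
  d1 != 0 -> d2 != 0 -> d3 != 0 -> m != 0 -> d1 * d2 * d3 = w * w ->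
  D_field_pt K e1 e2 e3 m (d1, d2, d3) ->
  D_field_pt K e1 e2 e3 m (d1 * (e2 * m), d2 * (- (e1 * m)), d3 * (- (e1 * e2))).
Proof.
move=> /eqP; rewrite addrC addr_eq0 => /eqP -> n1 n2 n3 m0 Ew.
have w0 : w != 0.
  by apply: contraNneq (mulf_neq0 (mulf_neq0 n1 n2) n3); rewrite Ew => ->; rewrite mul0r.
move=> /D_fieldE[t [u1 [u2 [u3 [nz]]]]].
rewrite !rmorphN !rmorphD /= => -[H1 H2 H3]; apply/D_fieldE.
have := congr1 (fun x : int => x%:~R : K) Ew; rewrite /= !rmorphM /= => EwR.
rewrite !rmorphN !rmorphD !rmorphM /=.
have [N1 N2 N3 Nm Nw] : [/\ d1%:~R != 0 :> K, d2%:~R != 0 :> K, d3%:~R != 0 :> K,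
  m%:~R != 0 :> K & w%:~R != 0 :> K] by rewrite !intr_eq0.
move: H1 H2 H3 EwR N1 N2 N3 Nm Nw.
move: (d1%:~R : K) (d2%:~R : K) (d3%:~R : K) (m%:~R : K) (w%:~R : K)
  (e1%:~R : K) (e2%:~R : K) => {n1 n2 n3 m0 Ew w0} {}d1 {}d2 {}d3 {}m {}w {}e1 {}e2.
move=> H1 H2 H3 Ew n1 n2 n3 m0 w0.
exists (d3 * w * u3), (d3 * d2 * u2), (d3 * d1 * u1), (w * m * t); split.
  rewrite !mulf_eq0 (negbTE n1) (negbTE n2) (negbTE n3) (negbTE m0) (negbTE w0) /=.
  by case/or4P: nz => ->; rewrite ?orbT.
have X1 : d1 * (e2 * m) * (d3 * d2 * u2) ^+ 2 = e2 * m * d3 * (w * w) * (d2 * u2 ^+ 2).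
  by rewrite -Ew; ring.
have X2 : d2 * (- (e1 * m)) * (d3 * d1 * u1) ^+ 2 = - (e1 * m * d3 * (w * w) * (d1 * u1 ^+ 2)).
  by rewrite -Ew; ring.
rewrite X1 X2; split.
- transitivity ((e1 * m * d3 * (w * w)) * (e2 * m * t ^+ 2 + d3 * u3 ^+ 2 - d1 * u1 ^+ 2)); first by ring.
  by rewrite H2 mulr0.
- transitivity (- (e2 * m * d3 * (w * w)) * (e1 * m * t ^+ 2 + d2 * u2 ^+ 2 - d3 * u3 ^+ 2)); first by ring.
  by rewrite H1 mulr0.
- transitivity ((e2 * m * d3 * (w * w)) * (e1 * m * t ^+ 2 + d2 * u2 ^+ 2 - d3 * u3 ^+ 2)
    - (e1 * m * d3 * (w * w)) * (e2 * m * t ^+ 2 + d3 * u3 ^+ 2 - d1 * u1 ^+ 2)); first by ring.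
  by rewrite H1 H2 !mulr0 subr0.
Qed.

(* Twisting by the image of a 2-torsion point is translation on the curve. *)
Lemma tors_invariance (P : int -> int -> int -> int -> triple -> Prop) :
  (forall e1 e2 e3 m d1 d2 d3,
     P e1 e2 e3 m (d1, d2, d3) -> P e2 e3 e1 m (d2, d3, d1)) ->
  (forall e1 e2 e3 m d1 d2 d3 d1' d2' d3',
     d1 != 0 -> d2 != 0 -> d3 != 0 -> d1' != 0 -> d2' != 0 -> d3' != 0 ->
     is_sq (d1 * d1') -> is_sq (d2 * d2') -> is_sq (d3 * d3') ->
     P e1 e2 e3 m (d1, d2, d3) -> P e1 e2 e3 m (d1', d2', d3')) ->
  (forall e1 e2 e3 m d1 d2 d3 w, e1 + e2 + e3 = 0 ->
     d1 != 0 -> d2 != 0 -> d3 != 0 -> m != 0 -> d1 * d2 * d3 = w * w ->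
     P e1 e2 e3 m (d1, d2, d3) ->
     P e1 e2 e3 m (d1 * (e2 * m), d2 * (- (e1 * m)), d3 * (- (e1 * e2)))) ->
  forall e1 e2 e3 m L L' T, e1 != 0 -> e2 != 0 -> e3 != 0 -> m != 0 -> e1 + e2 + e3 = 0 ->
    t1 L != 0 -> t2 L != 0 -> t3 L != 0 -> t1 L' != 0 -> t2 L' != 0 -> t3 L' != 0 ->
    is_sq (t1 L * t2 L * t3 L) -> T \in tors_img e1 e2 e3 m -> prod_cls L L' T ->
    P e1 e2 e3 m L -> P e1 e2 e3 m L'.
Proof.
move=> Pcyc Psc Ptr e1 e2 e3 m [[d1 d2] d3] [[d1' d2'] d3'] T.
rewrite /t1 /t2 /t3 /= => e10 e20 e30 m0 Esum n1 n2 n3 n1' n2' n3' [w Ew] TT [].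
rewrite /t1 /t2 /t3 /=.
have perm (x y z : int) : x * y * z = x * z * y by ring.
move: TT; rewrite /tors_img !inE => /or4P[] /eqP -> /=; rewrite ?mulr1 1?(perm d1) 1?(perm d2) 1?(perm d3) => S1 S2 S3 HP.
- exact: Psc HP.
(* The other two torsion points are reached by rotating the indices, translating, and rotating
   back. *)
- have H : P e3 e1 e2 m (d3 * (e1 * m), d1 * (- (e3 * m)), d2 * (- (e3 * e1))).
    apply: (Ptr _ _ _ _ _ _ _ w) (Pcyc _ _ _ _ _ _ _ (Pcyc _ _ _ _ _ _ _ HP)) => //.
    - by rewrite -Esum; ring.
    - by rewrite -Ew; ring.
  apply: Psc (Pcyc _ _ _ _ _ _ _ H) => //; rewrite ?(mulf_neq0, oppr_eq0) //.
  by rewrite [e3 * e1]mulrC.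
- have H : P e2 e3 e1 m (d2 * (e3 * m), d3 * (- (e2 * m)), d1 * (- (e2 * e3))).
    apply: (Ptr _ _ _ _ _ _ _ w) (Pcyc _ _ _ _ _ _ _ HP) => //.
    - by rewrite -Esum; ring.
    - by rewrite -Ew; ring.
  by apply: Psc (Pcyc _ _ _ _ _ _ _ (Pcyc _ _ _ _ _ _ _ H)) => //; rewrite ?(mulf_neq0, oppr_eq0).
- have H := Ptr _ _ _ _ _ _ _ _ Esum n1 n2 n3 m0 Ew HP.
  by apply: Psc H => //; rewrite ?(mulf_neq0, oppr_eq0).
Qed.

Lemma D_padic_tors (p : nat) (e1 e2 e3 m : int) (L L' T : triple) : prime p ->
  e1 != 0 -> e2 != 0 -> e3 != 0 -> m != 0 -> e1 + e2 + e3 = 0 ->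
  t1 L != 0 -> t2 L != 0 -> t3 L != 0 -> t1 L' != 0 -> t2 L' != 0 -> t3 L' != 0 ->
  is_sq (t1 L * t2 L * t3 L) -> T \in tors_img e1 e2 e3 m -> prod_cls L L' T ->
  D_padic_pt p e1 e2 e3 m L -> D_padic_pt p e1 e2 e3 m L'.
Proof.
move=> pp; apply: (tors_invariance (P := D_padic_pt p)).
- exact: D_padic_cycle.
- by move=> *; apply: D_padic_scale; last eassumption.
- by move=> *; apply: D_padic_translate3; eassumption.
Qed.

Lemma D_real_tors (e1 e2 e3 m : int) (L L' T : triple) :
  e1 != 0 -> e2 != 0 -> e3 != 0 -> m != 0 -> e1 + e2 + e3 = 0 ->
  t1 L != 0 -> t2 L != 0 -> t3 L != 0 -> t1 L' != 0 -> t2 L' != 0 -> t3 L' != 0 ->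
  is_sq (t1 L * t2 L * t3 L) -> T \in tors_img e1 e2 e3 m -> prod_cls L L' T ->
  D_real_pt e1 e2 e3 m L -> D_real_pt e1 e2 e3 m L'.
Proof.
apply: (tors_invariance (P := D_field_pt Rreal)).
- exact: D_field_cycle.
- by move=> *; apply: D_field_scale; last eassumption.
- by move=> *; apply: D_field_translate3; eassumption.
Qed.

(** * Local conditions at odd primes *)

(** If [p] divided both, the first two equations modulo [p] would make it divide t and u1; then the
    equations modulo p^2, with d2 and d3 square-free, would make it divide u2 and u3. *)
Lemma D_padic_unramified (p : nat) (e1 e2 e3 m d1 d2 d3 : int) : prime p ->
  ~~ (p%:Z %| e1)%Z -> ~~ (p%:Z %| m)%Z -> ~~ (p%:Z %| d1)%Z -> sqfree d2 -> sqfree d3 ->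
  D_padic_pt p e1 e2 e3 m (d1, d2, d3) -> ~ ((p%:Z %| d2)%Z /\ (p%:Z %| d3)%Z).
Proof.
move=> pp pe pm pd1 s2 s3 /D_padicE /(_ 2%N) [t [u1 [u2 [u3 [/negP nd [E1 E2 E3]]]]]] [pd2 pd3].
have pt : (p%:Z %| t)%Z.
  have : (p%:Z %| e1 * m * t ^+ 2)%Z.
    have F := dvdz_comb2 (a := u2 ^+ 2) (b := - u3 ^+ 2) pd2 pd3 erefl.
    by apply: dvdz_comb2 (dvdz_prime1 (isT : 0 < 2)%N E1) F (_ : _ = 1 * _ + (-1) * _); ring.
  by rewrite prime_dvdzM // prime_dvdzX2 // prime_dvdzM // (negbTE pe) (negbTE pm).
have pu1 : (p%:Z %| u1)%Z.
  have : (p%:Z %| d1 * u1 ^+ 2)%Z.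
    have F := dvdz_comb2 (a := e2 * m * t) (b := u3 ^+ 2) pt pd3 erefl.
    by apply: dvdz_comb2 (dvdz_prime1 (isT : 0 < 2)%N E2) F (_ : _ = (-1) * _ + 1 * _); ring.
  by rewrite prime_dvdzM // prime_dvdzX2 // (negbTE pd1).
have sq0 x : (p%:Z %| x)%Z -> ((p ^ 2)%N%:Z %| x ^+ 2)%Z.
  by move=> px; rewrite -mulnn PoszM expr2 dvdz_mul.
have pu2 : (p%:Z %| u2)%Z.
  apply: sqfree_dvd_cancel pp s2 _.
  apply: dvdz_comb2 (_ : ((p ^ 2)%N%:Z %| e3 * m * t ^+ 2 + d1 * u1 ^+ 2)%Z) E3 (_ : _ = 1 * _ + (-1) * _).
    by apply: rpredD; apply: dvdz_mull; apply: sq0.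
  ring.
apply: nd; rewrite pt pu1 pu2 /=; apply: sqfree_dvd_cancel pp s3 _.
apply: dvdz_comb2 (_ : ((p ^ 2)%N%:Z %| e1 * m * t ^+ 2 + d2 * u2 ^+ 2)%Z) E1 (_ : _ = 1 * _ + (-1) * _).
  by apply: rpredD; apply: dvdz_mull; apply: sq0.
ring.
Qed.

(** Once [t] and [u3] are chosen, the first two equations prescribe u2^2 and u1^2, and the third is
    a consequence because e1 + e2 + e3 = 0. *)
Lemma D_padic_solve3 (p : nat) (e1 e2 e3 m d1 d2 d3 t u3 : int) : prime p ->
  e1 + e2 + e3 = 0 -> ~~ (p%:Z %| d1)%Z -> ~~ (p%:Z %| d2)%Z ->
  ~~ ((p%:Z %| t)%Z && (p%:Z %| u3)%Z) ->
  padic_sq p (d2 * (d3 * u3 ^+ 2 - e1 * m * t ^+ 2)) ->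
  padic_sq p (d1 * (d3 * u3 ^+ 2 + e2 * m * t ^+ 2)) ->
  D_padic_pt p e1 e2 e3 m (d1, d2, d3).
Proof.
move=> pp /eqP; rewrite addrC addr_eq0 => /eqP -> pd1 pd2 nd /(padic_sq_solve pp pd2) S2 /(padic_sq_solve pp pd1) S1.
apply/D_padicE => k; have [u2 E2] := S2 k; have [u1 E1] := S1 k.
exists t, u1, u2, u3; split; first by apply: contra nd => /and4P[-> _ _ ->].
split.
- by apply: dvdz_scale E2 (_ : _ = 1 * _); ring.
- by apply: dvdz_scale E1 (_ : _ = (-1) * _); ring.
- by apply: dvdz_comb2 E1 E2 (_ : _ = 1 * _ + (-1) * _); ring.
Qed.

Lemma quadres_congr (p : nat) (a b : int) :
  (p%:Z %| a - b)%Z -> quadres p a -> quadres p b.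
Proof. by move=> ab [x Ex]; exists x; apply: dvdz_comb2 ab Ex (_ : _ = 1 * _ + 1 * _); ring. Qed.

Lemma padic_sq_congr (p : nat) (a b : int) : prime p -> odd p ->
  ~~ (p%:Z %| b)%Z -> quadres p a -> (p%:Z %| a - b)%Z -> padic_sq p b.
Proof. by move=> pp op pb qa ab; apply: hensel_odd => //; apply: quadres_congr ab qa. Qed.

(** The point lies at t = 0, so the lemma also serves at primes dividing m or one of the e's. *)
Lemma D_padic_quadres (p : nat) (e1 e2 e3 m d1 d2 d3 : int) : prime p -> odd p ->
  e1 + e2 + e3 = 0 -> ~~ (p%:Z %| d1)%Z -> ~~ (p%:Z %| d2)%Z -> ~~ (p%:Z %| d3)%Z ->
  quadres p d1 -> quadres p d2 -> quadres p d3 -> D_padic_pt p e1 e2 e3 m (d1, d2, d3).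
Proof.
move=> pp op Es p1 p2 p3 q1 q2 q3.
apply: (D_padic_solve3 (t := 0) (u3 := 1)) => //.
- by rewrite dvdz0 /= dvdz1 absz_nat; have := prime_gt1 pp; lia.
- apply: hensel_odd => //; rewrite expr0n expr1n mulr0 subr0 mulr1; last exact: quadresM.
  by rewrite prime_dvdzM // negb_or p2.
- apply: hensel_odd => //; rewrite expr0n expr1n mulr0 addr0 mulr1; last exact: quadresM.
  by rewrite prime_dvdzM // negb_or p1.
Qed.

(** At t = 1 put X = d1 u1^2; then d2 u2^2 = X + e3 m and d3 u3^2 = X - e2 m. As d1 is a square
    modulo [p] while d2 and d3 are not, a point modulo [p] is an X of the kind found by
    [quadres_pattern]. Lifting fixes u3 and takes roots of two units; if X or X + e3 m vanishes
    modulo [p], the indices are rotated so that the vanishing coordinate is the fixed one, set to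
    0. *)
Lemma D_padic_good1 (p : nat) (e1 e2 e3 m d1 d2 d3 : int) : prime p -> odd p ->
  e1 + e2 + e3 = 0 ->
  ~~ (p%:Z %| e1)%Z -> ~~ (p%:Z %| e2)%Z -> ~~ (p%:Z %| e3)%Z -> ~~ (p%:Z %| m)%Z ->
  ~~ (p%:Z %| d1)%Z -> ~~ (p%:Z %| d2)%Z -> ~~ (p%:Z %| d3)%Z ->
  quadres p d1 -> ~ quadres p d2 -> ~ quadres p d3 ->
  D_padic_pt p e1 e2 e3 m (d1, d2, d3).
Proof.
move=> pp op Es pe1 pe2 pe3 pm p1 p2 p3 q1 q2 q3.
have Ee3 : e3 = - (e1 + e2) by apply/eqP; rewrite -addr_eq0 addrC Es.
have n1 : ~~ (p%:Z %| 1)%Z by rewrite dvdz1 absz_nat; have := prime_gt1 pp; lia.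
have nM x y : ~~ (p%:Z %| x)%Z -> ~~ (p%:Z %| y)%Z -> ~~ (p%:Z %| x * y)%Z.
  by move=> px py; rewrite prime_dvdzM // negb_or px.
have nC (x y : int) : (p%:Z %| x - y)%Z -> ~~ (p%:Z %| x)%Z -> ~~ (p%:Z %| y)%Z.
  move=> xy; apply: contra => py; apply: dvdz_comb2 xy py (_ : _ = 1 * _ + 1 * _); ring.
have [||| X [qX HA HB]] := quadres_pattern (a := - (e3 * m)) (b := e2 * m) pp op.
- by rewrite dvdzE abszN -dvdzE nM.
- exact: nM.
- rewrite (_ : - (e3 * m) - e2 * m = e1 * m); first exact: nM.
  by rewrite Ee3; ring.
rewrite opprK in HA.
have [pX|pX] := boolP (p%:Z %| X)%Z.
  have {}HA : ~ quadres p (e3 * m).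
    case: HA => [HA|HA qe]; last first.
      by apply: HA; apply: quadres_congr qe; apply: dvdz_scale pX (_ : _ = (-1) * _); ring.
    by case/negP: (nM _ _ pe3 pm); apply: dvdz_comb2 HA pX (_ : _ = 1 * _ + (-1) * _); ring.
  have {}HB : ~ quadres p (- (e2 * m)).
    case: HB => [HB|HB qe]; last first.
      by apply: HB; apply: quadres_congr qe; apply: dvdz_scale pX (_ : _ = (-1) * _); ring.
    by case/negP: (nM _ _ pe2 pm); apply: dvdz_comb2 HB pX (_ : _ = (-1) * _ + 1 * _); ring.
  have : D_padic_pt p e2 e3 e1 m (d2, d3, d1).
    apply: (D_padic_solve3 (t := 1) (u3 := 0)) => //.
    - by rewrite -Es; ring.
    - by rewrite (negbTE n1).
    - have -> : d3 * (d1 * 0 ^+ 2 - e2 * m * 1 ^+ 2) = d3 * (- (e2 * m)) by ring.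
      apply: hensel_odd => //; first by rewrite nM // dvdzE abszN -dvdzE nM.
      exact: quadresM_non.
    - have -> : d2 * (d1 * 0 ^+ 2 + e3 * m * 1 ^+ 2) = d2 * (e3 * m) by ring.
      apply: hensel_odd => //; first by rewrite !nM.
      exact: quadresM_non.
  by move=> H; apply: D_padic_cycle (D_padic_cycle H).
have [pA|pA] := boolP (p%:Z %| X + e3 * m)%Z.
  have cB : (p%:Z %| X - e2 * m - e1 * m)%Z.
    by apply: dvdz_scale pA (_ : _ = 1 * _); rewrite Ee3; ring.
  have {}HB : ~ quadres p (e1 * m).
    case: HB => [HB|HB qe]; last first.
      by apply: HB; apply: quadres_congr qe; apply: dvdz_scale cB (_ : _ = (-1) * _); ring.
    by case/negP: (nM _ _ pe1 pm); apply: dvdz_comb2 HB cB (_ : _ = 1 * _ + (-1) * _); ring.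
  have : D_padic_pt p e3 e1 e2 m (d3, d1, d2).
    apply: (D_padic_solve3 (t := 1) (u3 := 0)) => //.
    - by rewrite -Es; ring.
    - by rewrite (negbTE n1).
    - have -> : d1 * (d2 * 0 ^+ 2 - e3 * m * 1 ^+ 2) = d1 * (- (e3 * m)) by ring.
      apply: (padic_sq_congr (a := d1 * X)) => //; first by rewrite nM // dvdzE abszN -dvdzE nM.
        exact: quadresM.
      by apply: dvdz_scale pA (_ : _ = d1 * _); ring.
    - have -> : d3 * (d2 * 0 ^+ 2 + e1 * m * 1 ^+ 2) = d3 * (e1 * m) by ring.
      apply: hensel_odd => //; first by rewrite !nM.
      exact: quadresM_non.
  exact: D_padic_cycle.
have {}HA : ~ quadres p (X + e3 * m) by case: HA => // H; rewrite H in pA.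
have [v Hv] : exists v, (p%:Z %| d3 * v ^+ 2 - (X - e2 * m))%Z.
  have [pB|pB] := boolP (p%:Z %| X - e2 * m)%Z.
    by exists 0; apply: dvdz_scale pB (_ : _ = (-1) * _); ring.
  have qB : quadres p (d3 * (X - e2 * m)).
    by apply: quadresM_non => //; case: HB => // H; rewrite H in pB.
  have [v Hv] := padic_sq_solve pp p3 (hensel_odd pp op (nM _ _ p3 pB) qB) 1.
  by exists v; rewrite expn1 in Hv.
apply: (D_padic_solve3 (t := 1) (u3 := v)) => //.
- by rewrite (negbTE n1).
- have C : (p%:Z %| d2 * (X + e3 * m) - d2 * (d3 * v ^+ 2 - e1 * m * 1 ^+ 2))%Z.
    by apply: dvdz_scale Hv (_ : _ = (- d2) * _); rewrite Ee3; ring.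
  have nB := nC _ _ C (nM _ _ p2 pA).
  by apply: padic_sq_congr C => //; exact: quadresM_non.
- have C : (p%:Z %| d1 * X - d1 * (d3 * v ^+ 2 + e2 * m * 1 ^+ 2))%Z.
    by apply: dvdz_scale Hv (_ : _ = (- d1) * _); ring.
  have nB := nC _ _ C (nM _ _ p1 pX).
  by apply: padic_sq_congr C => //; exact: quadresM.
Qed.

(** As the product is a square, either all three entries are squares modulo [p] or exactly one is,
    and a rotation puts that one first. *)
Lemma D_padic_good (p : nat) (e1 e2 e3 m d1 d2 d3 : int) : prime p -> odd p ->
  e1 + e2 + e3 = 0 ->
  ~~ (p%:Z %| e1)%Z -> ~~ (p%:Z %| e2)%Z -> ~~ (p%:Z %| e3)%Z -> ~~ (p%:Z %| m)%Z ->
  ~~ (p%:Z %| d1)%Z -> ~~ (p%:Z %| d2)%Z -> ~~ (p%:Z %| d3)%Z ->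
  is_sq (d1 * d2 * d3) -> D_padic_pt p e1 e2 e3 m (d1, d2, d3).
Proof.
move=> pp op Es pe1 pe2 pe3 pm p1 p2 p3 [w Ew].
have qw : quadres p (d1 * d2 * d3) by rewrite Ew -expr2; apply: quadres_sqr.
have nM x y : ~~ (p%:Z %| x)%Z -> ~~ (p%:Z %| y)%Z -> ~~ (p%:Z %| x * y)%Z.
  by move=> px py; rewrite prime_dvdzM // negb_or px.
case: (classic (quadres p d1)) => q1; case: (classic (quadres p d2)) => q2.
- apply: D_padic_quadres => //; apply: quadres_divl qw => //; first exact: nM.
  exact: quadresM.
- apply: D_padic_good1 => // q3; apply: q2.
  apply: (quadres_divl (u := d1 * d3)) => //; first exact: nM.
    exact: quadresM.
  by rewrite mulrAC.
- apply/D_padic_cycle/D_padic_cycle; apply: D_padic_good1 => //; first by rewrite -Es; ring.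
  move=> q3; apply: q1; apply: (quadres_divl (u := d2 * d3)) => //; first exact: nM.
    exact: quadresM.
  by rewrite mulrC mulrA.
- apply/D_padic_cycle; apply: D_padic_good1 => //; first by rewrite -Es; ring.
  apply: quadres_divl qw => //; first exact: nM.
  exact: quadresM_non.
Qed.

(** Modulo [p] the terms in t vanish and d1 u1^2 = d2 u2^2 = d3 u3^2. This common value is a unit:
    otherwise [p] divides every u_i, and modulo p^2 the first equation makes it divide t, because
    [p] divides m only once. So the products d_i d_j are squares modulo [p], and with d1 d2 d3 each
    d_i is. *)
Lemma D_padic_multiplicative (p : nat) (e1 e2 e3 m d1 d2 d3 : int) : prime p ->
  ~~ (p%:Z %| e1)%Z -> (p%:Z %| m)%Z -> ~~ ((p ^ 2)%N%:Z %| m)%Z ->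
  ~~ (p%:Z %| d1)%Z -> ~~ (p%:Z %| d2)%Z -> ~~ (p%:Z %| d3)%Z ->
  is_sq (d1 * d2 * d3) -> D_padic_pt p e1 e2 e3 m (d1, d2, d3) ->
  [/\ quadres p d1, quadres p d2 & quadres p d3].
Proof.
move=> pp pe pm pm2 p1 p2 p3 [w Ew] /D_padicE /(_ 2%N) [t [u1 [u2 [u3 [/negP nd [E1 E2 E3]]]]]].
have F1 : (p%:Z %| d2 * u2 ^+ 2 - d3 * u3 ^+ 2)%Z.
  apply: dvdz_comb2 (dvdz_prime1 (isT : 0 < 2)%N E1) pm (_ : _ = 1 * _ + (- (e1 * t ^+ 2)) * _); ring.
have F2 : (p%:Z %| d3 * u3 ^+ 2 - d1 * u1 ^+ 2)%Z.
  apply: dvdz_comb2 (dvdz_prime1 (isT : 0 < 2)%N E2) pm (_ : _ = 1 * _ + (- (e2 * t ^+ 2)) * _); ring.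
have sq0 x : (p%:Z %| x)%Z -> ((p ^ 2)%N%:Z %| x ^+ 2)%Z.
  by move=> px; rewrite -mulnn PoszM expr2 dvdz_mul.
have unit_sq d u : ~~ (p%:Z %| d)%Z -> (p%:Z %| d * u ^+ 2)%Z = (p%:Z %| u)%Z.
  by move=> pd; rewrite prime_dvdzM // prime_dvdzX2 // (negbTE pd).
have pu3 : ~~ (p%:Z %| u3)%Z.
  apply/negP=> pu3; have pd3 : (p%:Z %| d3 * u3 ^+ 2)%Z by rewrite unit_sq.
  have pu2 : (p%:Z %| u2)%Z.
    by rewrite -(unit_sq d2) //; apply: dvdz_comb2 F1 pd3 (_ : _ = 1 * _ + 1 * _); ring.
  have pu1 : (p%:Z %| u1)%Z.
    by rewrite -(unit_sq d1) //; apply: dvdz_comb2 F2 pd3 (_ : _ = (-1) * _ + 1 * _); ring.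
  apply: nd; rewrite pu1 pu2 pu3 !andbT.
  apply: contraNT pm2 => pt.
  have : ((p ^ 2)%N%:Z %| (e1 * t ^+ 2) * m)%Z.
    apply: dvdz_comb2 E1 (_ : ((p ^ 2)%N%:Z %| d2 * u2 ^+ 2 - d3 * u3 ^+ 2)%Z) (_ : _ = 1 * _ + (-1) * _).
      by apply: rpredB; apply: dvdz_mull; apply: sq0.
    ring.
  rewrite Gauss_dvdzr //; apply: coprimez_primeX => //.
  by rewrite prime_dvdzM // prime_dvdzX2 // negb_or pe.
have pu2 : ~~ (p%:Z %| u2)%Z.
  rewrite -(unit_sq d2) //; apply: contra pu3 => H; rewrite -(unit_sq d3) //.
  by apply: dvdz_comb2 F1 H (_ : _ = (-1) * _ + 1 * _); ring.
have pu1 : ~~ (p%:Z %| u1)%Z.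
  rewrite -(unit_sq d1) //; apply: contra pu3 => H; rewrite -(unit_sq d3) //.
  by apply: dvdz_comb2 F2 H (_ : _ = 1 * _ + 1 * _); ring.
have nM x y : ~~ (p%:Z %| x)%Z -> ~~ (p%:Z %| y)%Z -> ~~ (p%:Z %| x * y)%Z.
  by move=> px py; rewrite prime_dvdzM // negb_or px.
have Q d d' u u' : ~~ (p%:Z %| u)%Z -> (p%:Z %| d * u ^+ 2 - d' * u' ^+ 2)%Z -> quadres p (d * d').
  move=> pu H; apply: (quadres_cancel pp pu); exists (d' * u').
  by apply: dvdz_scale H (_ : _ = (- d') * _); ring.
have q23 : quadres p (d2 * d3) by apply: Q pu2 F1.
have q31 : quadres p (d3 * d1) by apply: Q pu3 F2.
have q1 : quadres p d1.
  apply: (quadres_divl (u := d2 * d3)) => //; first exact: nM.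
  by rewrite mulrC mulrA Ew -expr2; apply: quadres_sqr.
have q3 : quadres p d3 by apply: (quadres_divl pp p1 q1); rewrite mulrC.
by split=> //; apply: (quadres_divl pp p3 q3); rewrite mulrC.
Qed.

(** * Solvability at 2 *)

(** The first equation times d3 is the conic, with z = d3 u3. Forgetting u1 keeps a bounded form of
    primitivity: if t, u2 and z are divisible by a high power of [p], the second equation makes u1
    divisible by [p] too. *)
Lemma D_padic_conic (p : nat) (e1 e2 e3 m d1 d2 d3 : int) : prime p ->
  d1 != 0 -> d3 != 0 -> D_padic_pt p e1 e2 e3 m (d1, d2, d3) ->
  conic_loc p (d3 * (e1 * m)) (d2 * d3).
Proof.
move=> pp n1 n3 /D_padicE HD; have [v Hv] := primeX_cancel pp (mulf_neq0 n1 n3).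
exists (1 + v)%N => k; have [t [u1 [u2 [u3 [nd [E1 E2 _]]]]]] := HD (k + (1 + v))%N.
exists t, u2, (d3 * u3); split; last first.
  by apply: dvdz_scale (dvdz_primeX (leq_addr _ _) E1) (_ : _ = (- d3) * _); ring.
apply: contra nd => /and3P[a0 a2 a3].
have small x : ((p ^ (1 + v))%N%:Z %| x)%Z -> (p%:Z %| x)%Z by apply: dvdz_prime1.
rewrite (small _ a0) (small _ a2) /=.
have b3 : ((p ^ (1 + v))%N%:Z %| d1 * d3 * u3)%Z by apply: dvdz_scale a3 (_ : _ = d1 * _); ring.
have := Hv _ _ b3; rewrite expn1 => ->; rewrite andbT.
rewrite -prime_dvdzX2 //.
have b1 : ((p ^ (1 + v))%N%:Z %| d1 * d3 * u1 ^+ 2)%Z.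
  have F := dvdz_comb2 (a := e2 * m * d3 * t) (b := d3 * u3) a0 a3 erefl.
  by apply: dvdz_comb2 (dvdz_primeX (leq_addl _ _) E2) F (_ : _ = (- d3) * _ + 1 * _); ring.
by have := Hv _ _ b1; rewrite expn1.
Qed.

(** With both coefficients negative the conic would force t = u2 = u3 = 0, and the second equation
    u1 = 0. *)
Lemma D_field_conic (K : realFieldType) (e1 e2 e3 m d1 d2 d3 : int) :
  e1 != 0 -> m != 0 -> d1 != 0 -> d2 != 0 -> d3 != 0 -> D_field_pt K e1 e2 e3 m (d1, d2, d3) ->
  (0 < d3 * (e1 * m)) || (0 < d2 * d3).
Proof.
move=> ne nm n1 n2 n3 /D_fieldE[t [u1 [u2 [u3 [nz [E1 E2 _]]]]]].
apply: contraT; rewrite negb_or -!leNgt => /andP[A B].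
have {}A : d3%:~R * (e1%:~R * m%:~R) < 0 :> K.
  by rewrite -!intrM ltrz0 lt_neqAle A andbT !mulf_neq0.
have {}B : d2%:~R * d3%:~R < 0 :> K.
  by rewrite -!intrM ltrz0 lt_neqAle B andbT !mulf_neq0.
have F : (d3%:~R * u3) ^+ 2 - (d3%:~R * (e1%:~R * m%:~R)) * t ^+ 2 - (d2%:~R * d3%:~R) * u2 ^+ 2 = 0.
  by rewrite -[RHS](mulr0 (- d3%:~R)) -E1; ring.
have P1 := sqr_ge0 (d3%:~R * u3).
have P2 : 0 <= - ((d3%:~R * (e1%:~R * m%:~R)) * t ^+ 2).
  by rewrite oppr_ge0 nmulr_rle0 ?sqr_ge0.
have P3 : 0 <= - ((d2%:~R * d3%:~R) * u2 ^+ 2) by rewrite oppr_ge0 nmulr_rle0 ?sqr_ge0.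
have /eqP : (d3%:~R * u3) ^+ 2 = 0 by lra.
rewrite expf_eq0 /= mulf_eq0 intr_eq0 (negbTE n3) /= => /eqP u30.
have /eqP : (d3%:~R * (e1%:~R * m%:~R)) * t ^+ 2 = 0 by lra.
rewrite mulf_eq0 (lt_eqF A) expf_eq0 /= => /eqP t0.
have /eqP : (d2%:~R * d3%:~R) * u2 ^+ 2 = 0 by lra.
rewrite mulf_eq0 (lt_eqF B) expf_eq0 /= => /eqP u20.
have : d1%:~R * u1 ^+ 2 = 0 by move: E2; rewrite t0 u30; lra.
move/eqP; rewrite mulf_eq0 intr_eq0 (negbTE n1) expf_eq0 /= => /eqP u10.
by move: nz; rewrite t0 u10 u20 u30 eqxx.
Qed.

Definition conic_sol (a b : int) : Prop :=
  exists x y z : int, [|| x != 0, y != 0 | z != 0] /\ z ^+ 2 = a * x ^+ 2 + b * y ^+ 2.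

Lemma D_conic_sol (e1 e2 e3 m d1 d2 d3 : int) :
  e1 != 0 -> m != 0 -> d1 != 0 -> d2 != 0 -> d3 != 0 ->
  D_field_pt Rreal e1 e2 e3 m (d1, d2, d3) ->
  (forall p : nat, prime p -> odd p -> D_padic_pt p e1 e2 e3 m (d1, d2, d3)) ->
  conic_sol (d3 * (e1 * m)) (d2 * d3).
Proof.
move=> ne nm n1 n2 n3 HR Hp; apply: legendre; rewrite ?mulf_neq0 //.
- exact: D_field_conic HR.
- by move=> p pp op; apply: D_padic_conic (Hp p pp op).
Qed.

Lemma conic_sol_odd (a b : int) : conic_sol a b ->
  exists x y z : int, ~~ [&& (2 %| x)%Z, (2 %| y)%Z & (2 %| z)%Z] /\ z ^+ 2 = a * x ^+ 2 + b * y ^+ 2.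
Proof.
move=> [x [y [z []]]].
elim: {x y z}_.+1 {-2}x {-2}y {-2}z (ltnSn (`|x| + `|y| + `|z|)%N) => // N IH x y z xN nz E.
have [/and3P[/dvdzP[x' Ex] /dvdzP[y' Ey] /dvdzP[z' Ez]]|nd] := boolP [&& (2 %| x)%Z, (2 %| y)%Z & (2 %| z)%Z]; last first.
  by exists x, y, z.
apply: (IH x' y' z').
- by move: xN nz; rewrite Ex Ey Ez; lia.
- by move: nz; rewrite Ex Ey Ez; lia.
- have F : 4 * (z' ^+ 2) = 4 * (a * x' ^+ 2 + b * y' ^+ 2).
    by transitivity (z ^+ 2); [rewrite Ez; ring|rewrite E Ex Ey; ring].
  by apply: (mulfI (isT : (4 : int) != 0)).
Qed.

Lemma sqr_mod8 (x : int) : (2 %| x)%Z /\ (4 %| x ^+ 2)%Z \/ ~~ (2 %| x)%Z /\ (8 %| x ^+ 2 - 1)%Z.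
Proof.
have [/dvdzP[y ->]|ox] := boolP (2 %| x)%Z.
  by left; split=> //; apply/dvdzP; exists (y ^+ 2); ring.
right; split=> //.
have [y [Ey|Ey]] : exists y, x = 4 * y + 1 \/ x = 4 * y - 1.
  by exists ((x + 1) %/ 4)%Z; lia.
- by rewrite Ey; apply/dvdzP; exists (2 * y ^+ 2 + y); ring.
- by rewrite Ey; apply/dvdzP; exists (2 * y ^+ 2 - y); ring.
Qed.

(** Otherwise x^2 + y^2 + z^2 would be divisible by 4, which makes x, y and z all even. *)
Lemma conic_sol_mod4 (a b : int) : conic_sol a b -> ~ ((4 %| a + 1)%Z /\ (4 %| b + 1)%Z).
Proof.
move=> /conic_sol_odd [x [y [z [nd E]]]] [A B].
have F : (4 %| x ^+ 2 + y ^+ 2 + z ^+ 2)%Z.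
  by apply: dvdz_comb2 A B (_ : _ = x ^+ 2 * _ + y ^+ 2 * _); rewrite E; ring.
move: F nd; have := (sqr_mod8 x, sqr_mod8 y, sqr_mod8 z).
move: (x ^+ 2) (y ^+ 2) (z ^+ 2) => X Y Z [[[]] + []] + [] + F /negP; lia.
Qed.

(** As a is 2 modulo 4, a solution that is not entirely even has y and z odd; the two alternatives
    correspond to x even and x odd. *)
Lemma conic_sol_mod8 (a b : int) : conic_sol a b -> (2 %| a)%Z -> ~~ (4 %| a)%Z -> ~~ (2 %| b)%Z ->
  (8 %| b - 1)%Z \/ (8 %| a + b - 1)%Z.
Proof.
move=> /conic_sol_odd [x [y [z [nd E]]]] A2 A4 B2.
have D (q : int) u v : (q %| v)%Z -> (q %| u * v)%Z by apply: dvdz_mull.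
have [[yE y4]|[yO y8]] := sqr_mod8 y; have [[zE z4]|[zO z8]] := sqr_mod8 z; have [[xE x4]|[xO x8]] := sqr_mod8 x.
- by rewrite xE yE zE in nd.
- have := D 4 a _ (dvdz_trans (isT : (4 %| 8)%Z) x8); have := D 4 b _ y4; move: E z4 A4.
  rewrite mulrBr mulr1; move: (x ^+ 2) (y ^+ 2) (z ^+ 2) => X Y Z.
  by move: (a * X) (b * Y) => aX bY; lia.
- have := D 2 b _ yE; have := dvdz_mulr (x ^+ 2) A2; move: E z8 yE.
  by rewrite -(prime_dvdzX2 y (isT : prime 2)) => + + /(D 2 b); move: (a * _) (b * y ^+ 2) (z ^+ 2) => *; lia.
- have := D 2 b _ yE; have := dvdz_mulr (x ^+ 2) A2; move: E z8 yE.
  by rewrite -(prime_dvdzX2 y (isT : prime 2)) => + + /(D 2 b); move: (a * _) (b * y ^+ 2) (z ^+ 2) => *; lia.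
- have := dvdz_mulr (x ^+ 2) A2; have := D 8 b _ y8; rewrite mulrBr mulr1; move: E z4 B2.
  by move: (a * _) (b * y ^+ 2) (z ^+ 2) => *; lia.
- have := dvdz_mulr (x ^+ 2) A2; have := D 8 b _ y8; rewrite mulrBr mulr1; move: E z4 B2.
  by move: (a * _) (b * y ^+ 2) (z ^+ 2) => *; lia.
- have := dvdz_mul A2 x4; rewrite -[2 * 4]/(8 : int) => AX; left.
  have := D 8 b _ y8; rewrite mulrBr mulr1; move: E z8 AX.
  by move: (a * _) (b * y ^+ 2) (z ^+ 2) => *; lia.
- right; have := D 8 a _ x8; have := D 8 b _ y8; rewrite !mulrBr !mulr1; move: E z8.
  by move: (a * _) (b * y ^+ 2) (z ^+ 2) => *; lia.
Qed.

Lemma dvdz8_Zp (z : int) : (8 %| z)%Z = (z%:~R == 0 :> 'Z_8).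
Proof.
case: z => k; rewrite ?NegzE ?rmorphN ?oppr_eq0 /= -pmulrn -(Zp_nat_mod (isT : (1 < 8)%N)).
  rewrite dvdzE /= /dvdn; apply/eqP/eqP => [->//|].
  by move/(congr1 val); rewrite /= val_Zp_nat // modn_mod.
rewrite dvdzE /= /dvdn; apply/eqP/eqP => [->//|].
by move/(congr1 val); rewrite /= val_Zp_nat // modn_mod.
Qed.

(** [f1] and [f2] stand for e1 m and e2 m, so that f1 + f2 = - e3 m; d3 = d1 d2 because every odd
    square is 1 modulo 8; multiplying by 2 expresses conditions modulo 4 in ['Z_8]. The guards are 4
    not dividing e3 m and the conditions of the three conics. [S] lists candidates for (t, u3), and
    the value 1 is what [hensel_two] asks for. *)
Lemma two_adic_residues :
  let U : seq 'Z_8 := [:: 1; 3%:R; 5%:R; 7%:R] in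
  let S : seq ('Z_8 * 'Z_8) := [:: (0, 1); (2%:R, 1); (1, 0); (1, 2%:R)] in
  all (fun d1 : 'Z_8 => all (fun d2 : 'Z_8 => all (fun f1 : 'Z_8 => all (fun f2 : 'Z_8 =>
    let d3 := d1 * d2 in
    [&& (2%:R * (f1 + f2) != 0),
        ~~ ((2%:R * (d3 * f1 + 1) == 0) && (2%:R * (d2 * d3 + 1) == 0)),
        ~~ ((2%:R * (d1 * f2 + 1) == 0) && (2%:R * (d3 * d1 + 1) == 0)) &
        (d1 * d2 - 1 == 0) || (d1 * d2 - d2 * (f1 + f2) - 1 == 0)] ==>
    has (fun s => (d2 * (d3 * s.2 ^+ 2 - f1 * s.1 ^+ 2) == 1) &&
                  (d1 * (d3 * s.2 ^+ 2 + f2 * s.1 ^+ 2) == 1)) S) U) U) U) U.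
Proof. by vm_compute. Qed.

Lemma odd_Zp8 (d : int) : ~~ (2 %| d)%Z -> (d%:~R : 'Z_8) \in [:: 1; 3%:R; 5%:R; 7%:R].
Proof.
move=> od; have [q [r [Ed Hr]]] : exists q r : int, d = 8 * q + r /\ (r : int) \in [:: 1; 3; 5; 7].
  by exists (d %/ 8)%Z, (d %% 8)%Z; split; rewrite ?inE; lia.
have E8 : 8%:~R = 0 :> 'Z_8 by apply/val_inj.
rewrite Ed rmorphD rmorphM /= E8 mul0r add0r.
by move: Hr; rewrite !inE => /or4P[] /eqP ->.
Qed.

(* A rational point on each of the three conics replaces the missing information at 2
   (this is reciprocity, in the form of Legendre's theorem). *)
Lemma D_padic_two (e1 e2 e3 m d1 d2 d3 : int) : e1 + e2 + e3 = 0 ->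
  ~~ (2 %| e1)%Z -> ~~ (2 %| e2)%Z -> ~~ (4 %| e3)%Z -> ~~ (2 %| m)%Z ->
  ~~ (2 %| d1)%Z -> ~~ (2 %| d2)%Z -> ~~ (2 %| d3)%Z -> is_sq (d1 * d2 * d3) ->
  D_real_pt e1 e2 e3 m (d1, d2, d3) ->
  (forall p : nat, prime p -> odd p -> D_padic_pt p e1 e2 e3 m (d1, d2, d3)) ->
  D_padic_pt 2 e1 e2 e3 m (d1, d2, d3).
Proof.
move=> Es o1 o2 o4 om od1 od2 od3 [w Ew] HR Hp.
have nz (x : int) : ~~ (2 %| x)%Z -> x != 0 by lia.
have oM (x y : int) : ~~ (2 %| x)%Z -> ~~ (2 %| y)%Z -> ~~ (2 %| x * y)%Z.
  by move=> ox oy; rewrite (prime_dvdzM _ _ (isT : prime 2)) negb_or ox.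
have n3 : e3 != 0 by move: o4; lia.
have Ee3 : e3 = - (e1 + e2) by apply/eqP; rewrite -addr_eq0 addrC Es.
have HR2 := D_field_cycle HR; have HR3 := D_field_cycle HR2.
have Hp2 p pp op := D_padic_cycle (Hp p pp op); have Hp3 p pp op := D_padic_cycle (Hp2 p pp op).
have C1 := D_conic_sol (nz _ o1) (nz _ om) (nz _ od1) (nz _ od2) (nz _ od3) HR Hp.
have C2 := D_conic_sol (nz _ o2) (nz _ om) (nz _ od2) (nz _ od3) (nz _ od1) HR2 Hp2.
have C3 := D_conic_sol n3 (nz _ om) (nz _ od3) (nz _ od1) (nz _ od2) HR3 Hp3.
have M1 := conic_sol_mod4 C1; have M2 := conic_sol_mod4 C2.
have e3m4 : ~~ (4 %| e3 * m)%Z.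
  by rewrite Gauss_dvdzl //; exact: (coprimez_primeX 2 (isT : prime 2) om).
have M3 : (8 %| d1 * d2 - 1)%Z \/ (8 %| d2 * (e3 * m) + d1 * d2 - 1)%Z.
  apply: conic_sol_mod8 C3 _ _ _; last exact: oM.
    by rewrite dvdz_mull // dvdz_mulr // Ee3; lia.
  by rewrite Gauss_dvdzr //; exact: (coprimez_primeX 2 (isT : prime 2) od2).
have w8 : (8 %| d1 * d2 * d3 - 1)%Z.
  have [[ew _]|[_]] := sqr_mod8 w; last by rewrite expr2 -Ew.
  have := oM _ _ (oM _ _ od1 od2) od3; rewrite Ew (prime_dvdzM _ _ (isT : prime 2)).
  by have := ew; lia.
have d38 : (8 %| d3 - d1 * d2)%Z.
  have sq1 (x : int) : ~~ (2 %| x)%Z -> (8 %| x ^+ 2 - 1)%Z by case: (sqr_mod8 x) => -[-> ].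
  have := sq1 _ (oM _ _ od1 od2) => S.
  by apply: dvdz_comb2 w8 S (_ : _ = (d1 * d2) * _ + (- d3) * _); ring.
have dvd4 (x : int) : (4 %| x)%Z = (2%:R * x%:~R == 0 :> 'Z_8).
  have -> : 2%:R * x%:~R = (2 * x)%:~R :> 'Z_8 by rewrite rmorphM.
  by rewrite -dvdz8_Zp; lia.
pose r (x : int) : 'Z_8 := x%:~R.
have rM x y : r (x * y) = r x * r y by rewrite /r rmorphM.
have E3 : r d3 = r d1 * r d2.
  by move: d38; rewrite dvdz8_Zp rmorphB rmorphM subr_eq0 => /eqP.
have := two_adic_residues.
move=> /allP /(_ _ (odd_Zp8 od1)) /allP /(_ _ (odd_Zp8 od2)).
move=> /allP /(_ _ (odd_Zp8 (oM _ _ o1 om))) /allP /(_ _ (odd_Zp8 (oM _ _ o2 om))).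
rewrite -!/(r _) -E3 => /implyP - /(_ _) /hasP.
case.
  have E31 : r (e1 * m) + r (e2 * m) = r (- (e3 * m)).
    by rewrite /r -rmorphD; congr (_%:~R); rewrite Ee3; ring.
  have r1 : 1 = r 1 by [].
  rewrite E31 r1 -!rM /r -!rmorphD -!rmorphB /= -!dvd4 -!dvdz8_Zp; apply/and4P; split.
  - by rewrite dvdzE abszN -dvdzE.
  - by apply/negP => /andP.
  - by apply/negP => /andP.
  - by apply/orP; case: M3 => [M3|M3]; [left|right];
      apply: dvdz_comb2 M3 d38 (_ : _ = 1 * _ + 1 * _); ring.
suff sol (t u3 : int) : ~~ ((2 %| t)%Z && (2 %| u3)%Z) ->
  (r d2 * (r d3 * r u3 ^+ 2 - r (e1 * m) * r t ^+ 2) == 1) &&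
  (r d1 * (r d3 * r u3 ^+ 2 + r (e2 * m) * r t ^+ 2) == 1) -> D_padic_pt 2 e1 e2 e3 m (d1, d2, d3).
  move=> s; rewrite !inE => /or4P[] /eqP -> /=.
  - exact: (sol 0 1).
  - exact: (sol 2 1).
  - exact: (sol 1 0).
  - exact: (sol 1 2).
have r1 : 1 = r 1 by [].
move=> nd; rewrite r1 -!(subr_eq0 _ (r 1)) /r -!rmorphXn -!rmorphM -?rmorphD -?rmorphB -?rmorphM -?rmorphB /=.
rewrite -!dvdz8_Zp => /andP[H2 H1].
by apply: (D_padic_solve3 (t := t) (u3 := u3)) => //; apply: hensel_two.
Qed.

(** * Square classes and parities of valuations *)

(** Together with the sign, these parities are coordinates on the nonzero rationals modulo
    squares. *)
Definition parv (p : nat) (x : int) : bool := odd (logn p `|x|).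

Lemma parvM (p : nat) (x y : int) : x != 0 -> y != 0 -> parv p (x * y) = parv p x (+) parv p y.
Proof. by move=> x0 y0; rewrite /parv abszM lognM ?absz_gt0 // oddD. Qed.

Lemma parv_coprime (p : nat) (x : int) : ~~ (p%:Z %| x)%Z -> parv p x = false.
Proof. by rewrite /parv dvdzE absz_nat lognE => /negbTE ->; rewrite !andbF. Qed.

Lemma parv_exact (p : nat) (x : int) : prime p -> (p%:Z %| x)%Z -> ~~ ((p ^ 2)%N%:Z %| x)%Z ->
  parv p x.
Proof.
move=> pp px px2; have x0 : (0 < `|x|)%N.
  by rewrite absz_gt0; apply: contraNneq px2 => ->; rewrite dvdz0.
have L1 : (0 < logn p `|x|)%N by rewrite logn_gt0 mem_primes pp x0; move: px; rewrite dvdzE.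
have L2 : (logn p `|x| < 2)%N by rewrite ltnNge -pfactor_dvdn //; move: px2; rewrite dvdzE absz_nat.
by rewrite /parv; case: (logn _ _) L1 L2 => [|[|]].
Qed.

Lemma parv_sqfree (p : nat) (x : int) : prime p -> sqfree x -> parv p x = (p%:Z %| x)%Z.
Proof.
move=> pp sx; have [px|/parv_coprime //] := boolP (p%:Z %| x)%Z.
by rewrite parv_exact // sqfree_dvd2.
Qed.

Lemma sqfree_unit (x : int) : sqfree x -> 0 < x -> (forall p : nat, prime p -> ~~ (p%:Z %| x)%Z) -> x = 1.
Proof.
move=> sx x0 H; have [x1|x1] := leqP `|x| 1; first by lia.
by have := H _ (pdiv_prime x1); rewrite dvdzE absz_nat pdiv_dvd.
Qed.

Lemma is_sqP (x : int) : x != 0 ->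
  is_sq x <-> 0 < x /\ forall p : nat, prime p -> parv p x = false.
Proof.
move=> x0; split=> [[y Ey]|[xp H]].
  have y0 : y != 0 by apply: contraNneq x0; rewrite Ey => ->; rewrite mul0r.
  split; first by rewrite Ey -expr2 lt0r sqr_ge0 expf_neq0.
  by move=> p _; rewrite Ey parvM // addbb.
have [d [s [sd s0 E]]] := sqfree_decomp x0; have d0 := sd.1.
have dp : 0 < d.
  by move: xp; rewrite E pmulr_lgt0 // lt0r sqr_ge0 expf_neq0.
suff d1 : d = 1 by exists s; rewrite E d1 mul1r expr2.
apply: sqfree_unit => // p pp; rewrite -parv_sqfree //; have := H p pp.
by rewrite E parvM ?expf_neq0 // expr2 parvM // addbb addbF => ->.
Qed.

Lemma is_sq_mul (x y : int) : is_sq x -> is_sq y -> is_sq (x * y).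
Proof. by move=> [a ->] [b ->]; exists (a * b); ring. Qed.

Lemma is_sq_divl (x y : int) : x != 0 -> is_sq x -> is_sq (x * y) -> is_sq y.
Proof.
move=> x0 sx sxy; have [->|y0] := eqVneq y 0; first by exists 0; rewrite mul0r.
have [xp Hx] := (is_sqP x0).1 sx; have [xyp Hxy] := (is_sqP (mulf_neq0 x0 y0)).1 sxy.
apply/is_sqP => //; split; first by move: xyp; rewrite pmulr_rgt0.
by move=> p pp; have := Hxy p pp; rewrite parvM // Hx.
Qed.

Lemma is_sq_coprimel (x y : int) : 0 < x -> y != 0 -> coprimez x y -> is_sq (x * y) -> is_sq y.
Proof.
move=> xp y0 cxy sxy; have x0 : x != 0 by lia.
have [xyp Hxy] := (is_sqP (mulf_neq0 x0 y0)).1 sxy.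
apply/is_sqP => //; split; first by move: xyp; rewrite pmulr_rgt0.
move=> p pp; have [py|/parv_coprime //] := boolP (p%:Z %| y)%Z.
have := Hxy p pp; rewrite parvM // (@parv_coprime p x) //.
apply/negP => px; have : (p%:Z %| gcdz x y)%Z by rewrite dvdz_gcd px.
by move: cxy; rewrite /coprimez => /eqP ->; rewrite dvdz1 absz_nat; have := prime_gt1 pp; lia.
Qed.

Lemma sqfree_rep (x : int) : x != 0 -> exists2 d, sqfree d & is_sq (d * x).
Proof.
by move=> /sqfree_decomp[d [s [sd _ ->]]]; exists d => //; exists (d * s); ring.
Qed.

Lemma is_sq_mod8 (x : int) : is_sq x -> ~~ (2 %| x)%Z -> (8 %| x - 1)%Z.
Proof.
move=> [y ->]; rewrite -expr2; have [[ey _]|[_ //]] := sqr_mod8 y.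
by rewrite (prime_dvdzX2 y (isT : prime 2)) ey.
Qed.

Lemma sqfree_same_class (x y : int) : sqfree x -> sqfree y -> is_sq (x * y) -> x = y.
Proof.
move=> sx sy sxy; have [x0 _] := sx; have [y0 _] := sy.
have [xyp H] := (is_sqP (mulf_neq0 x0 y0)).1 sxy.
have nat_eq : `|x|%N = `|y|%N.
  apply: eqn_from_log => [||p]; rewrite ?absz_gt0 //.
  have [pp|np] := boolP (prime p); last by rewrite /= (lognE p `|x|) (lognE p `|y|) (negbTE np).
  have le1 z : sqfree z -> (logn p `|z| <= 1)%N.
    by move=> sz; rewrite leqNgt -pfactor_dvdn ?absz_gt0 ?sz.1 //; have := sqfree_dvd2 pp sz; rewrite dvdzE.
  have := H p pp; rewrite parvM // /parv; move: (le1 _ sx) (le1 _ sy).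
  by case: (logn p `|x|) => [|[|]] //; case: (logn p `|y|) => [|[|]].
have [//|xy] : x = y \/ x = - y by clear -nat_eq; lia.
by move: xyp; rewrite xy mulNr oppr_gt0 -expr2 ltNge sqr_ge0.
Qed.

(** * The torsion classes *)

Lemma tors_img_neq0 (e1 e2 e3 m : int) (T : triple) :
  e1 != 0 -> e2 != 0 -> e3 != 0 -> m != 0 -> T \in tors_img e1 e2 e3 m ->
  [/\ t1 T != 0, t2 T != 0 & t3 T != 0].
Proof.
move=> n1 n2 n3 nm; rewrite !inE => /or4P[] /eqP ->; rewrite /t1 /t2 /t3 /=;
by split; rewrite ?oppr_eq0 ?mulf_neq0.
Qed.

Lemma tors_img_sq (e1 e2 e3 m : int) (T : triple) :
  T \in tors_img e1 e2 e3 m -> is_sq (t1 T * t2 T * t3 T).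
Proof.
rewrite !inE => /or4P[] /eqP ->; rewrite /t1 /t2 /t3 /=.
- by exists 1.
- by exists (e1 * e3 * m); ring.
- by exists (e2 * e3 * m); ring.
- by exists (e1 * e2 * m); ring.
Qed.

Lemma tors_imgM (e1 e2 e3 m : int) (T T' : triple) :
  T \in tors_img e1 e2 e3 m -> T' \in tors_img e1 e2 e3 m ->
  exists2 T'', T'' \in tors_img e1 e2 e3 m & prod_cls T T' T''.
Proof.
have [->|TT'] := eqVneq T' T.
  move=> _ _; exists (1, 1, 1); first by rewrite !inE eqxx.
  by split; rewrite mulr1; [exists (t1 T)|exists (t2 T)|exists (t3 T)].
have [->|T1] := eqVneq T (1, 1, 1).
  move=> _ T'in; exists T' => //; rewrite /prod_cls !mul1r.
  by split; [exists (t1 T')|exists (t2 T')|exists (t3 T')].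
have [->|T'1] := eqVneq T' (1, 1, 1).
  move=> Tin _; exists T => //; rewrite /prod_cls !mulr1.
  by split; [exists (t1 T)|exists (t2 T)|exists (t3 T)].
pose T2 : triple := (- (e3 * m), - (e1 * e3), e1 * m).
pose T3 : triple := (- (e2 * e3), e3 * m, - (e2 * m)).
pose T4 : triple := (e2 * m, - (e1 * m), - (e1 * e2)).
rewrite !inE (negbTE T1) (negbTE T'1) -/T2 -/T3 -/T4 /= => A B.
(* The product of two distinct nontrivial points is the third, so every case leads to the product of
   all three, which is a square in each entry. *)
suff [T'' T''in HT] : exists2 T'', T'' \in [:: T2; T3; T4] &
    [/\ t1 T * t1 T' * t1 T'' = t1 T2 * t1 T3 * t1 T4,
        t2 T * t2 T' * t2 T'' = t2 T2 * t2 T3 * t2 T4 &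
        t3 T * t3 T' * t3 T'' = t3 T2 * t3 T3 * t3 T4].
  exists T''; first by rewrite /tors_img -/T2 -/T3 -/T4 inE T''in orbT.
  case: HT; rewrite /prod_cls => -> -> ->; rewrite /t1 /t2 /t3 /=.
  by split; [exists (e2 * e3 * m)|exists (e1 * e3 * m)|exists (e1 * e2 * m)]; ring.
move: TT'; case/or3P: A => /eqP ->; case/or3P: B => /eqP ->; rewrite ?eqxx // => _;
  [exists T4|exists T3|exists T4|exists T2|exists T3|exists T2]; rewrite ?inE ?eqxx ?orbT //;
  by rewrite /T2 /T3 /T4 /t1 /t2 /t3 /=; split; ring.
Qed.

Lemma is_sq_chain (a b c t t' t'' : int) : b != 0 -> t != 0 -> t' != 0 ->
  is_sq (a * b * t) -> is_sq (b * c * t') -> is_sq (t * t' * t'') -> is_sq (a * c * t'').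
Proof.
move=> b0 t0 t'0 H1 H2 H3; apply: (@is_sq_divl ((b * t * t') * (b * t * t'))).
- by rewrite !mulf_neq0.
- by exists (b * t * t').
have := is_sq_mul (is_sq_mul H1 H2) H3; congr (is_sq _); ring.
Qed.

Lemma same_cls_trans (e1 e2 e3 m : int) (L L' L'' : triple) :
  e1 != 0 -> e2 != 0 -> e3 != 0 -> m != 0 -> t1 L' != 0 -> t2 L' != 0 -> t3 L' != 0 ->
  same_cls' e1 e2 e3 m L L' -> same_cls' e1 e2 e3 m L' L'' -> same_cls' e1 e2 e3 m L L''.
Proof.
move=> n1 n2 n3 nm l1 l2 l3 [T Tin [A1 A2 A3]] [T' T'in [B1 B2 B3]].
have [T'' T''in [C1 C2 C3]] := tors_imgM Tin T'in.
have [a1 a2 a3] := tors_img_neq0 n1 n2 n3 nm Tin.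
have [b1 b2 b3] := tors_img_neq0 n1 n2 n3 nm T'in.
by exists T'' => //; split; [apply: is_sq_chain A1 B1 C1|apply: is_sq_chain A2 B2 C2|apply: is_sq_chain A3 B3 C3].
Qed.

Lemma same_cls_sym (e1 e2 e3 m : int) (L L' : triple) :
  same_cls' e1 e2 e3 m L L' -> same_cls' e1 e2 e3 m L' L.
Proof.
move=> [T Tin [A1 A2 A3]]; exists T => //.
by split; rewrite ?[t1 L' * _]mulrC ?[t2 L' * _]mulrC ?[t3 L' * _]mulrC.
Qed.

(** Two of the points have the entry e3 m up to sign and fail by valuation at 2. For the third,
    coprimality would make e2 and -e1 squares, hence 1 modulo 8, and then 8 would divide e3. The
    case m = 1 separates the torsion classes of E; m = n gives uniqueness of representatives. *)
Lemma tors_img_nonsq (e1 e2 e3 m c1 c2 : int) (T : triple) : e1 + e2 + e3 = 0 ->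
  ~~ (2 %| e1)%Z -> ~~ (2 %| e2)%Z -> (2 %| e3)%Z -> ~~ (4 %| e3)%Z ->
  0 < m -> ~~ (2 %| m)%Z -> coprimez m e1 -> coprimez m e2 ->
  0 < c1 -> ~~ (2 %| c1)%Z -> coprimez c1 e2 -> 0 < c2 -> ~~ (2 %| c2)%Z -> coprimez c2 e1 ->
  T \in behead (tors_img e1 e2 e3 m) -> is_sq (c1 * t1 T) -> is_sq (c2 * t2 T) -> False.
Proof.
move=> Es o1 o2 e3_2 e3_4 m0 om cm1 cm2 c10 oc1 cc1 c20 oc2 cc2.
have n1 : e1 != 0 by lia. have n2 : e2 != 0 by lia. have n3 : e3 != 0 by lia.
have nm : m != 0 by lia. have nc1 : c1 != 0 by lia. have nc2 : c2 != 0 by lia.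
have e3par : parv 2 e3 by apply: parv_exact.
have par0 x : ~~ (2 %| x)%Z -> parv 2 x = false by apply: parv_coprime.
have oddsq x : x != 0 -> is_sq x -> parv 2 x = false by move=> x0 /(is_sqP x0)[_]; apply.
have parN x : parv 2 (- x) = parv 2 x by rewrite /parv abszN.
rewrite !inE => /or3P[] /eqP ->; rewrite /t1 /t2 /= => S1 S2.
- have := oddsq _ (_ : c1 * - (e3 * m) != 0) S1; rewrite ?mulf_neq0 ?oppr_eq0 ?mulf_neq0 // => /(_ isT).
  by rewrite parvM ?oppr_eq0 ?mulf_neq0 // parN parvM // e3par (par0 c1) // (par0 m).
- have := oddsq _ (_ : c2 * (e3 * m) != 0) S2; rewrite ?mulf_neq0 ?oppr_eq0 ?mulf_neq0 // => /(_ isT).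
  by rewrite parvM ?oppr_eq0 ?mulf_neq0 // parvM // e3par (par0 c2) // (par0 m).
have Q2 : is_sq e2.
  apply: (@is_sq_coprimel (c1 * m)); rewrite ?mulr_gt0 // ?coprimezMl ?cc1 //.
  by move: S1; congr (is_sq _); ring.
have Q1 : is_sq (- e1).
  apply: (@is_sq_coprimel (c2 * m)); rewrite ?mulr_gt0 ?oppr_eq0 // ?coprimezN ?coprimezMl ?cc2 //.
  by move: S2; congr (is_sq _); ring.
have := is_sq_mod8 Q2 o2; have := is_sq_mod8 Q1; rewrite dvdzE abszN -dvdzE => /(_ o1).
by move: Es e3_4; clear; lia.
Qed.

Lemma Sel2_translate (e1 e2 e3 m : int) (L L' T : triple) :
  e1 != 0 -> e2 != 0 -> e3 != 0 -> m != 0 -> e1 + e2 + e3 = 0 -> Sel2 e1 e2 e3 m L ->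
  sqfree (t1 L') -> sqfree (t2 L') -> sqfree (t3 L') ->
  T \in tors_img e1 e2 e3 m -> prod_cls L L' T -> Sel2 e1 e2 e3 m L'.
Proof.
move=> n1 n2 n3 nm Es [s1 s2 s3 sq [HR Hp]] s1' s2' s3' Tin HT.
have [[l1 _] [l2 _] [l3 _]] := And3 s1 s2 s3.
have [[l1' _] [l2' _] [l3' _]] := And3 s1' s2' s3'.
have [a1 a2 a3] := tors_img_neq0 n1 n2 n3 nm Tin.
split=> //.
  have [A1 A2 A3] := HT.
  apply: is_sq_divl (is_sq_mul sq (tors_img_sq Tin)) _; first by rewrite !mulf_neq0.
  by have := is_sq_mul (is_sq_mul A1 A2) A3; congr (is_sq _); ring.
split; first exact: D_real_tors HT HR.
by move=> p pp; apply: D_padic_tors HT (Hp p pp).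
Qed.

Lemma sqfree1 : sqfree 1.
Proof. by split=> // p pp; rewrite dvdn1; have := prime_gt1 pp; nia. Qed.

Lemma D_field_one (K : realFieldType) (e1 e2 e3 m : int) : D_field_pt K e1 e2 e3 m (1, 1, 1).
Proof.
apply/D_fieldE; exists 0, 1, 1, 1; split; last by split; ring.
by apply/or4P; constructor 2; exact: oner_neq0.
Qed.

Lemma Sel2_one (e1 e2 e3 m : int) : Sel2 e1 e2 e3 m (1, 1, 1).
Proof.
split; rewrite /t1 /t2 /t3 /=; try exact: sqfree1; first by exists 1.
split; first exact: D_field_one.
move=> p pp; apply/D_padicE => k; exists 0, 1, 1, 1; split.
  by rewrite /primitive4 dvdz1 absz_nat gtn_eqF ?prime_gt1 //= andbF.
by split; apply/dvdzP; exists 0; ring.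
Qed.

Lemma Sel2_tors_img (e1 e2 e3 m : int) (T : triple) :
  e1 != 0 -> e2 != 0 -> e3 != 0 -> m != 0 -> e1 + e2 + e3 = 0 -> T \in tors_img e1 e2 e3 m ->
  exists2 L, Sel2 e1 e2 e3 m L & prod_cls (1, 1, 1) L T.
Proof.
move=> n1 n2 n3 nm Es Tin; have [a1 a2 a3] := tors_img_neq0 n1 n2 n3 nm Tin.
have [d1 s1 q1] := sqfree_rep a1; have [d2 s2 q2] := sqfree_rep a2; have [d3 s3 q3] := sqfree_rep a3.
have P : prod_cls (1, 1, 1) (d1, d2, d3) T by rewrite /prod_cls [t1 (1, _, _)]/(1 : int) [t2 (_, 1, _)]/(1 : int) [t3 (_, _, 1)]/(1 : int) !mul1r.
by exists (d1, d2, d3) => //; apply: Sel2_translate (Sel2_one _ _ _ _) _ _ _ Tin P.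
Qed.

(** Pigeonhole: the square-free representatives of the torsion classes are four distinct Selmer
    elements, so their images fill ['rV['F_2]_2] and injectivity leaves room for no other
    element. *)
Lemma Sel2_eq_tors (e1 e2 e3 : int) (f : triple -> 'rV['F_2]_2) (L : triple) : e1 + e2 + e3 = 0 ->
  ~~ (2 %| e1)%Z -> ~~ (2 %| e2)%Z -> (2 %| e3)%Z -> ~~ (4 %| e3)%Z ->
  (forall L L', Sel2 e1 e2 e3 1 L -> Sel2 e1 e2 e3 1 L' -> f L = f L' -> L = L') ->
  Sel2 e1 e2 e3 1 L -> exists2 T, T \in tors_img e1 e2 e3 1 & prod_cls (1, 1, 1) L T.
Proof.
move=> Es o1 o2 e3_2 e3_4 finj SL.
have n1 : e1 != 0 by lia. have n2 : e2 != 0 by lia. have n3 : e3 != 0 by lia.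
have rep T : T \in tors_img e1 e2 e3 1 -> exists2 M, Sel2 e1 e2 e3 1 M & prod_cls (1, 1, 1) M T.
  by apply: Sel2_tors_img.
pose T1 : triple := (1, 1, 1).
pose T2 : triple := (- (e3 * 1), - (e1 * e3), e1 * 1).
pose T3 : triple := (- (e2 * e3), e3 * 1, - (e2 * 1)).
pose T4 : triple := (e2 * 1, - (e1 * 1), - (e1 * e2)).
have ET : tors_img e1 e2 e3 1 = [:: T1; T2; T3; T4] by [].
have [|M1 S1 P1] := rep T1; first by rewrite ET !inE eqxx.
have [|M2 S2 P2] := rep T2; first by rewrite ET !inE eqxx ?orbT.
have [|M3 S3 P3] := rep T3; first by rewrite ET !inE eqxx ?orbT.
have [|M4 S4 P4] := rep T4; first by rewrite ET !inE eqxx ?orbT.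
have nonsq T : T \in [:: T2; T3; T4] -> is_sq (1 * t1 T) -> is_sq (1 * t2 T) -> False.
  by move=> Tin; apply: (tors_img_nonsq (m := 1) Es o1 o2 e3_2 e3_4) => //; rewrite /coprimez gcd1z.
have quot M T T' : Sel2 e1 e2 e3 1 M -> prod_cls (1, 1, 1) M T -> prod_cls (1, 1, 1) M T' ->
    is_sq (t1 T * t1 T') /\ is_sq (t2 T * t2 T').
  move=> [[m1 _] [m2 _] _ _ _] [A1 A2 _] [B1 B2 _]; move: A1 A2 B1 B2; rewrite !mul1r => A1 A2 B1 B2.
  split.
    apply: (@is_sq_divl (t1 M * t1 M)); [by rewrite mulf_neq0|by exists (t1 M)|].
    by have := is_sq_mul A1 B1; congr (is_sq _); ring.
  apply: (@is_sq_divl (t2 M * t2 M)); [by rewrite mulf_neq0|by exists (t2 M)|].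
  by have := is_sq_mul A2 B2; congr (is_sq _); ring.
(* [T''] represents the quotient of [T] and [T']; if [M] and [M'] coincided, its first two entries
   would be squares. *)
have D M M' T T' T'' : Sel2 e1 e2 e3 1 M -> Sel2 e1 e2 e3 1 M' -> prod_cls T1 M T -> prod_cls T1 M' T' ->
   T'' \in [:: T2; T3; T4] -> T \in tors_img e1 e2 e3 1 -> T' \in tors_img e1 e2 e3 1 ->
   is_sq (t1 T * t1 T' * t1 T'') -> is_sq (t2 T * t2 T' * t2 T'') -> f M != f M'.
  move=> SM SM' PM PM' T''in Tin T'in Q1 Q2; apply/eqP => /(finj _ _ SM SM') EM.
  rewrite -EM in PM'; have [R1 R2] := quot _ _ _ SM PM PM'.
  have [a1 a2 _] := tors_img_neq0 n1 n2 n3 (oner_neq0 int) Tin; have [b1 b2 _] := tors_img_neq0 n1 n2 n3 (oner_neq0 int) T'in.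
  by apply: (nonsq _ T''in); rewrite mul1r; [apply: is_sq_divl R1 Q1|apply: is_sq_divl R2 Q2]; rewrite mulf_neq0.
have U : uniq [:: f M1; f M2; f M3; f M4].
  rewrite /= !inE !negb_or /= !andbT; apply/and3P; split; [apply/and3P; split|apply/andP; split|].
  - apply: (D _ _ _ _ T2 S1 S2 P1 P2); rewrite ?ET ?inE ?eqxx ?orbT //; rewrite mul1r.
    + by exists (t1 T2).
    + by exists (t2 T2).
  - apply: (D _ _ _ _ T3 S1 S3 P1 P3); rewrite ?ET ?inE ?eqxx ?orbT //; rewrite mul1r.
    + by exists (t1 T3).
    + by exists (t2 T3).
  - apply: (D _ _ _ _ T4 S1 S4 P1 P4); rewrite ?ET ?inE ?eqxx ?orbT //; rewrite mul1r.
    + by exists (t1 T4).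
    + by exists (t2 T4).
  - apply: (D _ _ _ _ T4 S2 S3 P2 P3); rewrite ?ET ?inE ?eqxx ?orbT //; rewrite /t1 /t2 /=.
    + by exists (e2 * e3); ring.
    + by exists (e1 * e3); ring.
  - apply: (D _ _ _ _ T3 S2 S4 P2 P4); rewrite ?ET ?inE ?eqxx ?orbT //; rewrite /t1 /t2 /=.
    + by exists (e2 * e3); ring.
    + by exists (e1 * e3); ring.
  - apply: (D _ _ _ _ T2 S3 S4 P3 P4); rewrite ?ET ?inE ?eqxx ?orbT //; rewrite /t1 /t2 /=.
    + by exists (e2 * e3); ring.
    + by exists (e1 * e3); ring.
have full : f L \in [:: f M1; f M2; f M3; f M4].
  have C : #|[:: f M1; f M2; f M3; f M4]| = #|{: 'rV['F_2]_2}|.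
    by rewrite (card_uniqP U) card_mx card_Fp.
  by have /subset_cardP - /(_ (subset_predT _)) -> := C.
rewrite !inE in full; case/or4P: full => /eqP /finj -> //.
- by exists T1; rewrite // ET !inE eqxx.
- by exists T2; rewrite // ET !inE eqxx ?orbT.
- by exists T3; rewrite // ET !inE eqxx ?orbT.
- by exists T4; rewrite // ET !inE eqxx ?orbT.
Qed.

(** * Representatives by positive divisors *)

Lemma sqfree_dvd (x y : int) : (x %| y)%Z -> sqfree y -> sqfree x.
Proof.
move=> xy [y0 H]; split; first by apply: contraNneq y0 => x0; move: xy; rewrite x0 dvd0z.
by move=> p pp; apply: contra (H p pp) => px; apply: dvdn_trans px _; rewrite -dvdzE.
Qed.

Lemma coprimez_primes (x y : int) : x != 0 ->
  (forall p : nat, prime p -> (p%:Z %| x)%Z -> ~~ (p%:Z %| y)%Z) -> coprimez x y.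
Proof.
move=> x0 H; rewrite coprimezE; apply: contraT => ncop.
have g1 : (1 < gcdn `|x| `|y|)%N.
  by have : (0 < gcdn `|x| `|y|)%N; [rewrite gcdn_gt0 absz_gt0 x0|move: ncop; rewrite /coprime; lia].
have pg := pdiv_dvd (gcdn `|x| `|y|); rewrite dvdn_gcd in pg; case/andP: pg => px py.
by have := H _ (pdiv_prime g1); rewrite !dvdzE !absz_nat px py => /(_ isT).
Qed.

Lemma coprimez_ndvd (p : nat) (x y : int) : prime p -> coprimez x y ->
  (p%:Z %| x)%Z -> ~~ (p%:Z %| y)%Z.
Proof.
move=> pp cxy px; apply/negP => py; have : (p%:Z %| gcdz x y)%Z by rewrite dvdz_gcd px.
by move: cxy; rewrite /coprimez => /eqP ->; rewrite dvdz1 absz_nat gtn_eqF ?prime_gt1.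
Qed.

Lemma D_padic_untwist (p : nat) (e1 e2 e3 n a1 a2 a3 b1 b2 b3 : int) : prime p ->
  ~~ (p%:Z %| n)%Z -> ~~ (p%:Z %| a1)%Z -> ~~ (p%:Z %| a2)%Z -> ~~ (p%:Z %| a3)%Z ->
  padic_sq p n -> padic_sq p a1 -> padic_sq p a2 -> padic_sq p a3 ->
  D_padic_pt p e1 e2 e3 n (a1 * b1, a2 * b2, a3 * b3) -> D_padic_pt p e1 e2 e3 1 (b1, b2, b3).
Proof.
move=> pp pn p1 p2 p3 qn q1 q2 q3 /D_padicE HD; apply/D_padicE => k.
(* The extra exponent keeps the modulus divisible by [p] when k = 0, so that the approximate roots
   of n and of the a's are units. *)
have [t [u1 [u2 [u3 [nd [E1 E2 E3]]]]]] := HD k.+1.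
have [s Es] := qn k.+1; have [s1 F1] := q1 k.+1; have [s2 F2] := q2 k.+1; have [s3 F3] := q3 k.+1.
have unit (x y : int) : ~~ (p%:Z %| y)%Z -> ((p ^ k.+1)%N%:Z %| x ^+ 2 - y)%Z -> ~~ (p%:Z %| x)%Z.
  move=> py xy; apply: contra py => px.
  by apply: dvdz_comb2 px (dvdz_prime1 _ xy) (_ : _ = x * _ + (-1) * _) => //; ring.
exists (s * t), (s1 * u1), (s2 * u2), (s3 * u3); split.
  by apply: contra nd; rewrite !prime_dvdzM // (negbTE (unit _ _ pn Es)) (negbTE (unit _ _ p1 F1))
    (negbTE (unit _ _ p2 F2)) (negbTE (unit _ _ p3 F3)).
have small x : ((p ^ k.+1)%N%:Z %| x)%Z -> ((p ^ k)%N%:Z %| x)%Z by apply: dvdz_primeX.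
have comb (c t' r r' b b' u u' x x' : int) :
    ((p ^ k.+1)%N%:Z %| c * n * t' ^+ 2 + x * b * u ^+ 2 - x' * b' * u' ^+ 2)%Z ->
    ((p ^ k.+1)%N%:Z %| s ^+ 2 - n)%Z -> ((p ^ k.+1)%N%:Z %| r ^+ 2 - x)%Z ->
    ((p ^ k.+1)%N%:Z %| r' ^+ 2 - x')%Z ->
    ((p ^ k)%N%:Z %| c * 1 * (s * t') ^+ 2 + b * (r * u) ^+ 2 - b' * (r' * u') ^+ 2)%Z.
  move=> A B C D; apply: small.
  have X := dvdz_comb2 (a := c * t' ^+ 2) (b := b * u ^+ 2) B C erefl.
  have Y := dvdz_comb2 (a := 1) (b := - (b' * u' ^+ 2)) A D erefl.
  by apply: dvdz_comb2 X Y (_ : _ = 1 * _ + 1 * _); ring.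
by split; [exact: comb E1 Es F2 F3|exact: comb E2 Es F3 F1|exact: comb E3 Es F1 F2].
Qed.

Lemma D_field_untwist (K : realFieldType) (e1 e2 e3 n a1 a2 a3 b1 b2 b3 : int) :
  (forall x : K, 0 < x -> exists y, x = y ^+ 2) -> 0 < n -> 0 < a1 -> 0 < a2 -> 0 < a3 ->
  D_field_pt K e1 e2 e3 n (a1 * b1, a2 * b2, a3 * b3) -> D_field_pt K e1 e2 e3 1 (b1, b2, b3).
Proof.
move=> sqrtP pn p1 p2 p3 /D_fieldE [t [u1 [u2 [u3 [nz [E1 E2 E3]]]]]]; apply/D_fieldE.
have root (x : int) : 0 < x -> exists2 y : K, x%:~R = y ^+ 2 & y != 0.
  move=> x0; have [|y Ey] := sqrtP x%:~R; first by rewrite ltr0z.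
  exists y => //; apply: contraTneq x0 => y0; rewrite -(ltr0z K) Ey y0 expr0n ltxx //.
have [s Es s0] := root _ pn; have [s1 F1 s10] := root _ p1.
have [s2 F2 s20] := root _ p2; have [s3 F3 s30] := root _ p3.
exists (s * t), (s1 * u1), (s2 * u2), (s3 * u3); split.
  by rewrite !mulf_eq0 (negbTE s0) (negbTE s10) (negbTE s20) (negbTE s30).
rewrite !rmorphM /= Es F1 F2 F3 in E1 E2 E3.
by split; [rewrite -E1|rewrite -E2|rewrite -E3]; ring.
Qed.

Lemma Rreal_sqrt (x : Rreal) : 0 < x -> exists y, x = y ^+ 2.
Proof. by move=> x0; exists (Num.sqrt (x : Rdefinitions.R)); rewrite sqr_sqrtr // ltW. Qed.

Lemma sq_prod_parity (d1 d2 d3 : int) (p : nat) : prime p -> sqfree d1 -> sqfree d2 -> sqfree d3 ->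
  is_sq (d1 * d2 * d3) -> (p%:Z %| d1)%Z (+) (p%:Z %| d2)%Z (+) (p%:Z %| d3)%Z = false.
Proof.
move=> pp s1 s2 s3 sq; have [[d10 _] [d20 _] [d30 _]] := And3 s1 s2 s3.
have [_ /(_ p pp)] := (is_sqP (mulf_neq0 (mulf_neq0 d10 d20) d30)).1 sq.
by rewrite !parvM ?mulf_neq0 // !parv_sqfree.
Qed.

Lemma prod_primes_dvd (s : seq nat) (q : nat) : all prime s -> prime q ->
  (q %| \prod_(p <- s) p)%N -> q \in s.
Proof.
elim: s => [_ pq|p s IH /= /andP[pp ss] pq]; first by rewrite big_nil dvdn1 gtn_eqF ?prime_gt1.
by rewrite big_cons Euclid_dvdM // dvdn_prime2 // inE => /orP[->//|/(IH ss pq) ->]; rewrite orbT.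
Qed.

Lemma sqfree_prod_primes (s : seq nat) : uniq s -> all prime s -> sqfree (\prod_(p <- s) p)%N%:Z.
Proof.
move=> us ss; split.
  rewrite -absz_gt0 absz_nat; elim: s ss {us} => [_|p s IH /= /andP[pp ss]]; first by rewrite big_nil.
  by rewrite big_cons muln_gt0 prime_gt0 // IH.
move=> q pq; rewrite absz_nat; elim: s us ss => [_ _|p s IH /= /andP[ps us] /andP[pp ss]].
  by rewrite big_nil dvdn1 muln_eq1 gtn_eqF ?prime_gt1.
rewrite big_cons; have [->|qp] := eqVneq q p.
  by rewrite dvdn_pmul2l ?prime_gt0 //; apply: contra ps; apply: prod_primes_dvd.
rewrite Gauss_dvdr; first exact: IH.
by rewrite coprimeMl andbb prime_coprime // dvdn_prime2.
Qed.

Lemma quadres_dvd_prod (s : seq nat) (q d : nat) : all prime s ->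
  (forall p, p \in s -> quadres q p%:Z) -> (d %| \prod_(p <- s) p)%N -> quadres q d%:Z.
Proof.
elim: s d => [|p s IH] d /=.
  by move=> _ _; rewrite big_nil dvdn1 => /eqP ->; exists 1; rewrite expr1n subrr.
move=> /andP[pp ss] H; have Hs r : r \in s -> quadres q r%:Z by move=> rs; apply: H; rewrite inE rs orbT.
rewrite big_cons; have [/dvdnP[c ->]|pd] := boolP (p %| d)%N.
  rewrite mulnC dvdn_pmul2l ?prime_gt0 // => cs; rewrite PoszM.
  by apply: quadresM; [apply: H; apply: mem_head|apply: IH].
by rewrite Gauss_dvdr; [apply: IH|rewrite coprime_sym prime_coprime].
Qed.

(** * Legendre and Hilbert symbols *)

Lemma leg_addP (u : int) (p : nat) : (0 < p)%N -> leg_add u p = 0 <-> quadres p u.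
Proof.
move=> p0; rewrite /leg_add; case: ifP => [/existsP[x Ex]|/negbT H]; split=> //.
  by move=> _; exists (x : nat)%:Z.
move=> [x Ex]; case/negP: H.
have xlt : (`|(x %% p%:Z)%Z| < p)%N.
  by have := ltz_mod x (isT : p.+1%:Z != 0); have := @modz_ge0 x p%:Z; have := @ltz_mod x p%:Z; lia.
apply/existsP; exists (Ordinal xlt) => /=.
have Er : `|(x %% p%:Z)%Z|%N%:Z = (x %% p%:Z)%Z by rewrite gez0_abs // modz_ge0; lia.
rewrite Er; have D : (p%:Z %| (x %% p%:Z)%Z - x)%Z.
  by apply/dvdzP; exists (- (x %/ p%:Z)%Z); rewrite {2}(divz_eq x p%:Z); ring.
by apply: dvdz_comb2 D Ex (_ : _ = ((x %% p%:Z)%Z + x) * _ + 1 * _); ring.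
Qed.

Lemma leg_add_non (u : int) (p : nat) : (0 < p)%N -> ~ quadres p u -> leg_add u p = 1.
Proof. by move=> p0 H; have := leg_addP u p0; rewrite /leg_add; case: ifP => // _ [/(_ erefl)]. Qed.

Lemma leg_addM (u v : int) (p : nat) : prime p -> odd p ->
  ~~ (p%:Z %| u)%Z -> ~~ (p%:Z %| v)%Z -> leg_add (u * v) p = leg_add u p + leg_add v p.
Proof.
move=> pp op pu pv; have p0 := prime_gt0 pp.
case: (classic (quadres p u)) => qu; case: (classic (quadres p v)) => qv.
- by rewrite !(leg_addP _ p0).2 ?addr0 //; apply: quadresM.
- rewrite ((leg_addP u p0).2 qu) add0r !leg_add_non // => quv.
  by apply: qv; apply: quadres_divl quv.
- rewrite ((leg_addP v p0).2 qv) addr0 !leg_add_non // => quv.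
  by apply: qu; apply: (quadres_divl pp pv qv); rewrite mulrC.
- rewrite (leg_add_non p0 qu) (leg_add_non p0 qv).
  by rewrite (leg_addP _ p0).2; [apply/val_inj|apply: quadresM_non].
Qed.

Lemma leg_add_prod (I : eqType) (s : seq I) (g k : I -> nat) (p : nat) : prime p -> odd p ->
  (forall i, i \in s -> ~~ (p %| g i)%N) ->
  \sum_(i <- s) leg_add (g i)%:Z p * (k i)%:R = leg_add (\prod_(i <- s) g i ^ k i)%N%:Z p /\
  ~~ (p %| \prod_(i <- s) g i ^ k i)%N.
Proof.
move=> pp op; have p0 := prime_gt0 pp.
have leg1 : leg_add 1 p = 0 by apply/leg_addP => //; exists 1; rewrite expr1n subrr.
have p1 : ~~ (p %| 1)%N by rewrite dvdn1 gtn_eqF ?prime_gt1.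
elim: s => [|i s IH] H; first by rewrite !big_nil leg1.
have [|Es ps] := IH; first by move=> j js; apply: H; rewrite inE js orbT.
have pg := H i (mem_head _ _); rewrite !big_cons Es.
have [Ek pk] : leg_add (g i)%:Z p * (k i)%:R = leg_add (g i ^ k i)%N%:Z p /\ ~~ (p %| g i ^ k i)%N.
  elim: (k i) => [|j [IHj pj]]; first by rewrite mulr0 expn0 leg1.
  rewrite expnS PoszM leg_addM ?dvdzE //.
  by rewrite -IHj mulrS mulrDr mulr1 Euclid_dvdM // negb_or pg.
by rewrite PoszM leg_addM ?dvdzE ?absz_nat // Ek Euclid_dvdM // negb_or pk.
Qed.

Lemma hilb_solv_unit (p : nat) (a b : int) : prime p -> odd p -> sqfree b -> (p%:Z %| b)%Z ->
  ~~ (p%:Z %| a)%Z -> hilb_solv p a b <-> quadres p a.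
Proof.
move=> pp op sb pb pa; split.
  move=> H; apply: (conic_loc_quadres pp sb pb); exists 1%N => k.
  by rewrite expn1; have [x [y [z [nd E]]]] := H k; exists x, y, z.
move=> /(hensel_odd pp op pa) H k; have [z Ez] := H k; exists 1, 0, z; split.
  by rewrite dvdz1 absz_nat gtn_eqF ?prime_gt1.
by apply: dvdz_scale Ez (_ : _ = 1 * _); ring.
Qed.

(** The diagonal symbols of A, with c = n / p. In a solution modulo p^2, [p] divides z, and dividing
    by [p] leaves x^2 = c y^2 modulo [p]; conversely there is a solution with z = 0. *)
Lemma hilb_solv_prime (p : nat) (c : int) : prime p -> odd p -> ~~ (p%:Z %| c)%Z ->
  hilb_solv p p%:Z (- (p%:Z * c)) <-> quadres p c.
Proof.
move=> pp op pc; split.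
  move=> /(_ 2%N) [x [y [z [nd E]]]].
  have pz : (p%:Z %| z)%Z.
    rewrite -prime_dvdzX2 //.
    by apply: dvdz_comb2 (dvdz_prime1 (isT : 0 < 2)%N E) (dvdzz p%:Z) (_ : _ = 1 * _ + (x ^+ 2 - c * y ^+ 2) * _); ring.
  have pN0 : p%:Z != 0 by have := prime_gt0 pp; lia.
  have F : (p%:Z %| x ^+ 2 - c * y ^+ 2)%Z.
    rewrite -(dvdz_mul2l pN0).
    have zz : (p%:Z * p%:Z %| z * z)%Z by apply: dvdz_mul.
    move: E; rewrite -mulnn PoszM => E.
    by apply: dvdz_comb2 E zz (_ : _ = (-1) * _ + 1 * _); ring.
  have py : ~~ (p%:Z %| y)%Z.
    apply: contra nd => py; rewrite py pz /= andbT -prime_dvdzX2 //.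
    by apply: dvdz_comb2 F py (_ : _ = 1 * _ + (c * y) * _); ring.
  by apply: (quadres_cancel pp py); exists x.
move=> /(hensel_odd pp op pc) H k; have [x Ex] := H k; exists x, 1, 0; split.
  by rewrite dvdz1 absz_nat gtn_eqF ?prime_gt1 //= andbF.
by apply: dvdz_scale Ex (_ : _ = (- p%:Z) * _); ring.
Qed.

Lemma hilb_add_eq_leg (p : nat) (a b u : int) : (0 < p)%N ->
  hilb_solv p a b <-> quadres p u -> hilb_add p a b = leg_add u p.
Proof.
move=> p0 H; rewrite /hilb_add; case: ClassicalEpsilon.excluded_middle_informative => h.
  by apply/esym/leg_addP => //; apply/H.
by rewrite leg_add_non // => /H.
Qed.

(** * The Selmer group of the twist *)

Section Twist.

Variables (e1 e2 e3 : int) (n : nat).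
Hypotheses (Es : e1 + e2 + e3 = 0) (o1 : ~~ (2 %| e1)%Z) (o2 : ~~ (2 %| e2)%Z)
  (e3_2 : (2 %| e3)%Z) (e3_4 : ~~ (4 %| e3)%Z).
Hypotheses (on : odd n) (sn : sqfree n%:Z) (cop : coprimez n%:Z (e1 * e2 * e3)).
Hypothesis nres : forall q d : nat, prime q -> odd q -> (q%:Z %| e1 * e2 * e3)%Z ->
  (d %| n)%N -> quadres q d%:Z.
Hypothesis Sel1 : forall L, Sel2 e1 e2 e3 1 L ->
  exists2 T, T \in tors_img e1 e2 e3 1 & prod_cls (1, 1, 1) L T.

Let n1 : e1 != 0. Proof. by move: o1; lia. Qed.
Let n2 : e2 != 0. Proof. by move: o2; lia. Qed.
Let n3 : e3 != 0. Proof. by move: e3_4; lia. Qed.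
Let n0 : (0 < n)%N. Proof. exact: odd_gt0. Qed.
Let nz : n%:Z != 0. Proof. by move: n0; lia. Qed.
Let npos : 0 < n%:Z. Proof. by move: n0; lia. Qed.
Let n2' : ~~ (2 %| n%:Z)%Z. Proof. by move: on; lia. Qed.

Let cop1 : coprimez n%:Z e1. Proof. by move: cop; rewrite !coprimezMr => /andP[/andP[]]. Qed.
Let cop2 : coprimez n%:Z e2. Proof. by move: cop; rewrite !coprimezMr => /andP[/andP[]]. Qed.
Let cop3 : coprimez n%:Z e3. Proof. by move: cop; rewrite !coprimezMr => /andP[/andP[]]. Qed.

(** As d1 d2 d3 is a square, [p] divides none or exactly two of the square-free entries, and
    [D_padic_unramified], rotated, excludes each pair. *)
Lemma Sel2_unramified (d1 d2 d3 : int) (p : nat) : Sel2 e1 e2 e3 n%:Z (d1, d2, d3) -> prime p ->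
  ~~ (p%:Z %| n%:Z)%Z -> ~~ (p%:Z %| e1 * e2 * e3)%Z ->
  [/\ ~~ (p%:Z %| d1)%Z, ~~ (p%:Z %| d2)%Z & ~~ (p%:Z %| d3)%Z].
Proof.
rewrite /Sel2 /t1 /t2 /t3 /= => -[s1 s2 s3 sq [_ Hp]] pp pn.
rewrite !prime_dvdzM // !negb_or => /andP[/andP[pe1 pe2] pe3].
have D1 := Hp p pp; have D2 := D_padic_cycle D1; have D3 := D_padic_cycle D2.
have := sq_prod_parity pp s1 s2 s3 sq.
have C1 q := D_padic_unramified pp pe1 pn q s2 s3 D1.
have C2 q := D_padic_unramified pp pe2 pn q s3 s1 D2.
have C3 q := D_padic_unramified pp pe3 pn q s1 s2 D3.
move: C1 C2 C3; case: (p%:Z %| d1)%Z; case: (p%:Z %| d2)%Z; case: (p%:Z %| d3)%Z => //.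
- by move=> _ _ H; case: (H isT).
- by move=> _ H; case: (H isT).
- by move=> H; case: (H isT).
Qed.

(** The same argument at 2; as e3 is even, the pair d1, d2 is not excluded. *)
Lemma Sel2_parity (d1 d2 d3 : int) : Sel2 e1 e2 e3 n%:Z (d1, d2, d3) ->
  ~~ (2 %| d3)%Z /\ (2 %| d1)%Z = (2 %| d2)%Z.
Proof.
rewrite /Sel2 /t1 /t2 /t3 /= => -[s1 s2 s3 sq [_ Hp]].
have pp : prime 2 by []; have D1 := Hp 2 pp; have D2 := D_padic_cycle D1.
have := sq_prod_parity pp s1 s2 s3 sq.
have C1 q := D_padic_unramified pp o1 n2' q s2 s3 D1.
have C2 q := D_padic_unramified pp o2 n2' q s3 s1 D2.
move: C1 C2; rewrite -[Posz 2]/(2 : int); case: (2 %| d1)%Z; case: (2 %| d2)%Z; case: (2 %| d3)%Z => //.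
- by move=> _ H; case: (H isT).
- by move=> H; case: (H isT).
Qed.

(** If d1 and d2 are even, the torsion point (- e3 n, - e1 e3, e1 n), whose first two entries have
    odd valuation at 2, makes them odd. *)
Lemma Sel2_odd_rep (L : triple) : Sel2 e1 e2 e3 n%:Z L ->
  exists d1 d2 d3, [/\ Sel2 e1 e2 e3 n%:Z (d1, d2, d3), same_cls' e1 e2 e3 n%:Z L (d1, d2, d3) &
    [/\ ~~ (2 %| d1)%Z, ~~ (2 %| d2)%Z & ~~ (2 %| d3)%Z]].
Proof.
case: L => [[c1 c2] c3] SL; have [oc3 E] := Sel2_parity SL.
have [[c10 _] [c20 _] [c30 _] _ _] := SL; rewrite /t1 /t2 /t3 /= in c10 c20 c30.
have [ev|od] := boolP (2 %| c1)%Z; last first.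
  exists c1, c2, c3; split=> //; last by rewrite -E.
  exists (1, 1, 1); first by rewrite inE eqxx.
  by rewrite /prod_cls /t1 /t2 /t3 /= !mulr1; split; [exists c1|exists c2|exists c3].
pose T : triple := (- (e3 * n%:Z), - (e1 * e3), e1 * n%:Z).
have Tin : T \in tors_img e1 e2 e3 n%:Z by rewrite !inE eqxx orbT.
have [a1 a2 a3] := tors_img_neq0 n1 n2 n3 nz Tin.
have [d1 s1 q1] := sqfree_rep (mulf_neq0 c10 a1).
have [d2 s2 q2] := sqfree_rep (mulf_neq0 c20 a2).
have [d3 s3 q3] := sqfree_rep (mulf_neq0 c30 a3).
have P : prod_cls (c1, c2, c3) (d1, d2, d3) T.
  split; [move: q1|move: q2|move: q3]; congr (is_sq _); rewrite /t1 /t2 /t3 /=; ring.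
have SL' := @Sel2_translate _ _ _ _ _ (d1, d2, d3) _ n1 n2 n3 nz Es SL s1 s2 s3 Tin P.
exists d1, d2, d3; split=> //; first by exists T.
have [od3 E'] := Sel2_parity SL'; rewrite -E' od3; suff : ~~ (2 %| d1)%Z by [].
have [d10 _] := s1; have [sc1 _ _ _ _] := SL.
have [_ /(_ 2 isT)] := (is_sqP (mulf_neq0 d10 (mulf_neq0 c10 a1))).1 q1.
rewrite parvM ?mulf_neq0 // parvM // (parv_sqfree _ s1) // (parv_sqfree _ sc1) // ev.
rewrite /T /t1 /= (_ : parv 2 (- (e3 * n%:Z)) = true); first by rewrite addbF => ->.
rewrite /parv abszN -/(parv 2 (e3 * n%:Z)) parvM // (parv_coprime n2') (parv_exact (p := 2)) //.
Qed.

Lemma sqfree_split (d : int) : sqfree d ->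
  exists a b : int, [/\ d = a * b, 0 < a, (a %| n%:Z)%Z & coprimez n%:Z b].
Proof.
move=> sd; pose a := gcdz d n%:Z; have /dvdzP[b Eb] : (a %| d)%Z by apply: dvdz_gcdl.
have a0 : a != 0 by rewrite gcdz_eq0 negb_and nz orbT.
exists a, b; split; [by rewrite Eb mulrC|by rewrite lt0r a0|exact: dvdz_gcdr|].
apply: coprimez_primes => // p pp pn; apply/negP => pb.
have /negP[] := sqfree_dvd2 pp sd; rewrite Eb -mulnn PoszM dvdz_mul //.
by rewrite dvdz_gcd pn andbT Eb dvdz_mulr.
Qed.

Let dvd_n_ndvd (a : int) (p : nat) : (a %| n%:Z)%Z -> prime p -> ~~ (p%:Z %| n%:Z)%Z -> ~~ (p%:Z %| a)%Z.
Proof. by move=> an pp; apply: contra => pa; apply: dvdz_trans an. Qed.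

Let ndvd_e_n (q : nat) : prime q -> (q%:Z %| e1 * e2 * e3)%Z -> ~~ (q%:Z %| n%:Z)%Z.
Proof. by move=> pq; apply: coprimez_ndvd; rewrite // coprimez_sym. Qed.

Let dvd_n_quadres (a : int) (q : nat) : 0 < a -> (a %| n%:Z)%Z -> prime q -> odd q ->
  (q%:Z %| e1 * e2 * e3)%Z -> padic_sq q a.
Proof.
move=> a0 an pq oq qe; apply: hensel_odd => //.
  exact: dvd_n_ndvd an pq (ndvd_e_n pq qe).
have -> : a = `|a|%N%:Z by rewrite gez0_abs // ltW.
by apply: nres => //; move: an; rewrite dvdzE.
Qed.

(** The primes dividing n are of good reduction for E, and the b's are units there by coprimality;
    at the remaining odd primes of good reduction they are units by [Sel2_unramified]. The place 2
    comes last, since [D_padic_two] uses all the others. *)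
Lemma Sel2_untwist (a1 a2 a3 b1 b2 b3 : int) :
  Sel2 e1 e2 e3 n%:Z (a1 * b1, a2 * b2, a3 * b3) ->
  0 < a1 -> 0 < a2 -> 0 < a3 -> (a1 %| n%:Z)%Z -> (a2 %| n%:Z)%Z -> (a3 %| n%:Z)%Z ->
  coprimez n%:Z b1 -> coprimez n%:Z b2 -> coprimez n%:Z b3 ->
  ~~ (2 %| b1)%Z -> ~~ (2 %| b2)%Z -> ~~ (2 %| b3)%Z -> Sel2 e1 e2 e3 1 (b1, b2, b3).
Proof.
move=> SL a10 a20 a30 an1 an2 an3 cb1 cb2 cb3 ob1 ob2 ob3.
have [s1 s2 s3 sq [HR Hp]] := SL; rewrite /t1 /t2 /t3 /= in s1 s2 s3 sq.
have [b10 b20 b30] : [/\ b1 != 0, b2 != 0 & b3 != 0] by split; lia.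
have sqb : is_sq (b1 * b2 * b3).
  apply: (@is_sq_coprimel (a1 * a2 * a3)); rewrite ?mulr_gt0 ?mulf_neq0 //; last first.
    by move: sq; congr (is_sq _); ring.
  have dv a b : (a %| n%:Z)%Z -> coprimez n%:Z b -> coprimez a b by rewrite dvdzE; apply: coprimez_dvdl.
  by rewrite !coprimezMl !coprimezMr; do ?[apply/andP; split]; apply: dv.
have HR1 : D_real_pt e1 e2 e3 1 (b1, b2, b3) by apply: D_field_untwist Rreal_sqrt _ _ _ _ HR.
have Hodd p : prime p -> odd p -> D_padic_pt p e1 e2 e3 1 (b1, b2, b3).
  move=> pp op; have [pe|pe] := boolP (p%:Z %| e1 * e2 * e3)%Z.
    have pn := ndvd_e_n pp pe.
    apply: D_padic_untwist (Hp p pp) => //; try exact: dvd_n_ndvd pn; try exact: dvd_n_quadres.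
  have [pb1 pb2 pb3] : [/\ ~~ (p%:Z %| b1)%Z, ~~ (p%:Z %| b2)%Z & ~~ (p%:Z %| b3)%Z].
    have [pn|pn] := boolP (p%:Z %| n%:Z)%Z; first by split; apply: coprimez_ndvd pn.
    by have [] := Sel2_unramified SL pp pn pe; rewrite !prime_dvdzM // !negb_or => /andP[_ ->] /andP[_ ->] /andP[_ ->].
  move: pe; rewrite !prime_dvdzM // !negb_or => /andP[/andP[pe1 pe2] pe3].
  by apply: D_padic_good => //; rewrite dvdz1 absz_nat gtn_eqF ?prime_gt1.
split; rewrite /t1 /t2 /t3 //=.
- by apply: sqfree_dvd s1; rewrite dvdz_mull.
- by apply: sqfree_dvd s2; rewrite dvdz_mull.
- by apply: sqfree_dvd s3; rewrite dvdz_mull.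
split=> // p pp; case: (even_prime pp) => [->|op]; last exact: Hodd.
by apply: D_padic_two.
Qed.

Lemma Sel2_rep_exists (L : triple) : Sel2 e1 e2 e3 n%:Z L ->
  exists L', [/\ Sel2 e1 e2 e3 n%:Z L', pos_div_rep n L' & same_cls' e1 e2 e3 n%:Z L L'].
Proof.
move=> /Sel2_odd_rep[d1 [d2 [d3 [SM LM [od1 od2 od3]]]]].
have [s1 s2 s3 _ _] := SM; rewrite /t1 /t2 /t3 /= in s1 s2 s3.
have [[d10 _] [d20 _] [d30 _]] := And3 s1 s2 s3.
suff [L' [SL' PL' ML']] : exists L', [/\ Sel2 e1 e2 e3 n%:Z L', pos_div_rep n L' &
    same_cls' e1 e2 e3 n%:Z (d1, d2, d3) L'].
  by exists L'; split=> //; apply: same_cls_trans LM ML'.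
have [a1 [b1 [E1 a10 an1 cb1]]] := sqfree_split s1.
have [a2 [b2 [E2 a20 an2 cb2]]] := sqfree_split s2.
have [a3 [b3 [E3 a30 an3 cb3]]] := sqfree_split s3.
have oddr (a b : int) : ~~ (2 %| a * b)%Z -> ~~ (2 %| b)%Z.
  by rewrite (prime_dvdzM _ _ (isT : prime 2)) negb_or => /andP[].
rewrite E1 E2 E3 in SM s1 s2 s3 d10 d20 d30 od1 od2 od3 *.
move: (oddr _ _ od1) (oddr _ _ od2) (oddr _ _ od3) => ob1 ob2 ob3.
have SB := Sel2_untwist SM a10 a20 a30 an1 an2 an3 cb1 cb2 cb3 ob1 ob2 ob3.
have [sb1 sb2 sb3 _ _] := SB; rewrite /t1 /t2 /t3 /= in sb1 sb2 sb3.
have [[b10 _] [b20 _] [b30 _]] := And3 sb1 sb2 sb3.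
(* The two torsion classes whose first entry contains e3 cannot occur: [b1] is odd and e3 has
   valuation 1 at 2. *)
have noT2 (x : int) : ~~ (2 %| x)%Z -> ~ is_sq (b1 * - (x * e3)).
  move=> ox H; have x0 : x != 0 by apply: contraNneq ox => ->.
  have y0 : - (x * e3) != 0 by rewrite oppr_eq0 mulf_neq0.
  have [_ /(_ 2%N isT)] := (is_sqP (mulf_neq0 b10 y0)).1 H.
  rewrite parvM ?oppr_eq0 ?mulf_neq0 // (parv_coprime (p := 2) ob1).
  rewrite /parv abszN -/(parv 2 (x * e3)) parvM // (parv_coprime (p := 2) ox).
  by rewrite (parv_exact (p := 2) isT e3_2).
have [T0 Tin [Q1 Q2 Q3]] := Sel1 SB; move: Tin Q1 Q2 Q3.
have I : ((1, 1, 1) : triple) \in tors_img e1 e2 e3 n%:Z by rewrite inE eqxx.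
rewrite !inE => /or4P[] /eqP ->; rewrite /t1 /t2 /t3 /= !mul1r => Q1 Q2 Q3.
- have one b : sqfree b -> is_sq (b * 1) -> b = 1 by move=> sb; apply: sqfree_same_class sb sqfree1.
  rewrite (one _ sb1 Q1) (one _ sb2 Q2) (one _ sb3 Q3) !mulr1 in SM *.
  exists (a1, a2, a3); split=> //.
  exists (1, 1, 1) => //; rewrite /prod_cls /t1 /t2 /t3 /= !mulr1.
  by split; [exists a1|exists a2|exists a3].
- by case: (noT2 1 _) => //; rewrite mul1r -(mulr1 e3).
- by case: (noT2 e2 _).
(* The b's now have the class (e2, -e1, -e1 e2). Translating by the corresponding point of the twist
   leaves a1 n, a2 n and a3 modulo squares, represented by n / a1, n / a2 and a3. *)
move: (an1) (an2) => /dvdzP[c1 F1] /dvdzP[c2 F2].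
pose T : triple := (e2 * n%:Z, - (e1 * n%:Z), - (e1 * e2)).
have Tin : T \in tors_img e1 e2 e3 n%:Z by rewrite !inE eqxx !orbT.
have P : prod_cls (a1 * b1, a2 * b2, a3 * b3) (c1, c2, a3) T.
  rewrite /prod_cls /t1 /t2 /t3 /=; split.
  - have := is_sq_mul Q1 (ex_intro _ n%:Z erefl : is_sq (n%:Z * n%:Z)).
    by congr (is_sq _); rewrite {1}F1; ring.
  - have := is_sq_mul Q2 (ex_intro _ n%:Z erefl : is_sq (n%:Z * n%:Z)).
    by congr (is_sq _); rewrite {1}F2; ring.
  - have := is_sq_mul Q3 (ex_intro _ a3 erefl : is_sq (a3 * a3)).
    by congr (is_sq _); ring.
have cn1 : (c1 %| n%:Z)%Z by rewrite F1 dvdz_mulr.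
have cn2 : (c2 %| n%:Z)%Z by rewrite F2 dvdz_mulr.
exists (c1, c2, a3); split; last by exists T.
- by apply: Sel2_translate SM _ _ _ Tin P => //; apply: sqfree_dvd sn.
split; rewrite /t1 /t2 /t3 //=.
- by move: npos; rewrite F1 pmulr_lgt0.
- by move: npos; rewrite F2 pmulr_lgt0.
Qed.

Lemma pos_div_rep_tors (c1 c2 : int) (T : triple) :
  0 < c1 -> 0 < c2 -> coprimez c1 (2 * (e1 * e2 * e3)) -> coprimez c2 (2 * (e1 * e2 * e3)) ->
  T \in tors_img e1 e2 e3 n%:Z -> is_sq (c1 * t1 T) -> is_sq (c2 * t2 T) -> T = (1, 1, 1).
Proof.
move=> c10 c20; rewrite !coprimezMr => /andP[oc1 /andP[/andP[c11 c12] _]] /andP[oc2 /andP[/andP[c21 c22] _]].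
have od c : coprimez c 2 -> ~~ (2 %| c)%Z.
  by rewrite coprimez_sym coprimezE (prime_coprime _ (isT : prime 2)) => H; rewrite dvdzE.
rewrite /tors_img in_cons => /predU1P[//|Tin] Q1 Q2.
by have := tors_img_nonsq Es o1 o2 e3_2 e3_4 npos n2' cop1 cop2 c10 (od _ oc1) c12 c20 (od _ oc2) c21 Tin Q1 Q2.
Qed.

Lemma dvd_n_coprime (d : int) : (`|d| %| n)%N -> coprimez d (2 * (e1 * e2 * e3)).
Proof.
move=> dn; have : coprimez n%:Z (2 * (e1 * e2 * e3)).
  by rewrite coprimezMr cop andbT coprimez_sym coprimezE (prime_coprime _ (isT : prime 2)); exact: n2'.
by apply: coprimez_dvdl.
Qed.

Lemma pos_div_rep_uniq (L L' : triple) :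
  Sel2 e1 e2 e3 n%:Z L -> pos_div_rep n L -> Sel2 e1 e2 e3 n%:Z L' -> pos_div_rep n L' ->
  same_cls' e1 e2 e3 n%:Z L L' -> L = L'.
Proof.
case: L L' => [[d1 d2] d3] [[d1' d2'] d3'] [s1 s2 s3 _ _] [p1 p2 p3 [v1 v2 v3]].
move=> [s1' s2' s3' _ _] [p1' p2' p3' [v1' v2' v3']] [T Tin [Q1 Q2 Q3]].
have cM x y : (`|x| %| n)%N -> (`|y| %| n)%N -> coprimez (x * y) (2 * (e1 * e2 * e3)).
  by move=> xn yn; rewrite coprimezMl !dvd_n_coprime.
have ET := pos_div_rep_tors (mulr_gt0 p1 p1') (mulr_gt0 p2 p2') (cM _ _ v1 v1') (cM _ _ v2 v2') Tin Q1 Q2.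
move: Q1 Q2 Q3; rewrite ET [t1 (1, _, _)]/(1 : int) [t2 (_, 1, _)]/(1 : int) [t3 (_, _, 1)]/(1 : int) !mulr1.
move=> /(sqfree_same_class s1 s1') + /(sqfree_same_class s2 s2') + /(sqfree_same_class s3 s3').
by rewrite /t1 /t2 /t3 /= => -> -> ->.
Qed.

(** (c1, c2, c1 c2) is a unit representative of the translate by [T]. On unit triples
    [D_padic_multiplicative] and [D_padic_quadres] are converse to each other, and the condition on
    the third entry follows from the other two. *)
Lemma D_padic_translated (p : nat) (d1 d2 d3 c1 c2 : int) (T : triple) :
  prime p -> odd p -> (p%:Z %| n%:Z)%Z -> T \in tors_img e1 e2 e3 n%:Z ->
  d1 != 0 -> d2 != 0 -> d3 != 0 -> is_sq (d1 * d2 * d3) ->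
  ~~ (p%:Z %| c1)%Z -> ~~ (p%:Z %| c2)%Z -> is_sq (d1 * c1 * t1 T) -> is_sq (d2 * c2 * t2 T) ->
  D_padic_pt p e1 e2 e3 n%:Z (d1, d2, d3) <-> quadres p c1 /\ quadres p c2.
Proof.
move=> pp op pn Tin d10 d20 d30 sq pc1 pc2 Q1 Q2.
have [a1 a2 a3] := tors_img_neq0 n1 n2 n3 nz Tin.
have Q3 : is_sq (d3 * (c1 * c2) * t3 T).
  apply: (@is_sq_divl ((d1 * d2 * (t1 T * t2 T)) * (d1 * d2 * (t1 T * t2 T)))).
  - by rewrite !mulf_neq0.
  - by exists (d1 * d2 * (t1 T * t2 T)).
  have := is_sq_mul (is_sq_mul Q1 Q2) (is_sq_mul sq (tors_img_sq Tin)).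
  by congr (is_sq _); ring.
have nzd c : ~~ (p%:Z %| c)%Z -> c != 0 by apply: contraNneq => ->; rewrite dvdz0.
have pc3 : ~~ (p%:Z %| c1 * c2)%Z by rewrite prime_dvdzM // negb_or pc1.
have sqc : is_sq (c1 * c2 * (c1 * c2)) by exists (c1 * c2).
have pe1 : ~~ (p%:Z %| e1)%Z := coprimez_ndvd pp cop1 pn.
have A : D_padic_pt p e1 e2 e3 n%:Z (d1, d2, d3) <-> D_padic_pt p e1 e2 e3 n%:Z (c1, c2, c1 * c2).
  split.
    by apply: (D_padic_tors (T := T)) => //; apply: nzd.
  apply: (D_padic_tors (T := T)) => //; try exact: nzd.
  by split; [move: Q1|move: Q2|move: Q3]; rewrite /t1 /t2 /t3 /=; congr (is_sq _); ring.
apply: (iff_trans A); split.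
  by move=> /(D_padic_multiplicative pp pe1 pn (sqfree_dvd2 pp sn) pc1 pc2 pc3 sqc)[].
by move=> [q1 q2]; apply: D_padic_quadres => //; apply: quadresM.
Qed.

(** Over the reals and at odd primes dividing e1 e2 e3 the entries are squares, which gives a point
    with t = 0; the other odd primes prime to n are of good reduction. *)
Lemma Sel2_of_local (d1 d2 d3 : nat) : (d1 %| n)%N -> (d2 %| n)%N -> (d3 %| n)%N ->
  is_sq (d1%:Z * d2%:Z * d3%:Z) ->
  (forall p : nat, prime p -> (p %| n)%N -> D_padic_pt p e1 e2 e3 n%:Z (d1%:Z, d2%:Z, d3%:Z)) ->
  Sel2 e1 e2 e3 n%:Z (d1%:Z, d2%:Z, d3%:Z).
Proof.
move=> dn1 dn2 dn3 sq Hp.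
have dpos d : (d %| n)%N -> 0 < d%:Z by move=> /dvdn_gt0 - /(_ n0).
have HR : D_real_pt e1 e2 e3 n%:Z (d1%:Z, d2%:Z, d3%:Z).
  apply/D_fieldE; have root (d : nat) : (d %| n)%N -> exists2 y : Rreal, d%:Z%:~R * y ^+ 2 = 1 & y != 0.
    move=> /dpos d0; have d0R : 0 < (d%:Z%:~R : Rreal) by rewrite ltr0z.
    have [y Ey] := Rreal_sqrt d0R; have y0 : y != 0.
      by apply: contraTneq d0R => y0; rewrite Ey y0 expr0n ltxx.
    exists y^-1; last by rewrite invr_eq0.
    by rewrite Ey exprVn mulfV // expf_neq0.
  have [y1 E1 y10] := root _ dn1; have [y2 E2 y20] := root _ dn2; have [y3 E3 y30] := root _ dn3.
  exists 0, y1, y2, y3; split; first by rewrite y10 orbT.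
  by rewrite E1 E2 E3 expr0n !mulr0 !add0r subrr.
have unit d p : (d %| n)%N -> prime p -> ~~ (p %| n)%N -> ~~ (p%:Z %| d%:Z)%Z.
  by move=> dn pp; apply: contra; rewrite dvdzE !absz_nat => pd; apply: dvdn_trans dn.
have Hodd p : prime p -> odd p -> D_padic_pt p e1 e2 e3 n%:Z (d1%:Z, d2%:Z, d3%:Z).
  move=> pp op; have [pn|pn] := boolP (p %| n)%N; first exact: Hp.
  have [pe|pe] := boolP (p%:Z %| e1 * e2 * e3)%Z; last first.
    move: pe; rewrite !prime_dvdzM // !negb_or => /andP[/andP[pe1 pe2] pe3].
    by apply: D_padic_good => //; apply: unit.
  by apply: D_padic_quadres => //; try exact: unit; apply: nres.
have sqd d : (d %| n)%N -> sqfree d%:Z by move=> dn; apply: sqfree_dvd sn; rewrite dvdzE.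
split; rewrite /t1 /t2 /t3 /=; try exact: sqd; first by [].
split=> // p pp; case: (even_prime pp) => [->|op]; last exact: Hodd.
have od d : (d %| n)%N -> ~~ (2 %| d%:Z)%Z by move=> dn; apply: (unit d 2%N) => //; rewrite dvdn2 on.
by apply: D_padic_two => //; apply: od.
Qed.

(** * The conditions at the primes dividing n as rows of the matrix *)

Variable ps : seq nat.
Hypotheses (ups : uniq ps) (pps : all prime ps) (En : n = (\prod_(p <- ps) p)%N).

Let ps_prime p : p \in ps -> prime p. Proof. by move=> /(allP pps). Qed.

Let ps_dvd p : p \in ps -> (p %| n)%N.
Proof. by move=> pin; rewrite En (big_rem p) //= dvdn_mulr. Qed.

Let ps_odd p : p \in ps -> odd p.
Proof. by move=> /ps_dvd pn; apply: dvdn_odd on. Qed.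

Let ps_mem p : prime p -> (p %| n)%N -> p \in ps.
Proof.
by move=> pp; rewrite En; apply: prod_primes_dvd.
Qed.

Let logn_le1 p d : prime p -> (d %| n)%N -> (logn p d <= 1)%N.
Proof.
move=> pp dn; rewrite leqNgt -pfactor_dvdn ?(dvdn_gt0 n0) //.
apply: contra (sqfree_dvd2 pp sn) => pd; rewrite dvdzE !absz_nat; exact: dvdn_trans dn.
Qed.

Let ndvd_cofactor p : p \in ps -> ~~ (p %| n %/ p)%N.
Proof.
move=> pin; apply: contra (sqfree_dvd2 (ps_prime pin) sn) => H.
by rewrite dvdzE !absz_nat -mulnn -(divnK (ps_dvd pin)) dvdn_mul.
Qed.

Lemma dvd_n_prod d : (d %| n)%N -> d = (\prod_(q <- ps) q ^ logn q d)%N.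
Proof.
move=> dn; have d0 := dvdn_gt0 n0 dn.
rewrite {1}[d]prod_prime_decomp // prime_decompE big_map /=.
rewrite [RHS](bigID (mem (primes d))) /= [X in (_ * X)%N]big1_seq ?muln1; last first.
  by move=> q /andP[qd _]; rewrite -logn_gt0 -eqn0Ngt in qd; rewrite (eqP qd).
rewrite -[RHS]big_filter; apply: perm_big; apply: uniq_perm; [exact: primes_uniq|exact: filter_uniq|].
move=> q; rewrite mem_filter /=; case: (boolP (q \in primes d)) => //=.
by rewrite mem_primes => /and3P[pq _ qd]; rewrite ps_mem // (dvdn_trans qd).
Qed.

(* The diagonal entry of A at p is [p, -n]_p = [(n / p) / p], whence the factor n / p. *)
Definition adjusted (p d : nat) : nat :=
  (\prod_(q <- ps) (if q == p then n %/ p else q) ^ logn q d)%N.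

(** [adjusted p d] is d with its factor p, if present, replaced by n / p; the identity says so
    without dividing. *)
Lemma adjustedE p d : p \in ps -> (d %| n)%N ->
  (adjusted p d * p ^ logn p d = d * (n %/ p) ^ logn p d)%N.
Proof.
move=> pin dn; rewrite {3}(dvd_n_prod dn) /adjusted (bigD1_seq p) //= eqxx.
rewrite [in RHS](bigD1_seq p) //= mulnAC [in RHS]mulnC mulnA; congr (_ * _)%N.
by apply: eq_bigr => q /negbTE ->.
Qed.

Lemma sum_hilb_add p d : p \in ps ->
  \sum_(q <- ps) hilb_add p q%:Z (- n%:Z) * (logn q d)%:R = leg_add (adjusted p d)%:Z p /\
  ~~ (p %| adjusted p d)%N.
Proof.
move=> pin; have pp := ps_prime pin; have op := ps_odd pin; have p0 := prime_gt0 pp.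
have H q : q \in ps -> ~~ (p %| if q == p then n %/ p else q)%N.
  move=> qin; case: eqP => [_|/eqP qp]; first exact: ndvd_cofactor.
  by rewrite dvdn_prime2 ?ps_prime // eq_sym.
have [<- ?] := leg_add_prod (logn^~ d) pp op H; split=> //.
apply: eq_big_seq => q qin; congr (_ * _); apply: hilb_add_eq_leg => //.
have sNn : sqfree (- n%:Z) by case: sn => _ sq; split; rewrite ?oppr_eq0 ?abszN.
case: eqP => [->|/eqP qp].
  have -> : - n%:Z = - (p%:Z * (n %/ p)%N%:Z) by rewrite -PoszM mulnC divnK // ps_dvd.
  by apply: hilb_solv_prime => //; rewrite dvdzE !absz_nat ndvd_cofactor.
apply: hilb_solv_unit => //; first by rewrite dvdzE abszN !absz_nat ps_dvd.
by rewrite dvdzE !absz_nat dvdn_prime2 ?ps_prime // eq_sym.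
Qed.

(** The valuations of d1 and d2 at p single out the torsion point whose translate is a unit there.
    In each of the four cases the two sums are the Legendre symbols of the first two entries of that
    translate, with n / p absorbed in [adjusted]. *)
Lemma D_padic_row p (d1 d2 d3 : nat) : p \in ps -> (d1 %| n)%N -> (d2 %| n)%N -> (d3 %| n)%N ->
  is_sq (d1%:Z * d2%:Z * d3%:Z) ->
  D_padic_pt p e1 e2 e3 n%:Z (d1%:Z, d2%:Z, d3%:Z) <->
  leg_add (adjusted p d1)%:Z p + leg_add (- e3) p * (logn p d1)%:R
    + leg_add (- (e2 * e3)) p * (logn p d2)%:R = 0 /\
  leg_add (- (e1 * e3)) p * (logn p d1)%:R +
    (leg_add (adjusted p d2)%:Z p + leg_add e3 p * (logn p d2)%:R) = 0.
Proof.
move=> pin dn1 dn2 dn3 sq; have pp := ps_prime pin; have op := ps_odd pin; have p0 := prime_gt0 pp.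
have pn : (p%:Z %| n%:Z)%Z by rewrite dvdzE !absz_nat ps_dvd.
have pe1 : ~~ (p%:Z %| e1)%Z := coprimez_ndvd pp cop1 pn.
have pe2 : ~~ (p%:Z %| e2)%Z := coprimez_ndvd pp cop2 pn.
have pe3 : ~~ (p%:Z %| e3)%Z := coprimez_ndvd pp cop3 pn.
have nN x : ~~ (p%:Z %| x)%Z -> ~~ (p%:Z %| - x)%Z by rewrite !dvdzE abszN.
have nM x y : ~~ (p%:Z %| x)%Z -> ~~ (p%:Z %| y)%Z -> ~~ (p%:Z %| x * y)%Z.
  by move=> px py; rewrite prime_dvdzM // negb_or px.
have dnz d : (d %| n)%N -> d%:Z != 0 by move=> /dvdn_gt0 - /(_ n0); lia.
have [_ pa1] := sum_hilb_add d1 pin; have [_ pa2] := sum_hilb_add d2 pin.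
have PoszX (a k : nat) : (a ^ k)%N%:Z = a%:Z ^+ k.
  by elim: k => // k IH; rewrite expnS exprS PoszM IH.
have adj d : (d %| n)%N -> (adjusted p d)%:Z * p%:Z ^+ logn p d = d%:Z * (n %/ p)%N%:Z ^+ logn p d.
  by move=> /(adjustedE pin) /(congr1 Posz); rewrite !PoszM !PoszX.
have A1 := adj _ dn1; have A2 := adj _ dn2.
have {}pa1 : ~~ (p%:Z %| (adjusted p d1)%:Z)%Z by rewrite dvdzE.
have {}pa2 : ~~ (p%:Z %| (adjusted p d2)%:Z)%Z by rewrite dvdzE.
have En' : n%:Z = p%:Z * (n %/ p)%N%:Z by rewrite -PoszM mulnC divnK // ps_dvd.
move: A1 A2 pa1 pa2 (logn_le1 pp dn1) (logn_le1 pp dn2).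
move: (adjusted p d1)%:Z (adjusted p d2)%:Z => g1 g2.
have crit (T : triple) (c1 c2 : int) : T \in tors_img e1 e2 e3 n%:Z ->
    ~~ (p%:Z %| c1)%Z -> ~~ (p%:Z %| c2)%Z ->
    is_sq (d1%:Z * c1 * t1 T) -> is_sq (d2%:Z * c2 * t2 T) ->
    D_padic_pt p e1 e2 e3 n%:Z (d1%:Z, d2%:Z, d3%:Z) <-> leg_add c1 p = 0 /\ leg_add c2 p = 0.
  move=> Tin pc1 pc2 Q1 Q2.
  have E := D_padic_translated pp op pn Tin (dnz _ dn1) (dnz _ dn2) (dnz _ dn3) sq pc1 pc2 Q1 Q2.
  by apply: (iff_trans E); split=> -[? ?]; split; apply/leg_addP.
case: (logn p d1) => [|[|//]]; case: (logn p d2) => [|[|//]]; rewrite ?expr0 ?expr1 ?mulr0 ?mulr1 ?addr0 ?add0r;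
  move=> A1 A2 pg1 pg2 _ _.
- rewrite A1 A2 in pg1 pg2 *.
  apply: (crit (1, 1, 1)) => //.
  + by exists d1%:Z; rewrite mulr1.
  + by exists d2%:Z; rewrite mulr1.
- rewrite A1 in pg1 *; rewrite -!leg_addM //; try by rewrite ?nN ?nM.
  apply: (crit (- (e2 * e3), e3 * n%:Z, - (e2 * n%:Z))); rewrite ?nM ?nN ?nM //.
  + by rewrite !inE eqxx !orbT.
  + by exists (d1%:Z * (e2 * e3)); rewrite /t1 /=; ring.
  + exists (d2%:Z * (n %/ p)%N%:Z * e3); rewrite /t2 /= {1}En'.
    by transitivity (d2%:Z * (n %/ p)%N%:Z * e3 * e3 * (g2 * p%:Z)); [ring|rewrite A2; ring].
- rewrite A2 in pg2 *; rewrite -!leg_addM //; try by rewrite ?nN ?nM.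
  apply: (crit (- (e3 * n%:Z), - (e1 * e3), e1 * n%:Z)); rewrite ?nM ?nN ?nM //.
  + by rewrite !inE eqxx !orbT.
  + exists (d1%:Z * (n %/ p)%N%:Z * e3); rewrite /t1 /= {1}En'.
    by transitivity (d1%:Z * (n %/ p)%N%:Z * e3 * e3 * (g1 * p%:Z)); [ring|rewrite A1; ring].
  + by exists (d2%:Z * (e1 * e3)); rewrite /t2 /=; ring.
(* When p divides both d1 and d2, the factors e3 pair up: -e3 times -e2 e3 is e2, and e3 times -e1
   e3 is -e1, modulo squares; these are the entries of the point (e2 n, -e1 n, -e1 e2) up to n. *)
- rewrite -!leg_addM //; try by rewrite ?nM ?nN ?nM.
  apply: (crit (e2 * n%:Z, - (e1 * n%:Z), - (e1 * e2))); rewrite ?nM ?nN ?nM //.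
  + by rewrite !inE eqxx !orbT.
  + exists (d1%:Z * (n %/ p)%N%:Z * (e2 * e3)); rewrite /t1 /= {1}En'.
    by transitivity (d1%:Z * (n %/ p)%N%:Z * (e2 * e3) * (e2 * e3) * (g1 * p%:Z)); [ring|rewrite A1; ring].
  + exists (d2%:Z * (n %/ p)%N%:Z * (e1 * e3)); rewrite /t2 /= {1}En'.
    by transitivity (d2%:Z * (n %/ p)%N%:Z * (e1 * e3) * (e1 * e3) * (g2 * p%:Z)); [ring|rewrite A2; ring].
Qed.

Lemma ker_rows (d1 d2 d3 : nat) :
  Mmat ps n e1 e2 e3 *m xyvec ps (d1%:Z, d2%:Z, d3%:Z) = 0 <->
  forall p, p \in ps ->
  leg_add (adjusted p d1)%:Z p + leg_add (- e3) p * (logn p d1)%:R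
    + leg_add (- (e2 * e3)) p * (logn p d2)%:R = 0 /\
  leg_add (- (e1 * e3)) p * (logn p d1)%:R +
    (leg_add (adjusted p d2)%:Z p + leg_add e3 p * (logn p d2)%:R) = 0.
Proof.
have row (d : nat) (i : 'I_(size ps)) :
    (Amat ps n *m \col_(j < size ps) (logn (nth 0%N ps j) d)%:R) i 0 =
    leg_add (adjusted (nth 0%N ps i) d)%:Z (nth 0%N ps i).
  have [<- _] := sum_hilb_add d (mem_nth 0%N (ltn_ord i)).
  rewrite mxE (big_nth 0%N) big_mkord; apply: eq_bigr => j _; by rewrite !mxE.
have diag u (d : nat) (i : 'I_(size ps)) :
    (Dmat ps u *m \col_(j < size ps) (logn (nth 0%N ps j) d)%:R) i 0 =
    leg_add u (nth 0%N ps i) * (logn (nth 0%N ps i) d)%:R.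
  by rewrite /Dmat mul_diag_mx !mxE.
have addE (A B : 'cV['F_2]_(size ps)) i : (A + B) i 0 = A i 0 + B i 0 by rewrite mxE.
have zeroE i : (0 : 'cV['F_2]_(size ps)) i 0 = 0 by rewrite mxE.
rewrite /Mmat /xyvec /t1 /t2 /= mul_block_col !mulmxDl; split.
  move=> /eqP; rewrite col_mx_eq0 => /andP[/eqP/matrixP E1 /eqP/matrixP E2] p pin.
  have pi : (index p ps < size ps)%N by rewrite index_mem.
  have := E1 (Ordinal pi) 0; have := E2 (Ordinal pi) 0.
  by rewrite !addE !row !diag !zeroE /= nth_index.
move=> H; apply/eqP; rewrite col_mx_eq0; apply/andP; split; apply/eqP/matrixP => i j; rewrite ord1;
  have [E1 E2] := H _ (mem_nth 0%N (ltn_ord i)); by rewrite !addE !row !diag !zeroE.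
Qed.

Lemma Sel2_ker (d1 d2 d3 : nat) : (d1 %| n)%N -> (d2 %| n)%N -> (d3 %| n)%N ->
  is_sq (d1%:Z * d2%:Z * d3%:Z) ->
  Sel2 e1 e2 e3 n%:Z (d1%:Z, d2%:Z, d3%:Z) <->
  Mmat ps n e1 e2 e3 *m xyvec ps (d1%:Z, d2%:Z, d3%:Z) = 0.
Proof.
move=> dn1 dn2 dn3 sq; split.
  move=> [_ _ _ _ [_ Hp]]; apply/ker_rows => p pin; apply/(D_padic_row pin dn1 dn2 dn3 sq).
  exact: Hp (ps_prime pin).
move=> /ker_rows H; apply: Sel2_of_local => // p pp pn.
by apply/(D_padic_row (ps_mem pp pn) dn1 dn2 dn3 sq); apply: H; apply: ps_mem.
Qed.

(** * Divisors of n and their exponent vectors *)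

Let logn_prod (k : 'I_(size ps) -> nat) (j : 'I_(size ps)) :
  logn (nth 0%N ps j) (\prod_(i < size ps) nth 0%N ps i ^ k i) = k j.
Proof.
have pr i : prime (nth 0%N ps (i : 'I_(size ps))) by apply: ps_prime; apply: mem_nth.
have [-> _] : logn (nth 0%N ps j) (\prod_(i < size ps) nth 0%N ps i ^ k i) =
   (\sum_(i < size ps) k i * (j == i))%N /\ (0 < \prod_(i < size ps) nth 0%N ps i ^ k i)%N.
  apply: (big_ind2 (fun a b => logn (nth 0%N ps j) a = b /\ (0 < a)%N)); first by rewrite logn1.
    by move=> a b c d [<- a0] [<- c0]; rewrite lognM // muln_gt0 a0.
  move=> i _; rewrite lognX logn_prime // nth_uniq // expn_gt0 prime_gt0 //.
by rewrite (bigD1 j) //= eqxx muln1 big1 ?addn0 // => i /negbTE ij; rewrite eq_sym ij muln0.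
Qed.

Let En_ord : n = (\prod_(i < size ps) nth 0%N ps i)%N.
Proof. by rewrite En (big_nth 0%N) big_mkord. Qed.

Lemma xyvec_surj (v : 'cV['F_2]_(size ps + size ps)) :
  exists d1 d2 d3 : nat, [/\ (d1 %| n)%N, (d2 %| n)%N, (d3 %| n)%N,
    is_sq (d1%:Z * d2%:Z * d3%:Z) & xyvec ps (d1%:Z, d2%:Z, d3%:Z) = v].
Proof.
pose P (k : 'I_(size ps) -> nat) := (\prod_(i < size ps) nth 0%N ps i ^ k i)%N.
have Pdvd k : (forall i, k i <= 1)%N -> (P k %| n)%N.
  move=> k1; rewrite En_ord; apply: (big_ind2 dvdn) => // [a b c d|i _]; first exact: dvdn_mul.
  by have := k1 i; case: (k i) => [|[|]].
have F2le (x : 'F_2) : (x <= 1)%N by have := ltn_ord x; rewrite ltnS.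
pose x (i : 'I_(size ps)) : 'F_2 := usubmx v i 0; pose y (i : 'I_(size ps)) : 'F_2 := dsubmx v i 0.
exists (P (fun i => x i)), (P (fun i => y i)), (P (fun i => (x i + y i)%R)).
split; try by apply: Pdvd => i; apply: F2le.
  (* The third exponent is a sum in ['F_2]; for bits, x + y + (x + y mod 2) = 2 max (x, y), which
     gives the square root. *)
  exists (P (fun i => maxn (x i) (y i)))%:Z; rewrite -!PoszM; congr Posz.
  rewrite /P -!big_split /=; apply: eq_bigr => i _; rewrite -!expnD; congr (_ ^ _)%N.
  by move: (x i) (y i) => [[|[|?]] ?] [[|[|?]] ?].
rewrite /xyvec /t1 /t2 /= -[RHS]vsubmxK; congr col_mx; apply/matrixP => i j;
  by rewrite ord1 mxE logn_prod natr_Zp.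
Qed.

Let F2_natr (a b : nat) : a%:R = b%:R :> 'F_2 -> odd a = odd b.
Proof. by move=> /(congr1 val); rewrite /= !val_Fp_nat // !modn2; case: odd; case: odd. Qed.

Lemma parv_dvd_n (d : int) (p : nat) : (`|d| %| n)%N -> prime p -> p \notin ps -> parv p d = false.
Proof.
move=> dn pp pin; apply: parv_coprime; apply: contra pin; rewrite dvdzE absz_nat => pd.
by apply: ps_mem => //; apply: dvdn_trans dn.
Qed.

Lemma xyvec_inj (L L' : triple) : pos_div_rep n L -> pos_div_rep n L' ->
  is_sq (t1 L * t2 L * t3 L) -> is_sq (t1 L' * t2 L' * t3 L') ->
  xyvec ps L = xyvec ps L' -> same_cls' e1 e2 e3 n%:Z L L'.
Proof.
move=> [p1 p2 p3 [v1 v2 v3]] [p1' p2' p3' [v1' v2' v3']] sq sq' /eq_col_mx[/matrixP E1 /matrixP E2].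
have pnz x : 0 < x -> x != 0 :> int by move=> /lt0r_neq0.
have S (d d' : int) : 0 < d -> 0 < d' -> (`|d| %| n)%N -> (`|d'| %| n)%N ->
   (forall i : 'I_(size ps), (logn (nth 0%N ps i) `|d|)%:R = (logn (nth 0%N ps i) `|d'|)%:R :> 'F_2) ->
   is_sq (d * d').
  move=> d0 d0' dn dn' H; apply/is_sqP; first by rewrite mulf_neq0 ?pnz.
  split; first exact: mulr_gt0.
  move=> p pp; rewrite parvM ?pnz //; have [pin|pin] := boolP (p \in ps); last by rewrite !parv_dvd_n.
  have pi : (index p ps < size ps)%N by rewrite index_mem.
  by have /F2_natr := H (Ordinal pi); rewrite /= nth_index // /parv => ->; rewrite addbb.
have Q1 : is_sq (t1 L * t1 L') by apply: S => // i; have := E1 i 0; rewrite !mxE.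
have Q2 : is_sq (t2 L * t2 L') by apply: S => // i; have := E2 i 0; rewrite !mxE.
exists (1, 1, 1); first by rewrite inE eqxx.
rewrite /prod_cls [t1 (1, _, _)]/(1 : int) [t2 (_, 1, _)]/(1 : int) [t3 (_, _, 1)]/(1 : int) !mulr1.
split=> //; apply: is_sq_divl (is_sq_mul Q1 Q2) _; first by rewrite !mulf_neq0 ?pnz.
by have := is_sq_mul sq sq'; congr (is_sq _); ring.
Qed.

(** The product relation holds only up to torsion, but positive entries prime to 2 e1 e2 e3 force
    the torsion class to be trivial, so valuations add modulo 2. *)
Lemma xyvec_add (L1 L2 L3 : triple) : pos_div_rep n L1 -> pos_div_rep n L2 -> pos_div_rep n L3 ->
  prod_cls' e1 e2 e3 n%:Z L1 L2 L3 -> xyvec ps L3 = xyvec ps L1 + xyvec ps L2.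
Proof.
move=> [p1 p2 _ [v1 v2 _]] [p1' p2' _ [v1' v2' _]] [p1'' p2'' _ [v1'' v2'' _]] [T Tin [Q1 Q2 _]].
have pnz x : 0 < x -> x != 0 :> int by move=> /lt0r_neq0.
have ET : T = (1, 1, 1).
  by apply: pos_div_rep_tors Tin Q1 Q2; rewrite ?mulr_gt0 ?coprimezMl ?dvd_n_coprime.
move: Q1 Q2; rewrite ET [t1 (1, _, _)]/(1 : int) [t2 (_, 1, _)]/(1 : int) !mulr1 => Q1 Q2.
rewrite /xyvec add_col_mx.
have S (a b c : int) : 0 < a -> 0 < b -> 0 < c -> is_sq (a * b * c) -> forall p, prime p ->
   (logn p `|c|)%:R = (logn p `|a|)%:R + (logn p `|b|)%:R :> 'F_2.
  move=> a0 b0 c0 /is_sqP - []; first by rewrite !mulf_neq0 ?pnz.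
  move=> _ H p pp; have := H p pp; rewrite !parvM ?mulf_neq0 ?pnz // /parv => E.
  rewrite -natrD; apply/val_inj; rewrite /= !val_Fp_nat // !modn2 oddD.
  by move: E; case: odd; case: odd; case: odd.
congr col_mx; apply/matrixP => i j; rewrite !mxE; apply: S => //; apply: ps_prime; exact: mem_nth.
Qed.

End Twist.

Theorem theorem3p3 (e1 e2 e3 : int) (n : nat) (ps : seq nat) :
  e1 != 0 -> e2 != 0 -> e3 != 0 -> e1 + e2 + e3 = 0 ->
  gcdz (gcdz e1 e2) e3 \in [:: 1; 2] ->
  ~~ (2 %| e1)%Z -> ~~ (2 %| e2)%Z -> (2 %| e3)%Z -> ~~ (4 %| e3)%Z ->
  (* n = p_1 ... p_k odd, positive, square-free *)
  uniq ps -> all prime ps -> n = (\prod_(p <- ps) p)%N -> odd n ->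
  coprime n (absz (e1 * e2 * e3)%R) ->
  (forall p q : nat, p \in ps -> prime q -> odd q -> (q %| absz (e1 * e2 * e3)%R)%N ->
     exists x : nat, x ^ 2 = p %[mod q]) ->
  (* Sel_2(E/Q) is isomorphic to (Z/2Z)^2 *)
  (exists f : triple -> 'rV['F_2]_2,
     [/\ (forall L L', Sel2 e1 e2 e3 1 L -> Sel2 e1 e2 e3 1 L' -> f L = f L' -> L = L'),
         (forall v, exists2 L, Sel2 e1 e2 e3 1 L & f L = v) &
         (forall L1 L2 L3, Sel2 e1 e2 e3 1 L1 -> Sel2 e1 e2 e3 1 L2 ->
            Sel2 e1 e2 e3 1 L3 -> prod_cls L1 L2 L3 -> f L3 = f L1 + f L2)]) ->
  (* unique representatives with positive divisors of n *)
  (forall L, Sel2 e1 e2 e3 n%:Z L ->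
     exists! L', [/\ Sel2 e1 e2 e3 n%:Z L', pos_div_rep n L' &
                     same_cls' e1 e2 e3 n%:Z L L']) /\
  (* the induced map Sel_2'(E^{(n)}) -> ker M is an isomorphism *)
  (forall L, Sel2 e1 e2 e3 n%:Z L -> pos_div_rep n L ->
     Mmat ps n e1 e2 e3 *m xyvec ps L = 0) /\
  (forall L L', Sel2 e1 e2 e3 n%:Z L -> pos_div_rep n L ->
     Sel2 e1 e2 e3 n%:Z L' -> pos_div_rep n L' ->
     xyvec ps L = xyvec ps L' -> same_cls' e1 e2 e3 n%:Z L L') /\
  (forall v : 'cV['F_2]_(size ps + size ps), Mmat ps n e1 e2 e3 *m v = 0 ->
     exists2 L, Sel2 e1 e2 e3 n%:Z L /\ pos_div_rep n L & xyvec ps L = v) /\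
  (forall L1 L2 L3, Sel2 e1 e2 e3 n%:Z L1 -> pos_div_rep n L1 ->
     Sel2 e1 e2 e3 n%:Z L2 -> pos_div_rep n L2 ->
     Sel2 e1 e2 e3 n%:Z L3 -> pos_div_rep n L3 ->
     prod_cls' e1 e2 e3 n%:Z L1 L2 L3 ->
     xyvec ps L3 = xyvec ps L1 + xyvec ps L2).
Proof.
move=> n1 n2 n3 Es _ o1 o2 e3_2 e3_4 ups pps En on cop res [f [finj _ _]].
have sn : sqfree n%:Z by rewrite En; apply: sqfree_prod_primes.
have copz : coprimez n%:Z (e1 * e2 * e3) by rewrite coprimezE.
have nres (q d : nat) : prime q -> odd q -> (q%:Z %| e1 * e2 * e3)%Z -> (d %| n)%N -> quadres q d%:Z.
  move=> pq oq qe; rewrite En; apply: quadres_dvd_prod => // p pin.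
  have [x Ex] := res p q pin pq oq qe.
  by exists x%:Z; rewrite -eqz_mod_dvd expr2 -PoszM mulnn !modz_nat Ex.
have Sel1 L : Sel2 e1 e2 e3 1 L -> exists2 T, T \in tors_img e1 e2 e3 1 & prod_cls (1, 1, 1) L T.
  exact: (Sel2_eq_tors Es o1 o2 e3_2 e3_4 finj).
have nz : n%:Z != 0 by move: (odd_gt0 on); lia.
have posE L : pos_div_rep n L -> exists d1 d2 d3 : nat,
    [/\ L = (d1%:Z, d2%:Z, d3%:Z), (d1 %| n)%N, (d2 %| n)%N & (d3 %| n)%N].
  case: L => [[a b] c] [p1 p2 p3 [v1 v2 v3]]; exists `|a|%N, `|b|%N, `|c|%N.
  by split=> //; rewrite !gez0_abs ?ltW.
have uniqrep := pos_div_rep_uniq Es o1 o2 e3_2 e3_4 on copz.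
split; [|split; [|split; [|split]]].
- move=> L SL; have [L' [SL' PL' LL']] := Sel2_rep_exists Es o1 o2 e3_2 e3_4 on sn copz nres Sel1 SL.
  exists L'; split=> // L'' [SL'' PL'' LL'']; apply: uniqrep => //.
  have [[a1 _] [a2 _] [a3 _] _ _] := SL.
  by apply: same_cls_trans (same_cls_sym LL') LL''.
- move=> L SL /posE[d1 [d2 [d3 [EL v1 v2 v3]]]]; rewrite EL in SL *.
  have [_ _ _ sq _] := SL.
  by apply/(Sel2_ker Es o1 o2 e3_2 e3_4 on sn copz nres ups pps En v1 v2 v3 sq).
- move=> L L' SL PL SL' PL' E; have [_ _ _ sq _] := SL; have [_ _ _ sq' _] := SL'.
  by apply: xyvec_inj E.
- move=> v Hv; have [d1 [d2 [d3 [v1 v2 v3 sq Ev]]]] := xyvec_surj ups pps En v.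
  exists (d1%:Z, d2%:Z, d3%:Z) => //; split; last first.
    by have n0 := odd_gt0 on; split; rewrite /t1 /t2 /t3 /= ?ltz_nat ?(dvdn_gt0 n0).
  by apply/(Sel2_ker Es o1 o2 e3_2 e3_4 on sn copz nres ups pps En v1 v2 v3 sq); rewrite Ev.
- move=> L1 L2 L3 _ P1 _ P2 _ P3 HP.
  exact: (xyvec_add Es o1 o2 e3_2 e3_4 on copz pps P1 P2 P3 HP).
Qed.
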